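(* Let $\Lambda$ and $\Lambda'$ be two Bedford--McMullen carpets with non-uniform fibres which are bi-Lipschitz equivalent, and let $\nu$ and $\nu'$ be the corresponding uniform Bernoulli measures. Then $f_{\nu}(\alpha)=f_{\nu'}(\alpha)$ for all $\alpha\in(\alpha_{\min},\alpha_{\max})$ and $T_{\nu}(q)=T_{\nu'}(q)$ for all $q\in\mathbb R$. Moreover both carpets can be defined on the same $m\times n$ grid, and for the parameters of the two carpets on this grid (with $\gamma=\log n/\log m$) one has $M_0=M_0'$ and $N_i/N_i'=(R_i'/R_i)^{\gamma}=(M'/M)^{\gamma}$ for all $i=1,\dots,M_0$.
   Context: Carpets. A Bedford--McMullen carpet $\Lambda$ on an $m\times n$ grid ($n>m\ge2$ integers) is the unique non-empty compact set with $\Lambda=\bigcup_{(i,j)\in\mathcal A}f_{(i,j)}(\Lambda)$, where $\mathcal A\subseteq\{1,\dots,m\}\times\{1,\dots,n\}$ is non-empty and $f_{(i,j)}(x,y)=\left(\frac{x+i-1}{m},\frac{y+j-1}{n}\right)$. A set ''can be defined on an $m\times n$ grid'' if it is the attractor of some such iterated function system with those $m,n$. $\gamma=\log n/\log m$. A column $i$ is non-empty if $(i,j)\in\mathcal A$ for some $j$; the number of maps in it is the number of such $j$. $M>1$ is the number of non-empty columns and $N=\#\mathcal A$. $M_0$ is the number of distinct values taken by the number of maps in a non-empty column; these values are ordered as $N_1>N_2>\dots>N_{M_0}$, and $R_i$ is the number of columns containing exactly $N_i$ maps. Non-uniform fibres means $M_0\ge2$. Primed parameters are those of $\Lambda'$.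 Two metric spaces $X,Y$ are bi-Lipschitz equivalent if there are a surjection $f:X\to Y$ and $C\ge1$ with $C^{-1}d_X(x,y)\le d_Y(f(x),f(y))\le C\,d_X(x,y)$ for all $x,y\in X$; carpets carry the Euclidean distance. Measures. The uniform Bernoulli (self-affine) measure $\nu$ is the unique Borel probability measure with $\nu(A)=\frac1N\sum_{(i,j)\in\mathcal A}\nu(f_{(i,j)}^{-1}A)$ for all Borel $A$. Its Hausdorff multifractal spectrum is $f_\nu(\alpha)=\dim_{\mathrm H}\{x\in\mathrm{supp}\,\nu:\dim_{\mathrm{loc}}(\nu,x)=\alpha\}$, where $\dim_{\mathrm{loc}}(\nu,x)=\lim_{r\to0}\frac{\log\nu(B(x,r))}{\log r}$ when the limit exists. For $\Lambda$ put $\alpha_{\min}=\frac{\log N}{\log m}-\frac{1-\gamma^{-1}}{\log m}\log N_1$ and $\alpha_{\max}=\frac{\log N}{\log m}-\frac{1-\gamma^{-1}}{\log m}\log N_{M_0}$. The $L^q$ spectrum is $T_\nu(q)=\lim_{\delta\to0^+}\frac{\log T_\delta(\nu,q)}{-\log\delta}$, where $T_\delta(\nu,q)=\sup\{\sum_i(\nu(B_i))^q: B_i$ disjoint balls of radius $\delta$ centred in $\mathrm{supp}(\nu)\}$. *)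

(* Defs.v *)
From HB Require Import structures.
From mathcomp Require Import all_boot all_order all_algebra.
From mathcomp Require Import all_classical all_reals all_analysis.

Set Implicit Arguments.
Unset Strict Implicit.
Unset Printing Implicit Defensive.

Import Order.TTheory GRing.Theory Num.Theory.
Import numFieldNormedType.Exports.

Local Open Scope classical_set_scope.
Local Open Scope ring_scope.

(** The library norm on [R * R] is the sup norm, which induces the same topology
    as the Euclidean distance used here. *)
Definition edist (R : realType) (x y : R * R) : R :=
  Num.sqrt ((x.1 - y.1) ^+ 2 + (x.2 - y.2) ^+ 2).

Definition eball (R : realType) (x : R * R) (r : R) : set (R * R) :=
  [set y | edist x y <= r].

Definition bilipschitz_equiv (R : realType) (X Y : set (R * R)) : Prop :=
  exists (f : R * R -> R * R) (C : R),
    [/\ 1 <= C, f @` X = Y &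
        forall x y, X x -> X y ->
          C^-1 * edist x y <= edist (f x) (f y) <= C * edist x y].

(** The supremum is [-oo] on the empty set and nonnegative otherwise. *)
Definition ediam (R : realType) (U : set (R * R)) : \bar R :=
  ereal_sup [set d | exists x y, [/\ U x, U y & d = (edist x y)%:E]].

(** Empty members of a cover contribute nothing, also for [s = 0], so finite
    covers are included among the sequences [U]. *)
Definition hausdorff_premeasure (R : realType) (s delta : R)
    (F : set (R * R)) : \bar R :=
  ereal_inf [set h | exists U : nat -> set (R * R),
    [/\ F `<=` \bigcup_i U i,
        forall i, (ediam (U i) <= delta%:E)%E &
        h = (\sum_(i <oo | U i != set0) poweR (ediam (U i)) s)%E]].

Definition hausdorff_measure (R : realType) (s : R) (F : set (R * R)) :
    \bar R :=
  ereal_sup [set hausdorff_premeasure s delta F | delta in [set d : R | 0 < d]].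

Definition hausdorff_dim (R : realType) (F : set (R * R)) : \bar R :=
  ereal_inf [set s%:E | s in [set s : R | 0 <= s /\ hausdorff_measure s F = 0%E]].

(** Indices start at 0: column [i : 'I_m] and row [j : 'I_n] are
    the column [i + 1] and row [j + 1] of the usual notation. *)
Definition bm_map (R : realType) (m n : nat) (a : 'I_m * 'I_n) (p : R * R) :
    R * R :=
  ((p.1 + (a.1 : nat)%:R) / m%:R, (p.2 + (a.2 : nat)%:R) / n%:R).

(** By Hutchinson's theorem exactly one set [L] satisfies the last three
    conditions. *)
Definition bm_carpet (R : realType) (m n : nat) (A : {set ('I_m * 'I_n)})
    (L : set (R * R)) : Prop :=
  [/\ (1 < m < n)%N, A != finset.set0, L !=set0, compact L &
      L = \bigcup_(a in [set a | a \in A]) (bm_map a @` L)].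

Definition column_size (m n : nat) (A : {set ('I_m * 'I_n)}) (i : 'I_m) :
    nat :=
  #|[set j | (i, j) \in A]%SET|.

Definition num_columns (m n : nat) (A : {set ('I_m * 'I_n)}) : nat :=
  #|[set i | (0 < column_size A i)%N]%SET|.

Definition column_sizes (m n : nat) (A : {set ('I_m * 'I_n)}) :
    seq nat :=
  sort geq (undup [seq column_size A i | i <- enum 'I_m & (0 < column_size A i)%N]).

Definition num_sizes (m n : nat) (A : {set ('I_m * 'I_n)}) : nat :=
  size (column_sizes A).

(** [size_val k] is N_(k+1) for [k < num_sizes]. *)
Definition size_val (m n : nat) (A : {set ('I_m * 'I_n)}) (k : nat) :
    nat :=
  nth 0%N (column_sizes A) k.

(** [size_mult k] is R_(k+1) for [k < num_sizes]. *)
Definition size_mult (m n : nat) (A : {set ('I_m * 'I_n)}) (k : nat) :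
    nat :=
  #|[set i | column_size A i == size_val A k]%SET|.

Definition nonuniform_fibres (m n : nat) (A : {set ('I_m * 'I_n)}) :
    Prop :=
  (1 < num_sizes A)%N.

Definition bm_gamma (R : realType) (m n : nat) : R := ln n%:R / ln m%:R.

Definition alpha_of (R : realType) (m n : nat) (A : {set ('I_m * 'I_n)})
    (k : nat) : R :=
  ln #|A|%:R / ln m%:R
    - (1 - (bm_gamma R m n)^-1) / ln m%:R * ln (size_val A k)%:R.

Definition alpha_min (R : realType) (m n : nat) (A : {set ('I_m * 'I_n)}) : R :=
  alpha_of R A 0.

Definition alpha_max (R : realType) (m n : nat) (A : {set ('I_m * 'I_n)}) : R :=
  alpha_of R A (num_sizes A).-1.

(** The product sigma-algebra on [R * R] is the Borel sigma-algebra of the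
    plane. *)
Definition uniform_bernoulli (R : realType) (m n : nat)
    (A : {set ('I_m * 'I_n)}) (nu : probability (R * R)%type R) : Prop :=
  forall B : set (R * R), measurable B ->
    nu B = ((#|A|%:R^-1)%:E * \sum_(a in A) nu (bm_map a @^-1` B))%E.

Definition msupport (R : realType) (nu : probability (R * R)%type R) :
    set (R * R) :=
  [set x | forall r : R, 0 < r -> (0 < nu (eball x r))%E].

Definition has_local_dim (R : realType) (nu : probability (R * R)%type R)
    (x : R * R) (alpha : R) : Prop :=
  ln (fine (nu (eball x r))) / ln r @[r --> 0^'+] --> alpha.

Definition multifractal_spectrum (R : realType)
    (nu : probability (R * R)%type R) (alpha : R) : \bar R :=
  hausdorff_dim [set x | msupport nu x /\ has_local_dim nu x alpha].

(** A packing is given by the sequence of the centres of its balls; it is finite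
    whenever the support is bounded. *)
Definition ball_packing (R : realType) (nu : probability (R * R)%type R)
    (delta : R) (s : seq (R * R)) : Prop :=
  (forall x, x \in s -> msupport nu x) /\
  trivIset `I_(size s) (fun i => eball (nth (0, 0) s i) delta).

Definition Lq_moment (R : realType) (nu : probability (R * R)%type R)
    (q delta : R) : \bar R :=
  ereal_sup [set (\sum_(x <- s) poweR (nu (eball x delta)) q)%E |
             s in [set s | ball_packing nu delta s]].

Definition is_Lq_spectrum (R : realType) (nu : probability (R * R)%type R)
    (T : R -> R) : Prop :=
  forall q : R,
    (lne (Lq_moment nu q delta) * ((- ln delta)^-1)%:E)%E @[delta --> 0^'+]
      --> (T q)%:E.

(* Main.v *)
Require Import Defs.
From HB Require Import structures.
From mathcomp Require Import all_boot all_order all_algebra.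
From mathcomp Require Import all_classical all_reals all_analysis.
From mathcomp Require Import measurable_realfun.
From mathcomp Require Import zify ring lra.

Set Implicit Arguments.
Unset Strict Implicit.
Unset Printing Implicit Defensive.

Import Order.TTheory GRing.Theory Num.Theory.
Import numFieldNormedType.Exports.
Import Defs.

Local Open Scope classical_set_scope.
Local Open Scope ring_scope.

(** Two carpets that are bi-Lipschitz equivalent must carry comparable uniform
    measures, and a measure of this kind remembers its grid.

    The measure counts squares. A cell of level [k] has mass [#|A| ^- k] and size
    [m ^- k] by [n ^- k]; subdividing only its columns [e] times, with
    [m ^ (k + e)] comparable to [n ^ k], gives approximate squares, and every cell
    of level [k] contains the same number of them. So the mass of a ball is, up to
    constants, the proportion of the approximate squares of a very small side
    [delta] that it meets. A bi-Lipschitz map changes such counts by bounded factors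
    only ([transfer_count]), hence the masses of corresponding balls are comparable
    ([mass_eball_comparison]). Therefore it preserves local dimensions, and since it
    also preserves Hausdorff dimensions, the two multifractal spectra agree
    ([multifractal_spectrum_le]).

    The moments of the masses of the approximate squares are explicit
    ([box_moment]), and they are comparable to those of packings by balls, from
    above ([moment_upper]) because a ball meets few squares, and from below
    ([moment_lower]) because a square contains the centre of a ball that is as heavy
    as the square. Thus the L^q spectrum is [Lq_exponent], an expression in the
    logarithm of [psi q], the sum of the [q]-th powers of the numbers of maps in the
    columns. By the comparison of masses it is the same function for both carpets
    ([Lq_exponent_le]).

    That function determines the parameters once the grid is known: on one grid it
    says that [psi] and [psi'] have a quotient of the form [rho * kappa ^ q], and as
    distinct exponentials are independent, the column sizes of one carpet are [kappa]
    times those of the other, with multiplicities in the ratio [rho]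
    ([same_grid_parameters]).

    To find a common grid, first compare [gamma = ln n / ln m] with [gamma'].
    Prescribe a point of [L] whose digits give approximate squares as light as
    possible at one scale and as heavy as possible at a much finer one. The two
    ranges of abscissa digits are disjoint when the logarithm of the second scale is
    at least [gamma] times that of the first ([two_scale_point]). The image point has
    extreme masses at the same scales, but in [L'] the two ranges of digits would
    overlap more and more if [gamma'] exceeded [gamma], and a digit in the overlap
    would have to lie in a poorest and in a richest column at once
    ([bounded_overlap], [log_ratio_le]). By symmetry [gamma = gamma'].

    Then [m'] and [n'] are the powers of [m] and [n] with exponent
    [beta = ln m' / ln m], and the equality of the exponents becomes
    [psi ^ beta = exp(affine) * psi']. Such a relation between Dirichlet polynomials
    persists if [v ^ q] is multiplied by [exp (s * lam v)] for a completely additive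
    function [lam], for instance a [p]-adic valuation ([dirichlet_power_deform]);
    comparing the behaviour at [q = 0] and at infinity shows that [beta] is rational
    ([dirichlet_power_rational]). Hence [m ^ s = m' ^ t] and [n ^ s = n' ^ t] for some
    positive [s] and [t]. Iterating the two systems [s] and [t] times puts the
    carpets on this grid without changing the measures ([iterate_carpet],
    [iterate_bernoulli]). Because a carpet with non-uniform fibres has a point in the
    open unit square, its digit set on a given grid is unique
    ([carpet_set_unique]), so the conclusion holds for all descriptions of the two
    carpets on that grid. *)

(** * Words over an alphabet *)

Fixpoint words (T : Type) (s : seq T) (k : nat) : seq (seq T) :=
  if k is k'.+1 then [seq a :: w | a <- s, w <- words s k'] else [:: [::]].

Lemma size_words (T : Type) (s : seq T) k : size (words s k) = (size s ^ k)%N.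
Proof. by elim: k => // k IH; rewrite /= size_allpairs IH expnS. Qed.

Lemma mem_words (T : eqType) (s : seq T) k w :
  (w \in words s k) = (size w == k) && all (mem s) w.
Proof.
elim: k w => [|k IH] [|a w] //=.
- by apply/allpairsP => -[[b v]] [].
- rewrite eqSS andbCA -IH; apply/allpairsP/andP => [[[b v] [/= hb hv [-> ->]]]|[ha hw]] //.
  by exists (a, w).
Qed.

Lemma words_uniq (T : eqType) (s : seq T) k : uniq s -> uniq (words s k).
Proof.
move=> us; elim: k => // k IH /=.
by apply: allpairs_uniq => // -[a w] [b v] _ _ [-> ->].
Qed.

Lemma big_words_cons (V : nmodType) (T : Type) (s : seq T) k (F : seq T -> V) :
  \sum_(w <- words s k.+1) F w = \sum_(a <- s) \sum_(w <- words s k) F (a :: w).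
Proof. by rewrite /= big_allpairs_dep. Qed.

Lemma big_words_cat (V : nmodType) (T : Type) (s : seq T) k e (F : seq T -> V) :
  \sum_(w <- words s (k + e)) F w =
  \sum_(u <- words s k) \sum_(v <- words s e) F (u ++ v).
Proof.
elim: k F => [|k IH] F; first by rewrite add0n /= big_seq1.
rewrite addSn !big_words_cons; apply: eq_bigr => a _.
exact: IH.
Qed.

Lemma big_words_prod (K : comPzRingType) (T : Type) (s : seq T) k (g : T -> K) :
  \sum_(w <- words s k) \prod_(a <- w) g a = (\sum_(a <- s) g a) ^+ k.
Proof.
elim: k => [|k IH]; first by rewrite /= big_seq1 big_nil expr0.
rewrite big_words_cons exprS mulr_suml; apply: eq_bigr => a _.
by rewrite -IH mulr_sumr; apply: eq_bigr => w _; rewrite big_cons.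
Qed.

(** * Digit expansions *)

Fixpoint digval (m : nat) (ds : seq nat) : nat :=
  if ds is d :: ds' then (d * m ^ size ds' + digval m ds')%N else 0%N.

Lemma digval_cat m u v :
  digval m (u ++ v) = (digval m u * m ^ size v + digval m v)%N.
Proof.
elim: u => [|d u IH] //=.
by rewrite IH size_cat expnD mulnDl mulnA addnA.
Qed.

Lemma digval_lt m ds : all (gtn m) ds -> (digval m ds < m ^ size ds)%N.
Proof.
elim: ds => [|d ds IH] //= /andP[hd /IH h].
rewrite expnS; apply: (@leq_trans (d.+1 * m ^ size ds)%N); last by rewrite leq_mul2r hd orbT.
by rewrite mulSn addnC ltn_add2r.
Qed.

Lemma digval_inj m u v : size u = size v -> all (gtn m) u -> all (gtn m) v ->
  digval m u = digval m v -> u = v.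
Proof.
elim: u v => [|a u IH] [|b v] //= [hs] /andP[ha hu] /andP[hb hv] h.
have [hu' hv'] := (digval_lt hu, digval_lt hv).
have mg : (0 < m ^ size v)%N by case: (m ^ size v)%N hv'.
have hab : a = b.
  have := congr1 (divn ^~ (m ^ size v)%N) h.
  by rewrite hs !divnMDl // !divn_small ?addn0 // -hs.
move: h; rewrite hab hs => /addnI h.
by rewrite (IH v).
Qed.

(** * Counting in lists *)

(** Sorting the elements of [s] by a related element of [s'] leaves at most [c] of
    them in each class. *)
Lemma size_le_fibres (T U : eqType) (s : seq T) (s' : seq U) (r : T -> U -> bool) c :
  (forall x, x \in s -> exists2 y, y \in s' & r x y) ->
  (forall y, y \in s' -> (size [seq x <- s | r x y] <= c)%N) ->
  (size s <= c * size s')%N.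
Proof.
move=> tot fib.
have h1 : (size s <= \sum_(y <- s') size [seq x <- s | r x y])%N.
  elim: s tot {fib} => [|x s IH] tot //=.
  have [y ys rxy] := tot x (mem_head _ _).
  have IH' : (size s <= \sum_(y <- s') size [seq x <- s | r x y])%N.
    by apply: IH => z zs; apply: tot; rewrite inE zs orbT.
  have -> : (\sum_(y0 <- s') size (if r x y0 then x :: [seq x0 <- s | r x0 y0] else
     [seq x0 <- s | r x0 y0]) = count (r x) s' + \sum_(y <- s') size [seq x <- s | r x y])%N.
    elim: s' {tot IH IH' ys} => [|z s' IHs']; first by rewrite !big_nil.
    by rewrite !big_cons IHs' /=; case: (r x z) => /=; lia.
  rewrite -add1n leq_add // -has_count; apply/hasP; by exists y.
apply: (leq_trans h1).
elim: s' fib {tot h1} => [|y s' IH] fib; first by rewrite big_nil.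
rewrite big_cons mulnS leq_add ?fib ?mem_head //.
by apply: IH => z zs; apply: fib; rewrite inE zs orbT.
Qed.

(** Both indices are recorded relative to those of one fixed element, shifted by
    [c] and [d] so as to stay natural numbers; they then lie in a rectangle. *)
Lemma size_le_square (T : eqType) (s : seq T) (ix iy : T -> nat) c d :
  uniq s -> {in s &, injective (fun x => (ix x, iy x))} ->
  {in s &, forall x y, (ix x <= ix y + c)%N} ->
  {in s &, forall x y, (iy x <= iy y + d)%N} ->
  (size s <= (2 * c).+1 * (2 * d).+1)%N.
Proof.
case: s => [|x0 s'] //; set s := x0 :: s' => us inj hx hy.
pose F x : nat * nat := ((ix x + c - ix x0)%N, (iy x + d - iy x0)%N).
have x0s : x0 \in s by rewrite mem_head.
have injF : {in s &, injective F}.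
  move=> x y xs ys [h1 h2]; apply: inj => //.
  have := (hx _ _ x0s xs); have := (hx _ _ x0s ys).
  have := (hy _ _ x0s xs); have := (hy _ _ x0s ys) => ? ? ? ?; apply/eqP; rewrite xpair_eqE; lia.
rewrite -(size_map F) -(size_iota 0 (2 * c).+1) -(size_iota 0 (2 * d).+1) -(size_allpairs pair).
apply: uniq_leq_size; first by rewrite map_inj_in_uniq.
move=> _ /mapP[x xs ->]; apply/allpairsP; exists (F x); rewrite !mem_iota; split => //=.
- by have := hx _ _ xs x0s; lia.
- by have := hy _ _ xs x0s; lia.
Qed.

(** * Euclidean distance *)

Section Edist.
Context {R : realType}.
Implicit Types x y z : R * R.

Lemma edist_ge0 x y : 0 <= edist x y.
Proof. exact: sqrtr_ge0. Qed.

Lemma edistC x y : edist x y = edist y x.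
Proof. by rewrite /edist; congr Num.sqrt; ring. Qed.

Lemma edistxx x : edist x x = 0.
Proof. by rewrite /edist !subrr !expr0n /= addr0 sqrtr0. Qed.

Lemma edist_ge1 x y : `|x.1 - y.1| <= edist x y.
Proof. by rewrite -sqrtr_sqr ler_wsqrtr // lerDl sqr_ge0. Qed.

Lemma edist_ge2 x y : `|x.2 - y.2| <= edist x y.
Proof. by rewrite -sqrtr_sqr ler_wsqrtr // lerDr sqr_ge0. Qed.

Lemma edist_le x y : edist x y <= `|x.1 - y.1| + `|x.2 - y.2|.
Proof.
have h : 0 <= `|x.1 - y.1| + `|x.2 - y.2| by rewrite addr_ge0.
rewrite -[leRHS](ger0_norm h) -sqrtr_sqr ler_wsqrtr // [leRHS]sqrrD !real_normK ?num_real //.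
by rewrite -addrA lerD2l lerDr mulrn_wge0 // mulr_ge0.
Qed.

Lemma edist_triangle y x z : edist x z <= edist x y + edist y z.
Proof.
have h : 0 <= edist x y + edist y z by rewrite addr_ge0 // edist_ge0.
rewrite -[leRHS](ger0_norm h) -sqrtr_sqr ler_wsqrtr // [leRHS]sqrrD /edist.
rewrite !sqr_sqrtr ?addr_ge0 ?sqr_ge0 // -sqrtrM ?addr_ge0 ?sqr_ge0 //.
set a := x.1 - y.1; set b := x.2 - y.2; set c := y.1 - z.1; set d := y.2 - z.2.
have -> : x.1 - z.1 = a + c by rewrite /a /c; ring.
have -> : x.2 - z.2 = b + d by rewrite /b /d; ring.
have hs : a * c + b * d <= Num.sqrt ((a ^+ 2 + b ^+ 2) * (c ^+ 2 + d ^+ 2)).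
  apply: (le_trans (ler_norm _)); rewrite -sqrtr_sqr ler_wsqrtr // -subr_ge0.
  have -> : (a ^+ 2 + b ^+ 2) * (c ^+ 2 + d ^+ 2) - (a * c + b * d) ^+ 2 =
    (a * d - b * c) ^+ 2 by ring.
  exact: sqr_ge0.
rewrite mulr2n; move: hs; set r := Num.sqrt _; lra.
Qed.

Lemma eball_triangle x y r s : edist x y <= s -> eball y r `<=` eball x (s + r).
Proof.
move=> hs z; rewrite /eball /= => hr.
by apply: (le_trans (edist_triangle y _ _)); apply: lerD.
Qed.

Lemma eball_mono x r s : r <= s -> eball x r `<=` eball x s.
Proof. by move=> rs z; rewrite /eball /= => h; apply: le_trans h rs. Qed.

End Edist.

(** * Cells of a grid *)

(** This family contains the maps of all carpets and is closed under composition,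
    which turns words of maps into pairs of natural numbers. *)
Definition cell_map (R : realType) (M N a b : nat) (p : R * R) : R * R :=
  ((p.1 + a%:R) / M%:R, (p.2 + b%:R) / N%:R).

Definition unit_square {R : realType} : set (R * R) :=
  [set p | 0 <= p.1 <= 1 /\ 0 <= p.2 <= 1].

(** The inequalities are free of division, so that comparing two cells compares
    natural numbers. *)
Definition cell (R : realType) (M N a b : nat) : set (R * R) :=
  [set p | a%:R <= p.1 * M%:R <= a%:R + 1 /\ b%:R <= p.2 * N%:R <= b%:R + 1].

Section Cells.
Context {R : realType}.

Lemma cell_map_comp M N a b M' N' a' b' (p : R * R) :
  (0 < M)%N -> (0 < N)%N -> (0 < M')%N -> (0 < N')%N ->
  cell_map M N a b (cell_map M' N' a' b' p) =
  cell_map (M * M') (N * N') (a * M' + a') (b * N' + b') p.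
Proof.
move=> hM hN hM' hN'; rewrite /cell_map /=.
by congr pair; rewrite !natrD !natrM; field; rewrite !pnatr_eq0 -!lt0n ?hM ?hM' ?hN ?hN'.
Qed.

Lemma bm_map_cell_map m n (a : 'I_m * 'I_n) :
  bm_map (R := R) a = cell_map m n a.1 a.2.
Proof. by []. Qed.

Lemma cell_map_in_cell M N a b (p : R * R) : (0 < M)%N -> (0 < N)%N ->
  unit_square p -> cell M N a b (cell_map M N a b p).
Proof.
move=> hM hN [h1 h2]; rewrite /cell /cell_map /= !divfK ?pnatr_eq0 -?lt0n //.
by split; lra.
Qed.

Lemma cell_refine M N a b M' N' a' b' : (a' < M')%N -> (b' < N')%N ->
  cell (M * M') (N * N') (a * M' + a') (b * N' + b') `<=` cell (R := R) M N a b.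
Proof.
move=> aM bN p [/andP[h1 h2] /andP[h3 h4]].
have M0 : 0 < M'%:R :> R by rewrite ltr0n; lia.
have N0 : 0 < N'%:R :> R by rewrite ltr0n; lia.
have aM' : a'%:R + 1 <= M'%:R :> R by rewrite natr1 ler_nat.
have bN' : b'%:R + 1 <= N'%:R :> R by rewrite natr1 ler_nat.
have := ler0n R a'; have := ler0n R b' => hb ha.
rewrite !natrD !natrM in h1 h2 h3 h4.
split; apply/andP; split.
- rewrite -(ler_pM2r M0); lra.
- rewrite -(ler_pM2r M0) mulrDl; lra.
- rewrite -(ler_pM2r N0); lra.
- rewrite -(ler_pM2r N0) mulrDl; lra.
Qed.

Lemma cell_refine1 M N a b M' a' : (a' < M')%N ->
  cell (M * M') N (a * M' + a') b `<=` cell (R := R) M N a b.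
Proof. by move=> h; have := @cell_refine M N a b M' 1 a' 0 h isT; rewrite !muln1 addn0. Qed.

Lemma cell_refine2 M N a b N' b' : (b' < N')%N ->
  cell M (N * N') a (b * N' + b') `<=` cell (R := R) M N a b.
Proof. by move=> h; have := @cell_refine M N a b 1 N' 0 b' isT h; rewrite !muln1 addn0. Qed.

Lemma cell_index_le M N a b a' b' (p p' : R * R) d :
  cell M N a b p -> cell M N a' b' p' -> `|p.1 - p'.1| * M%:R <= d%:R ->
  (a <= a' + d.+1)%N.
Proof.
move=> [/andP[h1 h2] _] [/andP[h3 h4] _] hd.
have : (p.1 - p'.1) * M%:R <= d%:R.
  by apply: le_trans hd; rewrite ler_wpM2r ?ler0n // ler_norm.
rewrite mulrBl => hd'.
rewrite -(ler_nat R) natrD -natr1; lra.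
Qed.

Lemma cell_swap M N a b (p : R * R) :
  cell M N a b p -> cell N M b a (p.2, p.1).
Proof. by move=> [h1 h2]; split. Qed.

Lemma cell_index_le2 M N a b a' b' (p p' : R * R) d :
  cell M N a b p -> cell M N a' b' p' -> `|p.2 - p'.2| * N%:R <= d%:R ->
  (b <= b' + d.+1)%N.
Proof. by move=> /cell_swap h /cell_swap h'; exact: (cell_index_le h h'). Qed.

Lemma cell_dist M N a b (p p' : R * R) : (0 < M)%N -> (0 < N)%N ->
  cell M N a b p -> cell M N a b p' -> edist p p' <= M%:R^-1 + N%:R^-1.
Proof.
move=> hM hN [/andP[h1 h2] /andP[h3 h4]] [/andP[h5 h6] /andP[h7 h8]].
apply: (le_trans (edist_le _ _)); apply: lerD.
- rewrite -[_^-1]mul1r ler_pdivlMr ?ltr0n // -[M%:R]gtr0_norm ?ltr0n // -normrM mulrBl.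
  rewrite ler_norml; lra.
- rewrite -[_^-1]mul1r ler_pdivlMr ?ltr0n // -[N%:R]gtr0_norm ?ltr0n // -normrM mulrBl.
  rewrite ler_norml; lra.
Qed.

End Cells.

(** * Words in the letters of a carpet *)

Definition ordval (m : nat) (u : seq 'I_m) : nat := digval m (map val u).

Section Letters.
Context {m n : nat}.
Implicit Types (A : {set 'I_m * 'I_n}) (w z : seq ('I_m * 'I_n)) (u v : seq 'I_m).

Definition cols A : seq 'I_m := [seq i <- enum 'I_m | (0 < column_size A i)%N].

Definition fibre_count A u : nat := (\prod_(i <- u) column_size A i)%N.

(** Pairs [(w, u)] address the approximate squares: [w] gives the first [k]
    digits of both coordinates and [u] gives [e] more digits of the abscissa. *)
Definition addresses A (k e : nat) : seq (seq ('I_m * 'I_n) * seq 'I_m) :=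
  [seq (w, u) | w <- words (enum A) k, u <- words (cols A) e].

Definition word_map {R : realType} w (p : R * R) : R * R :=
  cell_map (m ^ size w) (n ^ size w) (ordval (unzip1 w)) (ordval (unzip2 w)) p.

Definition box {R : realType} (a : seq ('I_m * 'I_n) * seq 'I_m) : set (R * R) :=
  cell (m ^ (size a.1 + size a.2)) (n ^ size a.1)
    (ordval (unzip1 a.1 ++ a.2)) (ordval (unzip2 a.1)).

Lemma cols_uniq A : uniq (cols A).
Proof. by rewrite filter_uniq // enum_uniq. Qed.

Lemma mem_cols A i : (i \in cols A) = (0 < column_size A i)%N.
Proof. by rewrite mem_filter mem_enum andbT. Qed.

Lemma column_size_gt0P A i : reflect (exists j, (i, j) \in A) (0 < column_size A i)%N.
Proof.
apply: (iffP idP) => [|[j hj]]; last by apply/card_gt0P; exists j; rewrite inE.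
by move=> /card_gt0P[j]; rewrite inE; exists j.
Qed.

Lemma size_cols A : size (cols A) = num_columns A.
Proof. by rewrite size_filter /num_columns cardsE cardE size_filter enumT. Qed.

Lemma addresses_uniq A k e : uniq (addresses A k e).
Proof.
apply: allpairs_uniq; last by move=> -[? ?] [? ?].
- exact/words_uniq/enum_uniq.
- exact/words_uniq/cols_uniq.
Qed.

Lemma mem_addresses A k e a : (a \in addresses A k e) =
  [&& size a.1 == k, all (mem A) a.1, size a.2 == e & all (mem (cols A)) a.2].
Proof.
have eqA w : all (mem (enum A)) w = all (mem A) w.
  by apply: eq_all => b /=; rewrite mem_enum.
apply/allpairsP/idP => [[[w u] [/= hw hu ->]] /=|].
  by move: hw hu; rewrite !mem_words eqA => /andP[-> ->] /andP[-> ->].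
case: a => w u /= /and4P[h1 h2 h3 h4]; exists (w, u); rewrite /= !mem_words eqA.
by rewrite h1 h2 h3 h4.
Qed.

Lemma size_addresses A k e :
  size (addresses A k e) = (#|A| ^ k * num_columns A ^ e)%N.
Proof. by rewrite size_allpairs !size_words -cardE size_cols. Qed.

Lemma big_addresses (V : nmodType) A k e (P : pred _) (F : _ -> V) :
  \sum_(a <- addresses A k e | P a) F a =
  \sum_(w <- words (enum A) k) \sum_(u <- words (cols A) e | P (w, u)) F (w, u).
Proof.
rewrite big_mkcond big_allpairs_dep /=; apply: eq_bigr => w _.
by rewrite [RHS]big_mkcond.
Qed.

Lemma sum_letters (V : nmodType) A (G : 'I_m -> V) :
  \sum_(a <- enum A) G a.1 = \sum_(i <- cols A) G i *+ column_size A i.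
Proof.
rewrite big_enum /= big_filter big_enum_cond /=.
rewrite (eq_bigl (fun a : 'I_m * 'I_n => true && ((a.1, a.2) \in A))); last by case.
rewrite -(pair_big_dep xpredT (fun i j => (i, j) \in A) (fun i j => G i)) /=.
rewrite [RHS]big_mkcond; apply: eq_bigr => i _.
rewrite -/(@column_size m n A i) sumr_const.
have -> : #|(fun j => (i, j) \in A)| = column_size A i.
  by rewrite /column_size cardsE.
by case: (column_size A i).
Qed.

(** [fibre_count A u] words of [A] project to the column word [u]. This is how the
    sizes of the columns enter every count and every mass below. *)
Lemma sum_words_letters (V : nmodType) A e (G : seq 'I_m -> V) :
  \sum_(z <- words (enum A) e) G (unzip1 z) =
  \sum_(u <- words (cols A) e) G u *+ fibre_count A u.
Proof.
elim: e G => [|e IH] G; first by rewrite /= !big_seq1 /= /fibre_count big_nil.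
rewrite !big_words_cons.
rewrite (sum_letters A (fun i => \sum_(z <- words (enum A) e) G (i :: unzip1 z))).
apply: eq_bigr => i _; rewrite (IH (fun u => G (i :: u))) -sumrMnl.
by apply: eq_bigr => u _; rewrite /fibre_count big_cons -mulrnA mulnC.
Qed.

Lemma ordval_lt (p : nat) (u : seq 'I_p) : (ordval u < p ^ size u)%N.
Proof.
rewrite -[size u](size_map val); apply: digval_lt.
by apply/allP => _ /mapP[i _ ->] /=.
Qed.

Lemma ordval_inj (p : nat) (u v : seq 'I_p) :
  size u = size v -> ordval u = ordval v -> u = v.
Proof.
move=> hs /digval_inj h; apply: (inj_map val_inj); apply: h; rewrite ?size_map //.
- by apply/allP => _ /mapP[i _ ->] /=.
- by apply/allP => _ /mapP[i _ ->] /=.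
Qed.

Lemma ordval_cat (p : nat) (u v : seq 'I_p) :
  ordval (u ++ v) = (ordval u * p ^ size v + ordval v)%N.
Proof. by rewrite /ordval map_cat digval_cat size_map. Qed.

Lemma box_index_inj A k e :
  {in addresses A k e &, injective (fun a => (ordval (unzip1 a.1 ++ a.2), ordval (unzip2 a.1)))}.
Proof.
move=> [w u] [z v]; rewrite !mem_addresses /=.
move=> /and4P[/eqP hw _ /eqP hu _] /and4P[/eqP hz _ /eqP hv _] [h1 h2].
have s1 : size (unzip1 w ++ u) = size (unzip1 z ++ v).
  by rewrite !size_cat !size_map hw hz hu hv.
have /eqP := ordval_inj s1 h1.
rewrite eqseq_cat ?size_map ?hw ?hz // => /andP[/eqP e1 /eqP ->].
have s2 : size (unzip2 w) = size (unzip2 z) by rewrite !size_map hw hz.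
have e2 := ordval_inj s2 h2.
by congr pair; rewrite -[w]zip_unzip -[z]zip_unzip e1 e2.
Qed.

Section Real.
Context {R : realType} (hm : (0 < m)%N) (hn : (0 < n)%N).
Implicit Types p : R * R.

Lemma pow_m_gt0 k : (0 < m ^ k)%N. Proof. by rewrite expn_gt0 hm. Qed.
Lemma pow_n_gt0 k : (0 < n ^ k)%N. Proof. by rewrite expn_gt0 hn. Qed.

Lemma word_map_nil p : word_map [::] p = p.
Proof. by case: p => a b; rewrite /word_map /cell_map /= !addr0 !divr1. Qed.

Lemma word_map_cat w z p : word_map (w ++ z) p = word_map w (word_map z p).
Proof.
rewrite /word_map cell_map_comp ?pow_m_gt0 ?pow_n_gt0 //.
by rewrite -!expnD size_cat /unzip1 /unzip2 !map_cat !ordval_cat !size_map.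
Qed.

Lemma word_map1 a p : word_map [:: a] p = bm_map a p.
Proof. by rewrite /word_map /bm_map /cell_map /ordval /= !expn1 !expn0 !muln1 !addn0. Qed.

Lemma word_map_cons a w p : word_map (a :: w) p = bm_map a (word_map w p).
Proof. by rewrite -cat1s word_map_cat word_map1. Qed.

(** The ordinates of the letters of [z] are forgotten: the approximate square
    contains all the cells of level [size (w ++ z)] that share these columns. *)
Lemma box_word_map w z p : unit_square p -> box (w, unzip1 z) (word_map (w ++ z) p).
Proof.
move=> hp; have := cell_map_in_cell (ordval (unzip1 (w ++ z))) (ordval (unzip2 (w ++ z)))
  (pow_m_gt0 (size (w ++ z))) (pow_n_gt0 (size (w ++ z))) hp.
rewrite /box /= -/(word_map (w ++ z) p) size_map /unzip1 /unzip2 !map_cat.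
rewrite (ordval_cat (map snd w)) size_cat (expnD n) size_map.
by apply: cell_refine2; rewrite -[X in (_ < n ^ X)%N](size_map snd) ordval_lt.
Qed.

Lemma box_catr w u v : box (R := R) (w, u ++ v) `<=` box (w, u).
Proof.
rewrite /box /= size_cat addnA expnD catA ordval_cat.
by apply: cell_refine1; apply: ordval_lt.
Qed.

Lemma box_dist A k e a p p' : a \in addresses A k e -> box a p -> box a p' ->
  edist p p' <= (m ^ (k + e))%:R^-1 + (n ^ k)%:R^-1.
Proof.
rewrite mem_addresses => /and4P[/eqP <- _ /eqP <- _].
by apply: cell_dist; rewrite ?pow_m_gt0 ?pow_n_gt0.
Qed.

(** Points that are close at the scale of the sides have neighbouring indices, so
    [size_le_square] applies to the pairs of indices of the squares. *)
Lemma size_boxes_le A k e (P : pred _) c d :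
  (forall a b, a \in addresses A k e -> b \in addresses A k e -> P a -> P b ->
    exists p p' : R * R, [/\ box a p, box b p',
      `|p.1 - p'.1| * (m ^ (k + e))%:R <= c%:R & `|p.2 - p'.2| * (n ^ k)%:R <= d%:R]) ->
  (size [seq a <- addresses A k e | P a] <= (2 * c.+1).+1 * (2 * d.+1).+1)%N.
Proof.
move=> h.
apply: (@size_le_square _ _ (fun a => ordval (unzip1 a.1 ++ a.2)) (fun a => ordval (unzip2 a.1))).
- by rewrite filter_uniq // addresses_uniq.
- move=> a b; rewrite !mem_filter => /andP[_ ha] /andP[_ hb]; exact: box_index_inj ha hb.
- move=> a b; rewrite !mem_filter => /andP[Pa ha] /andP[Pb hb].
  have [p [p' [h1 h2 h3 _]]] := h _ _ ha hb Pa Pb.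
  move: ha hb h1 h2; rewrite !mem_addresses => /and4P[/eqP sa _ /eqP sa' _].
  move=> /and4P[/eqP sb _ /eqP sb' _]; rewrite /box sa sa' sb sb' => h1 h2.
  exact: cell_index_le h1 h2 h3.
- move=> a b; rewrite !mem_filter => /andP[Pa ha] /andP[Pb hb].
  have [p [p' [h1 h2 _ h3]]] := h _ _ ha hb Pa Pb.
  move: ha hb h1 h2; rewrite !mem_addresses => /and4P[/eqP sa _ /eqP sa' _].
  move=> /and4P[/eqP sb _ /eqP sb' _]; rewrite /box sa sa' sb sb' => h1 h2.
  exact: cell_index_le2 h1 h2 h3.
Qed.

End Real.
End Letters.

(** * The points of a carpet *)

Lemma le0_of_natmul_bounded (R : realType) (y B : R) :
  (forall k : nat, y * k%:R <= B) -> y <= 0.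
Proof.
move=> h; rewrite leNgt; apply/negP => y0.
have B0 : 0 <= B by have := h 0%N; rewrite mulr0.
have := archi_boundP (divr_ge0 B0 (ltW y0)).
by rewrite ltr_pdivrMr // mulrC ltNge h.
Qed.

Lemma all_enum (T : finType) (A : {set T}) (w : seq T) : all (mem (enum A)) w = all (mem A) w.
Proof. by apply: eq_all => a /=; rewrite mem_enum. Qed.

Section Carpet.
Context {R : realType} {m n : nat} {A : {set 'I_m * 'I_n}} {L : set (R * R)}.
Hypothesis hL : bm_carpet A L.

Lemma carpet_m_gt1 : (1 < m)%N. Proof. by case: hL => /andP[]. Qed.
Lemma carpet_mn : (m < n)%N. Proof. by case: hL => /andP[]. Qed.
Lemma carpet_m_gt0 : (0 < m)%N. Proof. exact: ltnW carpet_m_gt1. Qed.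
Lemma carpet_n_gt1 : (1 < n)%N. Proof. exact: ltn_trans carpet_m_gt1 carpet_mn. Qed.
Lemma carpet_n_gt0 : (0 < n)%N. Proof. exact: ltnW carpet_n_gt1. Qed.

Lemma carpet_card_gt0 : (0 < #|A|)%N.
Proof. by case: hL => _ + _ _ _; rewrite card_gt0. Qed.

Lemma carpet_ex : exists p, L p.
Proof. by case: hL => _ _ [p Lp] _ _; exists p. Qed.

Lemma carpet_closed : closed L.
Proof.
by case: hL => _ _ _ cL _; apply: compact_closed.
Qed.

Lemma carpet_word_map w p : all (mem A) w -> L p -> L (word_map w p).
Proof.
have [hm hn] := (carpet_m_gt0, carpet_n_gt0).
move=> + Lp; elim: w => [|a w IH] /=; first by rewrite word_map_nil.
move=> /andP[aA /IH Lw]; rewrite word_map_cons //.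
by case: hL => _ _ _ _ ->; exists a => //=; exists (word_map w p).
Qed.

Lemma carpet_words k x : L x ->
  exists w p, [/\ w \in words (enum A) k, L p & x = word_map w p].
Proof.
have [hm hn] := (carpet_m_gt0, carpet_n_gt0).
elim: k x => [|k IH] x Lx.
  by exists [::], x; rewrite mem_words eqxx word_map_nil.
move: Lx; case: (hL) => _ _ _ _ {1}-> [a /= aA [y Ly <-]].
have [w [p [hw Lp ->]]] := IH _ Ly.
exists (a :: w), p; rewrite word_map_cons //; split => //.
move: hw; rewrite -[X in _ \in X -> _]/(words _ _) -[X in _ -> _ \in X]/(words (enum A) k.+1).
rewrite !mem_words !all_enum.
  by move=> /andP[/eqP <- wA]; rewrite /= eqxx wA aA.
Qed.

(** Expanding along a word of length [k] keeps a point of [L] in the bounded set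
    [L], while its distance to the unit square would grow like [m ^ k]. *)
Lemma carpet_unit_square x : L x -> unit_square x.
Proof.
have [hm hn] := (carpet_m_gt0, carpet_n_gt0).
have [B hB] : exists B : R, forall p, L p -> `|p.1| <= B /\ `|p.2| <= B.
  case: hL => _ _ _ /compact_bounded [B0 [_ hB]] _.
  exists (B0 + 1) => p Lp.
  have : `|p| <= B0 + 1 by apply: hB Lp; rewrite ltrDl ltr01.
  by rewrite prod_normE ge_max => /andP.
have aux q a k y p1 : (1 < q)%N -> (a < q ^ k)%N -> `|p1| <= B -> y = (p1 + a%:R) / (q ^ k)%:R ->
    (y - 1) * k%:R <= B /\ - y * k%:R <= B.
  move=> q1 aq pB ->; have q0 : 0 < (q ^ k)%:R :> R by rewrite ltr0n expn_gt0; lia.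
  have kq : k%:R <= (q ^ k)%:R :> R by rewrite ler_nat ltnW // ltn_expl.
  have B0 : 0 <= B by apply: le_trans pB.
  have a1 : a%:R + 1 <= (q ^ k)%:R :> R by rewrite natr1 ler_nat.
  have := ler0n R a; move: pB; rewrite ler_norml => /andP[pB1 pB2] a0.
  have k0 := ler0n R k.
  set y' := _ / _; have hy : y' * (q ^ k)%:R = p1 + a%:R by rewrite /y' divfK // gt_eqF.
  split.
  - have [y1|y1] := leP (y' - 1) 0; first by apply: le_trans B0; rewrite mulr_le0_ge0.
    apply: (@le_trans _ _ ((y' - 1) * (q ^ k)%:R)); first by rewrite ler_wpM2l // ltW.
    rewrite mulrBl hy; lra.
  - have [y1|y1] := leP (- y') 0; first by apply: le_trans B0; rewrite mulr_le0_ge0.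
    apply: (@le_trans _ _ (- y' * (q ^ k)%:R)); first by rewrite ler_wpM2l // ltW.
    rewrite mulNr hy; lra.
move=> Lx.
have h k : ((x.1 - 1) * k%:R <= B /\ - x.1 * k%:R <= B) /\
           ((x.2 - 1) * k%:R <= B /\ - x.2 * k%:R <= B).
  have [w [p [hw Lp ->]]] := carpet_words k Lx.
  have [pB1 pB2] := hB _ Lp.
  move: hw; rewrite mem_words => /andP[/eqP hw _].
  split.
  - apply: (aux m (ordval (unzip1 w)) k _ p.1) => //.
    + exact: carpet_m_gt1.
    + by rewrite -hw -[X in (_ < m ^ X)%N](size_map fst) ordval_lt.
    + by rewrite /word_map /cell_map /= hw.
  - apply: (aux n (ordval (unzip2 w)) k _ p.2) => //.
    + exact: carpet_n_gt1.
    + by rewrite -hw -[X in (_ < n ^ X)%N](size_map snd) ordval_lt.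
    + by rewrite /word_map /cell_map /= hw.
have := le0_of_natmul_bounded (fun k => (h k).1.1).
have := le0_of_natmul_bounded (fun k => (h k).1.2).
have := le0_of_natmul_bounded (fun k => (h k).2.1).
have := le0_of_natmul_bounded (fun k => (h k).2.2).
by move=> h1 h2 h3 h4; split; apply/andP; split; lra.
Qed.

Lemma column_word_lift u : all (mem (cols A)) u ->
  exists2 z, all (mem A) z & unzip1 z = u.
Proof.
elim: u => [|i u IH] /=; first by exists [::].
rewrite mem_cols => /andP[/column_size_gt0P[j ij] /IH[z zA zu]].
by exists ((i, j) :: z) => /=; rewrite ?ij ?zA ?zu.
Qed.

Lemma box_point k e a : a \in addresses A k e -> exists2 p, L p & box a p.
Proof.
rewrite mem_addresses => /and4P[_ hw _ /column_word_lift[z zA hz]].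
have [p Lp] := carpet_ex; exists (word_map (a.1 ++ z) p).
  by apply: carpet_word_map => //; rewrite all_cat hw zA.
rewrite [a]surjective_pairing -hz; apply: box_word_map; rewrite ?carpet_m_gt0 ?carpet_n_gt0 //.
exact: carpet_unit_square.
Qed.

Lemma unzip1_cols w : all (mem A) w -> all (mem (cols A)) (unzip1 w).
Proof.
elim: w => [|[i j] w IH] //= /andP[ij /IH ->]; rewrite mem_cols andbT.
by apply/column_size_gt0P; exists j.
Qed.

(** The last [e] letters of a coding word are replaced by their columns. *)
Lemma point_address k e x : L x -> exists2 a, a \in addresses A k e & box a x.
Proof.
move=> Lx; have [w [p [hw Lp ->]]] := carpet_words (k + e) Lx.
move: hw; rewrite mem_words all_enum => /andP[/eqP sw wA].
exists (take k w, unzip1 (drop k w)).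
  rewrite mem_addresses /= size_takel ?sw ?leq_addr // size_map size_drop sw addKn !eqxx /=.
  have := wA; rewrite -{1}(cat_take_drop k w) all_cat => /andP[-> /unzip1_cols].
  by rewrite /mem /=.
rewrite -[X in word_map X](cat_take_drop k); apply: box_word_map;
  rewrite ?carpet_m_gt0 ?carpet_n_gt0 //.
exact: carpet_unit_square.
Qed.

Lemma num_columns_gt0 : (0 < num_columns A)%N.
Proof.
have /card_gt0P[[i j] ij] := carpet_card_gt0.
apply/card_gt0P; exists i; rewrite inE; apply/column_size_gt0P; by exists j.
Qed.

End Carpet.

(** * The Bernoulli measure of unions of approximate squares *)

Lemma measurable_cell_map (R : realType) M N a b :
  measurable_fun [set: R * R] (cell_map (R := R) M N a b).
Proof.
apply: measurable_fun_pair.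
- apply: measurable_funM => //; apply: measurable_funD => //; exact: measurable_fst.
- apply: measurable_funM => //; apply: measurable_funD => //; exact: measurable_snd.
Qed.

Lemma measurable_eball (R : realType) (x : R * R) r : measurable (eball x r).
Proof.
have [r0|r0] := leP 0 r; last first.
  suff -> : eball x r = set0 by [].
  apply/seteqP; split => // y; rewrite /eball /= => h.
  by have := lt_le_trans r0 (edist_ge0 x y); rewrite ltNge h.
have mf : measurable_fun [set: R * R]
    (fun y : R * R => (x.1 - y.1) ^+ 2 + (x.2 - y.2) ^+ 2).
  apply: measurable_funD; apply: measurable_funX; exact: measurable_funB.
have -> : eball x r = [set: R * R] `&`
    (fun y : R * R => (x.1 - y.1) ^+ 2 + (x.2 - y.2) ^+ 2) @^-1` `]-oo, r ^+ 2].
  apply/seteqP; split => y; rewrite /eball /= in_itv /=.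
  - move=> h; split => //; rewrite -[leLHS]sqr_sqrtr ?addr_ge0 ?sqr_ge0 //.
    by rewrite lerXn2r ?nnegrE ?sqrtr_ge0.
  - by move=> [_ h]; rewrite -[leRHS]ger0_norm // -sqrtr_sqr ler_wsqrtr.
by apply: mf.
Qed.

Definition mass (R : realType) (nu : probability (R * R)%type R) (E : set (R * R)) : R :=
  fine (nu E).

Section Bernoulli.
Context {R : realType} {m n : nat} {A : {set 'I_m * 'I_n}} {L : set (R * R)}
  {nu : probability (R * R)%type R}.
Hypothesis hL : bm_carpet A L.
Hypothesis hnu : uniform_bernoulli A nu.

Let hm := carpet_m_gt0 hL.
Let hn := carpet_n_gt0 hL.

Lemma massE E : measurable E -> nu E = (mass nu E)%:E.
Proof. by move=> mE; rewrite /mass fineK // fin_num_measure. Qed.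

Lemma mass_ge0 E : 0 <= mass nu E.
Proof. by rewrite /mass fine_ge0. Qed.

Lemma mass_mono E F : measurable E -> measurable F -> E `<=` F -> mass nu E <= mass nu F.
Proof.
move=> mE mF EF; rewrite -lee_fin -!massE //.
by apply: le_measure => //; rewrite inE.
Qed.

Lemma mass_le1 E : measurable E -> mass nu E <= 1.
Proof. by move=> mE; rewrite -lee_fin -massE // probability_le1. Qed.

Let measurable_pre (M N a b : nat) (E : set (R * R)) : measurable E ->
  measurable (cell_map (R := R) M N a b @^-1` E).
Proof. by move=> mE; rewrite -[_ @^-1` _]setTI; apply: measurable_cell_map. Qed.

Lemma mass_step E : measurable E ->
  mass nu E = #|A|%:R^-1 * \sum_(a <- enum A) mass nu (bm_map a @^-1` E).
Proof.
move=> mE; apply: EFin_inj; rewrite -massE // hnu // EFinM; congr (_ * _)%E.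
rewrite big_enum /= -sumEFin; apply: eq_bigr => a _.
by rewrite massE //; apply: measurable_pre.
Qed.

Lemma mass_words k E : measurable E ->
  mass nu E = (#|A|%:R ^- k) * \sum_(w <- words (enum A) k) mass nu (word_map w @^-1` E).
Proof.
move=> mE; elim: k => [|k IH].
  rewrite /= big_seq1 expr0 invr1 mul1r; congr mass; apply/seteqP.
  by split => p /=; rewrite word_map_nil.
have aux (w : seq ('I_m * 'I_n)) : mass nu (word_map w @^-1` E) =
    #|A|%:R^-1 * \sum_(a <- enum A) mass nu (word_map (w ++ [:: a]) @^-1` E).
  rewrite mass_step; last exact: measurable_pre.
  congr (_ * _); apply: eq_bigr => a _; congr mass; apply/seteqP.
  by split => p /=; rewrite word_map_cat // word_map1.
rewrite {}IH; under eq_bigr do rewrite aux.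
rewrite -mulr_sumr mulrA -invfM -exprSr -addn1 big_words_cat; congr (_ * _).
by apply: eq_bigr => w _; rewrite big_words_cons; apply: eq_bigr => a _; rewrite /= big_seq1.
Qed.

Lemma card_word_mean k (c : R) :
  (#|A|%:R ^- k) * \sum_(w <- words (enum A) k) c = c.
Proof.
rewrite big_const_seq count_predT size_words -cardE iter_addr_0 -[X in _ * X]mulr_natl natrX.
by rewrite mulKf // expf_neq0 // pnatr_eq0 -lt0n (carpet_card_gt0 hL).
Qed.

(** The inverse maps push mass lying outside the unit square off to infinity, where
    a finite measure has none. Distances are taken from the centre of the square,
    since both sides are then treated alike. *)
Let far (t : R) : set (R * R) :=
  [set p | 1 / 2 + t < `|p.1 - 1 / 2| \/ 1 / 2 + t < `|p.2 - 1 / 2|].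

Let measurable_far t : measurable (far t).
Proof.
have h (f : R * R -> R) : measurable_fun [set: R * R] f ->
    measurable [set p : R * R | 1 / 2 + t < `|f p - 1 / 2| :> R].
  move=> mf; have mg : measurable_fun [set: R * R] (fun p => `|f p - 1 / 2| : R).
    by apply: measurableT_comp => //; apply: measurable_funB.
  have -> : [set p : R * R | 1 / 2 + t < `|f p - 1 / 2| :> R] =
    [set: R * R] `&` (fun p => `|f p - 1 / 2| : R) @^-1` `]1 / 2 + t, +oo[.
    by apply/seteqP; split => p; rewrite /= in_itv /= andbT //; case.
  by apply: mg.
have -> : far t = [set p : R * R | 1 / 2 + t < `|p.1 - 1 / 2| :> R] `|`
  [set p : R * R | 1 / 2 + t < `|p.2 - 1 / 2| :> R] by [].
by apply: measurableU; apply: h; [exact: measurable_fst|exact: measurable_snd].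
Qed.

Let far_mono s t : s <= t -> far t `<=` far s.
Proof. by move=> st p [h|h]; [left|right]; lra. Qed.

(** The map [y |-> (y + i) / q] contracts [0, 1] into itself, so points within
    [t * q] of the interval come within [t] of it. *)
Let far_expand t (q i : nat) (y : R) : 0 <= t -> (i < q)%N ->
  1 / 2 + t < `|(y + i%:R) / q%:R - 1 / 2| -> 1 / 2 + t * q%:R < `|y - 1 / 2|.
Proof.
move=> t0 iq; have q0 : 0 < q%:R :> R by rewrite ltr0n; lia.
have iq' : i%:R + 1 <= q%:R :> R by rewrite natr1 ler_nat.
have i0 := ler0n R i.
set z := _ / q%:R; have hz : z * q%:R = y + i%:R by rewrite /z divfK // gt_eqF.
rewrite ltr_normr => /orP[] h; rewrite ltr_normr; apply/orP; [left|right].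
- have : (1 / 2 + t) * q%:R < (z - 1 / 2) * q%:R by rewrite ltr_pM2r.
  rewrite !mulrDl mulNr hz; lra.
- have : (1 / 2 + t) * q%:R < - (z - 1 / 2) * q%:R by rewrite ltr_pM2r.
  rewrite mulNr !mulrDl mulNr hz; lra.
Qed.

Lemma mass_far t : 0 < t -> mass nu (far t) = 0.
Proof.
move=> t0; apply/eqP; rewrite eq_le mass_ge0 andbT.
have step k : mass nu (far t) <= mass nu (far (t * k%:R)).
  rewrite (mass_words k) //; rewrite -[leRHS](card_word_mean k).
  rewrite ler_wpM2l ?invr_ge0 ?exprn_ge0 ?ler0n // !big_seq; apply: ler_sum => w.
  rewrite mem_words => /andP[/eqP sw _].
  apply: mass_mono => //; first exact: measurable_pre.
  have hk q : (1 < q)%N -> k%:R <= (q ^ k)%:R :> R by move=> q1; rewrite ler_nat ltnW // ltn_expl.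
  move=> p /= [] h.
  - left; move: h; rewrite /word_map /cell_map /= => /far_expand h.
    apply: (le_lt_trans _ (h _ _)); [|exact: ltW|].
    + by rewrite lerD2l ler_wpM2l ?(ltW t0) // sw hk // (carpet_m_gt1 hL).
    + by rewrite -[X in (_ < m ^ X)%N](size_map fst) ordval_lt.
  - right; move: h; rewrite /word_map /cell_map /= => /far_expand h.
    apply: (le_lt_trans _ (h _ _)); [|exact: ltW|].
    + by rewrite lerD2l ler_wpM2l ?(ltW t0) // sw hk // (carpet_n_gt1 hL).
    + by rewrite -[X in (_ < n ^ X)%N](size_map snd) ordval_lt.
have cap0 : \bigcap_k far (t * k%:R) = set0.
  apply/seteqP; split => // p hp; exfalso.
  pose B := `|p.1 - 1 / 2| + `|p.2 - 1 / 2|.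
  suff : t <= 0 by rewrite leNgt t0.
  apply: (@le0_of_natmul_bounded _ _ B) => k; have := hp k I; rewrite /far /B /=.
  have := normr_ge0 (p.1 - 1 / 2); have := normr_ge0 (p.2 - 1 / 2); lra.
have cv := @nonincreasing_cvg_mu _ _ _ nu (fun k => far (t * k%:R)).
have {}cv : nu (far (t * k%:R)) @[k --> \oo] --> 0%E.
  rewrite -(measure0 nu) -cap0; apply: cv => //.
  - by apply: le_lt_trans (ltry 1); rewrite probability_le1.
  - by rewrite cap0.
  - move=> i j ij; apply/subsetPset; apply: far_mono.
    by rewrite ler_wpM2l ?(ltW t0) // ler_nat.
rewrite -lee_fin -massE //; apply: (cvge_ge _ cv).
by apply: nearW => k; rewrite !massE // lee_fin step.
Qed.

Lemma mass_out E : measurable E -> (forall p, unit_square p -> ~ E p) -> mass nu E = 0.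
Proof.
move=> mE hE; have sub : E `<=` \bigcup_k far k.+1%:R^-1.
  move=> p Ep; apply: contrapT => np; apply: (hE p) => //.
  suff h : `|p.1 - 1 / 2| <= 1 / 2 /\ `|p.2 - 1 / 2| <= 1 / 2.
    by move: h; rewrite !ler_norml => -[/andP[h1 h2] /andP[h3 h4]]; split; lra.
  have h k : `|p.1 - 1 / 2| <= 1 / 2 + k.+1%:R^-1 /\ `|p.2 - 1 / 2| <= 1 / 2 + k.+1%:R^-1.
    split; rewrite leNgt; apply/negP => hh; apply: np; exists k => //; by [left|right].
  have lim (y : R) : (forall k, y <= 1 / 2 + k.+1%:R^-1) -> y <= 1 / 2.
    move=> hy; rewrite leNgt; apply/negP => /ltr_add_invr[k]; by rewrite ltNge hy.
  by split; apply: lim => k; have [] := h k.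
have : nu.-negligible (\bigcup_k far k.+1%:R^-1).
  apply: negligible_bigcup => k; exists (far k.+1%:R^-1); split => //.
  have k0 : 0 < k.+1%:R^-1 :> R by rewrite invr_gt0 ltr0n.
  by apply: (etrans (massE (measurable_far _))); rewrite mass_far.
move=> [F [mF F0 sF]]; apply/eqP; rewrite eq_le mass_ge0 andbT.
have <- : mass nu F = 0 by rewrite /mass F0.
by apply: mass_mono => //; apply: subset_trans sF.
Qed.

Lemma mass_full E : measurable E -> unit_square `<=` E -> mass nu E = 1.
Proof.
move=> mE hE; have mC : measurable (~` E) by apply: measurableC.
have h0 : mass nu (~` E) = 0 by apply: mass_out => // p /hE Ep; apply.
have := probability_setC nu mE; rewrite !massE // h0 => -[]; lra.
Qed.

Lemma big_addresses_fibre k e (P : pred _) :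
  \sum_(a <- addresses A k e | P a) (fibre_count A a.2)%:R =
  \sum_(w <- words (enum A) k) \sum_(z <- words (enum A) e) (P (w, unzip1 z))%:R :> R.
Proof.
rewrite big_addresses; apply: eq_bigr => w _.
rewrite (sum_words_letters A e (fun u => (P (w, u))%:R : R)) big_mkcond.
by apply: eq_bigr => u _; case: (P _); rewrite ?mul0rn.
Qed.

(** The measure is carried in equal parts by the images of the unit square under
    the words of length [k + e], and [fibre_count A u] of them lie in the
    approximate square addressed by [(w, u)]. The two lemmas keep the squares
    inside [E], respectively those meeting [E]. *)
Lemma mass_lower k e E : measurable E ->
  #|A|%:R ^- (k + e) *
    \sum_(a <- addresses A k e | `[< box a `<=` E >]) (fibre_count A a.2)%:R <= mass nu E.
Proof.
move=> mE; rewrite (mass_words (k + e)) // ler_wpM2l ?invr_ge0 ?exprn_ge0 ?ler0n //.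
rewrite big_addresses_fibre big_words_cat.
apply: ler_sum => w _; apply: ler_sum => z _.
case: asboolP => [sub|_]; last exact: mass_ge0.
rewrite mass_full //; first exact: measurable_pre.
by move=> p hp; apply: sub; apply: box_word_map.
Qed.

Lemma mass_upper k e E : measurable E ->
  mass nu E <= #|A|%:R ^- (k + e) *
    \sum_(a <- addresses A k e | `[< box a `&` E !=set0 >]) (fibre_count A a.2)%:R.
Proof.
move=> mE; rewrite (mass_words (k + e)) // ler_wpM2l ?invr_ge0 ?exprn_ge0 ?ler0n //.
rewrite big_addresses_fibre big_words_cat.
apply: ler_sum => w _; apply: ler_sum => z _.
have mE' : measurable (word_map (w ++ z) @^-1` E) by exact: measurable_pre.
case: asboolP => [_|no]; first exact: mass_le1.
rewrite mass_out // => p hp Ep; apply: no; exists (word_map (w ++ z) p); split => //.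
exact: box_word_map.
Qed.

End Bernoulli.

(** * Bi-Lipschitz maps *)

Definition bilip_onto (R : realType) (C : R) (f : R * R -> R * R) (X Y : set (R * R)) : Prop :=
  f @` X = Y /\
  forall x y, X x -> X y -> C^-1 * edist x y <= edist (f x) (f y) <= C * edist x y.

Section Bilipschitz.
Context {R : realType} {C : R} {f : R * R -> R * R} {X Y : set (R * R)}.
Hypothesis C1 : 1 <= C.
Hypothesis hf : bilip_onto C f X Y.

Let C0 : 0 < C. Proof. exact: lt_le_trans C1. Qed.

Lemma bilip_mem x : X x -> Y (f x).
Proof. by move=> Xx; rewrite -hf.1; exists x. Qed.

Lemma bilip_surj y : Y y -> exists2 x, X x & f x = y.
Proof. by rewrite -hf.1 => -[x]; exists x. Qed.

Lemma bilip_le x y : X x -> X y -> edist (f x) (f y) <= C * edist x y.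
Proof. by move=> Xx Xy; have /andP[] := hf.2 _ _ Xx Xy. Qed.

Lemma bilip_ge x y : X x -> X y -> edist x y <= C * edist (f x) (f y).
Proof. by move=> Xx Xy; have /andP[h _] := hf.2 _ _ Xx Xy; rewrite -ler_pdivrMl. Qed.

Lemma edist_eq0 (x y : R * R) : edist x y <= 0 -> x = y.
Proof.
move=> h; have := le_trans (edist_ge1 x y) h; have := le_trans (edist_ge2 x y) h.
rewrite !normr_le0 !subr_eq0 => /eqP h2 /eqP h1.
by rewrite [x]surjective_pairing [y]surjective_pairing h1 h2.
Qed.

Lemma bilip_inj x y : X x -> X y -> f x = f y -> x = y.
Proof.
move=> Xx Xy e; apply: edist_eq0; apply: (le_trans (bilip_ge Xx Xy)).
by rewrite e edistxx mulr0.
Qed.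

Lemma bilip_inverse : exists g, [/\ bilip_onto C g Y X,
  forall x, X x -> g (f x) = x & forall y, Y y -> f (g y) = y].
Proof.
pose g y := xget y [set x | X x /\ f x = y].
have gP y : Y y -> X (g y) /\ f (g y) = y.
  by move=> /bilip_surj[x Xx fx]; rewrite /g; case: xgetP => [z _ //|/(_ x)]; case.
have gf x : X x -> g (f x) = x.
  by move=> Xx; have [h1 h2] := gP _ (bilip_mem Xx); apply: bilip_inj.
exists g; split => [|//|y /gP[]//]; split.
  apply/seteqP; split => [_ [y /gP[h _] <-] //|x Xx].
  by exists (f x); [exact: bilip_mem|exact: gf].
move=> x y /gP[Xx fx] /gP[Xy fy]; apply/andP; split.
- by rewrite ler_pdivrMl // -{1}fx -{1}fy; apply: bilip_le.
- by rewrite -{2}fx -{2}fy; apply: bilip_ge.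
Qed.

End Bilipschitz.

(** * Approximate squares of a given diameter *)

(** The approximate squares with [k] pairs of digits and [e] further columns have
    both sides comparable to [delta]. *)
Definition scale (R : realType) (m n : nat) (delta : R) (k e : nat) : Prop :=
  1 <= delta * (m ^ (k + e))%:R < m%:R /\ 1 <= delta * (n ^ k)%:R < n%:R.

Lemma ex_power_scale (R : realType) (q : nat) (delta : R) : (1 < q)%N -> 0 < delta <= 1 ->
  exists k, 1 <= delta * (q ^ k)%:R < q%:R /\
    forall j, 1 <= delta * (q ^ j)%:R -> (k <= j)%N.
Proof.
move=> q1 /andP[d0 d1].
have ex : exists k, 1 <= delta * (q ^ k)%:R.
  exists (Num.bound delta^-1); rewrite mulrC -ler_pdivrMr // mul1r.
  apply: ltW; apply: (lt_le_trans (archi_boundP _)); first by rewrite invr_ge0 ltW.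
  by rewrite ler_nat ltnW // ltn_expl.
case: (ex_minnP ex) => k hk kmin; exists k; split => //; rewrite hk /=.
case: k hk kmin => [|k] hk kmin; first by rewrite expn0 mulr1 (le_lt_trans d1) // ltr1n.
rewrite expnS natrM mulrCA gtr_pMr ?ltr0n ?(ltnW q1) // ltNge; apply/negP => /kmin.
by rewrite ltnn.
Qed.

Lemma ex_scale (R : realType) (m n : nat) (delta : R) : (1 < m)%N -> (m < n)%N ->
  0 < delta <= 1 -> exists k e, scale m n delta k e.
Proof.
move=> m1 mn hd; have [d0 d1] := andP hd.
have [k [hk kmin]] := ex_power_scale (ltn_trans m1 mn) hd.
have [l [hl _]] := ex_power_scale m1 hd.
have kl : (k <= l)%N.
  apply: kmin; case/andP: hl => hl _; apply: (le_trans hl); rewrite ler_wpM2l ?(ltW d0) //.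
  by rewrite ler_nat; case: (posnP l) => [->|l0] //; rewrite leq_exp2r // ltnW.
by exists k, (l - k)%N; rewrite /scale subnKC.
Qed.

Section Scale.
Context {R : realType} {m n k e : nat} {delta : R}.
Hypothesis m1 : (1 < m)%N.
Hypothesis mn : (m < n)%N.
Hypothesis sc : scale m n delta k e.

Let m0 : (0 < m)%N. Proof. exact: ltnW. Qed.
Let n0 : (0 < n)%N. Proof. exact: ltn_trans mn. Qed.

Lemma scale_side1 : (m ^ (k + e))%:R^-1 <= delta.
Proof.
have [/andP[h _] _] := sc.
by rewrite -[_^-1]mul1r ler_pdivrMr // ltr0n expn_gt0 m0.
Qed.

Lemma scale_side2 : (n ^ k)%:R^-1 <= delta.
Proof.
have [_ /andP[h _]] := sc.
by rewrite -[_^-1]mul1r ler_pdivrMr // ltr0n expn_gt0 n0.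
Qed.

Lemma scale_delta_gt0 : 0 < delta.
Proof. by apply: lt_le_trans scale_side2; rewrite invr_gt0 ltr0n expn_gt0 n0. Qed.

Lemma scale_ge K : delta * (n ^ K)%:R <= 1 -> (K <= k)%N.
Proof.
move=> hK; have [_ /andP[h _]] := sc; have := le_trans hK h.
by rewrite ler_pM2l ?scale_delta_gt0 // ler_nat leq_exp2l // (ltn_trans m1).
Qed.

End Scale.

(** * Counting approximate squares is bi-Lipschitz invariant *)

Section Transfer.
Context {R : realType}.
Context {m n : nat} {A : {set 'I_m * 'I_n}} {L : set (R * R)}.
Context {m' n' : nat} {A' : {set 'I_m' * 'I_n'}} {L' : set (R * R)}.
Hypothesis hL : bm_carpet A L.
Hypothesis hL' : bm_carpet A' L'.
Context {C : R} {f : R * R -> R * R}.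
Hypothesis C1 : 1 <= C.
Hypothesis hf : bilip_onto C f L L'.

(** In units of the sides of a square, the image of a square spreads over at most
    [2 * C * n'] in each direction. *)
Definition transfer_const : nat :=
  let c := Num.bound (2 * C * n'%:R) in ((2 * c.+1).+1 * (2 * c.+1).+1)%N.

(** Link a square of [L'] to a square of [L] when some point of the second goes to
    the first. The squares linked to a given one all meet its image, whose diameter
    is comparable to their own, so there are boundedly many. *)
Lemma transfer_count (delta : R) k e k' e' (E : set (R * R)) :
  scale m n delta k e -> scale m' n' delta k' e' -> E `<=` L ->
  (size [seq a <- addresses A' k' e' | `[< exists2 x, E x & box a (f x) >]] <=
   transfer_const * size [seq a <- addresses A k e | `[< exists2 x, E x & box a x >]])%N.
Proof.
move=> sc sc' EL.
have [[[m1 mn] m1'] mn'] := (carpet_m_gt1 hL, carpet_mn hL, carpet_m_gt1 hL', carpet_mn hL').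
have C0 : 0 < C by exact: lt_le_trans C1.
pose r (a' : seq ('I_m' * 'I_n') * seq 'I_m') (a : seq ('I_m * 'I_n) * seq 'I_m) :=
  `[< exists2 x, E x & box a x /\ box a' (f x) >].
apply: (@size_le_fibres _ _ _ _ r).
- move=> a'; rewrite mem_filter => /andP[/asboolP[x Ex bx] _].
  have [a ha ax] := point_address hL k e (EL _ Ex).
  exists a; last by apply/asboolP; exists x.
  by rewrite mem_filter ha andbT; apply/asboolP; exists x.
- move=> a; rewrite mem_filter => /andP[_ ha].
  rewrite -filter_predI; set c := Num.bound (2 * C * n'%:R).
  apply: (size_boxes_le (R := R) (c := c) (d := c)) => b b' hb hb'.
  move=> /andP[/asboolP[x Ex [ax bx]] _] /andP[/asboolP[y Ey [ay by']] _].
  exists (f x), (f y).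
  have dxy : edist (f x) (f y) <= C * (2 * delta).
    apply: (le_trans (bilip_le hf (EL _ Ex) (EL _ Ey))); rewrite ler_wpM2l ?(ltW C0) //.
    apply: (le_trans (box_dist (carpet_m_gt0 hL) (carpet_n_gt0 hL) ha ax ay)).
    by have := scale_side1 m1 sc; have := scale_side2 m1 mn sc; lra.
  have cb : 2 * C * n'%:R <= c%:R.
    by apply: ltW; apply: archi_boundP; rewrite !mulr_ge0 // ltW.
  have aux (u y0 : R) q : u <= edist (f x) (f y) -> 0 <= y0 -> delta * y0 < q%:R -> (q <= n')%N ->
      u * y0 <= c%:R.
    move=> hu y0' hy hq; apply: (le_trans _ cb); apply: (@le_trans _ _ (C * (2 * delta) * y0)).
      by rewrite ler_wpM2r // (le_trans hu).
    have -> : C * (2 * delta) * y0 = 2 * C * (delta * y0) by ring.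
    by rewrite ler_wpM2l ?mulr_ge0 ?(ltW C0) // (le_trans (ltW hy)) // ler_nat.
  have [/andP[_ s1] /andP[_ s2]] := sc'.
  split => //.
  + by apply: (aux _ _ m') => //; rewrite ?edist_ge1 // ltnW.
  + by apply: (aux _ _ n') => //; rewrite edist_ge2.
Qed.

(** Surjectivity makes every approximate square count when [E] is all of [L]. *)
Lemma transfer_total (delta : R) k e k' e' :
  scale m n delta k e -> scale m' n' delta k' e' ->
  (#|A'| ^ k' * num_columns A' ^ e' <= transfer_const * (#|A| ^ k * num_columns A ^ e))%N.
Proof.
move=> sc sc'; have h := transfer_count sc sc' (@subset_refl _ L).
rewrite -!size_addresses; apply: leq_trans (leq_trans h _).
- rewrite size_filter; apply: eq_leq; symmetry; apply/eqP; rewrite -all_count.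
  apply/allP => a ha; have [p Lp ap] := box_point hL' ha.
  by have [x Lx fx] := bilip_surj hf Lp; apply/asboolP; exists x => //; rewrite fx.
- by rewrite leq_mul2l size_filter count_size orbT.
Qed.

End Transfer.
Arguments transfer_const {R} n' C.

(** * Bi-Lipschitz maps distort Bernoulli measures boundedly *)

Section Refinement.
Context {R : realType} {m n : nat} {A : {set 'I_m * 'I_n}}.

Lemma fibre_count_nil : fibre_count A [::] = 1%N.
Proof. by rewrite /fibre_count big_nil. Qed.

Lemma mem_addresses0 k (a : seq ('I_m * 'I_n) * seq 'I_m) :
  a \in addresses A k 0 -> a.2 = [::].
Proof. by rewrite mem_addresses => /and4P[_ _ /nilP]. Qed.

Lemma sum_fibre_count0 k (P : pred (seq ('I_m * 'I_n) * seq 'I_m)) :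
  \sum_(a <- addresses A k 0 | P a) (fibre_count A a.2)%:R =
  (size [seq a <- addresses A k 0 | P a])%:R :> R.
Proof.
rewrite -sum1_size big_filter natr_sum big_seq_cond [RHS]big_seq_cond.
by apply: eq_bigr => a /andP[/mem_addresses0 -> _]; rewrite fibre_count_nil.
Qed.

(** Every cell of level [k] contains the same number [num_columns A ^ e] of
    approximate squares with [e] further columns, so counting cells and counting
    approximate squares amount to the same. *)
Lemma size_addresses_refine k e
    (P : pred (seq ('I_m * 'I_n) * seq 'I_m)) (Q : pred (seq ('I_m * 'I_n) * seq 'I_m)) :
  (forall w u, (w, [::]) \in addresses A k 0 -> (w, u) \in addresses A k e ->
     P (w, [::]) -> Q (w, u)) ->
  (size [seq a <- addresses A k 0 | P a] * num_columns A ^ e <=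
   size [seq a <- addresses A k e | Q a])%N.
Proof.
move=> h; rewrite -size_cols -size_words -(size_allpairs (fun a u => (a.1, u))).
apply: uniq_leq_size.
- apply: allpairs_uniq; rewrite ?filter_uniq ?addresses_uniq ?words_uniq ?cols_uniq //.
  move=> x y /allpairsP[[a b] [/= ha _ ->]] /allpairsP[[a2 b2] [/= ha2 _ ->]] /=.
  move: ha ha2; rewrite !mem_filter => /andP[_ /mem_addresses0 +] /andP[_ /mem_addresses0 +].
  by case: a => w v; case: a2 => w2 v2 /= -> -> [-> ->].
- move=> _ /allpairsP[[a u] /= [ha hu ->]].
  move: ha; rewrite mem_filter => /andP[Pa ha].
  have e2 := mem_addresses0 ha.
  have hau : (a.1, u) \in addresses A k e.
    by move: ha hu; rewrite !mem_addresses mem_words /= => /and4P[-> -> _ _] ->.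
  rewrite mem_filter hau andbT; apply: h => //; by rewrite -e2 -surjective_pairing.
Qed.

Lemma size_addresses_coarsen k e
    (P : pred (seq ('I_m * 'I_n) * seq 'I_m)) (Q : pred (seq ('I_m * 'I_n) * seq 'I_m)) :
  (forall w u, (w, [::]) \in addresses A k 0 -> (w, u) \in addresses A k e ->
     Q (w, u) -> P (w, [::])) ->
  (size [seq a <- addresses A k e | Q a] <=
   size [seq a <- addresses A k 0 | P a] * num_columns A ^ e)%N.
Proof.
move=> h; rewrite -size_cols -size_words -(size_allpairs (fun a u => (a.1, u))).
apply: uniq_leq_size; first by rewrite filter_uniq ?addresses_uniq.
move=> [w u]; rewrite mem_filter => /andP[Qa ha]; apply/allpairsP.
have hw : (w, [::]) \in addresses A k 0.
  by move: ha; rewrite !mem_addresses /= => /and4P[-> ->].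
exists ((w, [::]), u) => /=; split => //.
- by rewrite mem_filter hw andbT; apply: (h w u).
- by move: ha; rewrite mem_addresses mem_words => /and4P[_ _ -> ->].
Qed.

End Refinement.

Section MeasureComparison.
Context {R : realType}.
Context {m n : nat} {A : {set 'I_m * 'I_n}} {L : set (R * R)}.
Context {m' n' : nat} {A' : {set 'I_m' * 'I_n'}} {L' : set (R * R)}.
Context {nu nu' : probability (R * R)%type R}.
Hypothesis hL : bm_carpet A L.
Hypothesis hL' : bm_carpet A' L'.
Hypothesis hnu : uniform_bernoulli A nu.
Hypothesis hnu' : uniform_bernoulli A' nu'.
Context {C : R} {f : R * R -> R * R}.
Hypothesis C1 : 1 <= C.
Hypothesis hf : bilip_onto C f L L'.

Let C0 : 0 < C. Proof. exact: lt_le_trans C1. Qed.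

Let box_diam (p q : nat) (B : {set 'I_p * 'I_q}) k w r (y z : R * R) :
  (1 < p)%N -> (p < q)%N -> 2 <= r * (p ^ k)%:R -> (w, [::]) \in addresses B k 0 ->
  box (w, [::]) y -> box (w, [::]) z -> edist y z <= r.
Proof.
move=> p1 pq hr hw hy hz.
have p0 : 0 < (p ^ k)%:R :> R by rewrite ltr0n expn_gt0; lia.
have q0 : 0 < (q ^ k)%:R :> R by rewrite ltr0n expn_gt0; lia.
apply: (le_trans (box_dist (ltnW p1) (ltn_trans (ltnW p1) pq) hw hy hz)); rewrite addn0.
have : 2 * (p ^ k)%:R^-1 <= r by rewrite -ler_pdivlMr ?invr_gt0 // invrK.
have : (q ^ k)%:R^-1 <= (p ^ k)%:R^-1 :> R.
  rewrite lef_pV2 ?posrE // ler_nat; case: (posnP k) => [->|k0] //.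
  by rewrite leq_exp2r // ltnW.
lra.
Qed.

(** The mass of a ball is about the proportion of the cells of level [k] in it,
    hence about the proportion of the approximate squares of side [delta] in it:
    a number that [transfer_count] compares on both sides of [f], over a total that
    [transfer_total] compares. *)
Lemma mass_eball_le_scale (delta : R) k e k' e' x r : L x -> 0 < r ->
  scale m n delta k e -> scale m' n' delta k' e' ->
  2 <= r * (m ^ k)%:R -> 2 <= r * (m' ^ k')%:R ->
  mass nu' (eball (f x) r) <=
    (transfer_const n' C * transfer_const n C)%:R * mass nu (eball x ((2 * C + 1) * r)).
Proof.
move=> Lx r0 sc sc' hk hk'.
have [[[m1 mn] m1'] mn'] := (carpet_m_gt1 hL, carpet_mn hL, carpet_m_gt1 hL', carpet_mn hL').
have [g [hg gf fg]] := bilip_inverse C1 hf.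
have tot := transfer_total hL' hL C1 hg sc' sc.
set c := transfer_const n' C; set c2 := transfer_const n C in tot *.
pose E := L `&` eball x (C * (2 * r)).
have tr := transfer_count hL hL' C1 hf sc sc' (@subIsetl _ L (eball x (C * (2 * r)))).
set S' := [seq a <- addresses A' k' 0 | `[< box a `&` eball (f x) r !=set0 >]].
set S := [seq a <- addresses A k 0 | `[< box a `<=` eball x ((2 * C + 1) * r) >]].
have up := mass_upper hL' hnu' k' 0 (measurable_eball (f x) r).
rewrite addn0 sum_fibre_count0 -/S' in up.
have lo := mass_lower hL hnu k 0 (measurable_eball x ((2 * C + 1) * r)).
rewrite addn0 sum_fibre_count0 -/S in lo.
have h1 : (size S' * num_columns A' ^ e' <=
    size [seq a <- addresses A' k' e' | `[< exists2 x0, E x0 & box a (f x0) >]])%N.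
  apply: size_addresses_refine => w u hw hwu /asboolP[y [wy yr]]; apply/asboolP.
  have [z Lz wz] := box_point hL' hwu.
  have [x0 Lx0 fx0] := bilip_surj hf Lz.
  exists x0; rewrite ?fx0 //; split => //; rewrite /eball /=.
  apply: (le_trans (bilip_ge C1 hf Lx Lx0)); rewrite ler_wpM2l ?(ltW C0) // fx0.
  apply: (le_trans (edist_triangle y _ _)).
  have wz' : box (w, [::]) z.
    by move: wz; rewrite -[u]cat0s; apply: box_catr; apply: ltnW.
  have := box_diam m1' mn' hk' hw wy wz'.
  move: yr; rewrite /eball /=; lra.
have h2 : (size [seq a <- addresses A k e | `[< exists2 x0, E x0 & box a x0 >]] <=
    size S * num_columns A ^ e)%N.
  apply: size_addresses_coarsen => w u hw hwu /asboolP[y [Ly yr] wy]; apply/asboolP => z wz.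
  have wy' : box (w, [::]) y.
    by move: wy; rewrite -[u]cat0s; apply: box_catr; apply: ltnW.
  apply: (le_trans (edist_triangle y _ _)).
  have := box_diam m1 mn hk hw wy' wz.
  move: yr; rewrite /eball /=; lra.
have h3 : (size S' * num_columns A' ^ e' <= c * (size S * num_columns A ^ e))%N.
  apply: (leq_trans h1); apply: (leq_trans tr); by rewrite leq_mul2l h2 orbT.
have h4 : (size S' * #|A| ^ k <= c * c2 * size S * #|A'| ^ k')%N.
  have Me : (0 < num_columns A ^ e)%N by rewrite expn_gt0 (num_columns_gt0 hL).
  rewrite -(leq_pmul2r Me) -mulnA.
  apply: (@leq_trans (size S' * (c2 * (#|A'| ^ k' * num_columns A' ^ e')))%N).
    by rewrite leq_mul2l tot orbT.
  rewrite [leqLHS](_ : _ = (c2 * #|A'| ^ k') * (size S' * num_columns A' ^ e'))%N; last by lia.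
  rewrite [leqRHS](_ : _ = (c2 * #|A'| ^ k') * (c * (size S * num_columns A ^ e)))%N; last by lia.
  by rewrite leq_mul2l h3 orbT.
have N0 : 0 < (#|A| ^ k)%:R :> R by rewrite ltr0n expn_gt0 (carpet_card_gt0 hL).
have N0' : 0 < (#|A'| ^ k')%:R :> R by rewrite ltr0n expn_gt0 (carpet_card_gt0 hL').
apply: (le_trans up); apply: (@le_trans _ _ ((c * c2)%:R * (#|A|%:R ^- k * (size S)%:R))).
  rewrite -!natrX mulrC ler_pdivrMr // mulrCA [X in _ <= X * _]mulrC mulrAC.
  by rewrite ler_pdivlMr // -!natrM ler_nat.
by rewrite ler_wpM2l.
Qed.

Lemma mass_eball_comparison : exists2 K : R, 1 <= K & exists2 D : R, 1 <= D &
  forall x r, L x -> 0 < r -> mass nu' (eball (f x) r) <= K * mass nu (eball x (D * r)).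
Proof.
have [[[m1 mn] m1'] mn'] := (carpet_m_gt1 hL, carpet_mn hL, carpet_m_gt1 hL', carpet_mn hL').
exists (transfer_const n' C * transfer_const n C)%:R; first by rewrite ler1n /transfer_const.
exists (2 * C + 1) => [|x r Lx r0]; first by have := C0; lra.
pose K := Num.bound (2 / r).
have hK p q j : (1 < p)%N -> (K <= j)%N -> q = r -> 2 <= q * (p ^ j)%:R.
  move=> p1 Kj ->; rewrite -ler_pdivrMl // mulrC.
  apply: (@le_trans _ _ K%:R).
    by apply: ltW; apply: archi_boundP; rewrite divr_ge0 // ltW.
  by rewrite ler_nat (leq_trans Kj) // ltnW // ltn_expl.
(* fine enough for the levels of both carpets to reach [K] *)
pose d : R := ((n * n') ^ K)%:R^-1.
have n0 : (0 < n)%N := ltn_trans (ltnW m1) mn.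
have n0' : (0 < n')%N := ltn_trans (ltnW m1') mn'.
have d0 : 0 < d by rewrite invr_gt0 ltr0n expn_gt0 muln_gt0 n0 n0'.
have d1 : 0 < d <= 1 by rewrite d0 /= invf_le1 ?ler1n ?ltr0n expn_gt0 muln_gt0 n0 n0'.
have [k [e sc]] := ex_scale m1 mn d1.
have [k' [e' sc']] := ex_scale m1' mn' d1.
apply: (mass_eball_le_scale Lx r0 sc sc'); apply: hK => //.
- apply: (scale_ge m1 mn sc); rewrite /d mulrC ler_pdivrMr ?mul1r ?ler_nat.
    by rewrite expnMn leq_pmulr // expn_gt0 n0'.
  by rewrite ltr0n expn_gt0 muln_gt0 n0 n0'.
- apply: (scale_ge m1' mn' sc'); rewrite /d mulrC ler_pdivrMr ?mul1r ?ler_nat.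
    by rewrite expnMn leq_pmull // expn_gt0 n0.
  by rewrite ltr0n expn_gt0 muln_gt0 n0 n0'.
Qed.

End MeasureComparison.

(** * Supports *)

Lemma fibre_count_gt0 (m n : nat) (A : {set 'I_m * 'I_n}) (u : seq 'I_m) :
  all (mem (cols A)) u -> (0 < fibre_count A u)%N.
Proof.
move=> /allP h; rewrite /fibre_count big_seq prodn_cond_gt0 // => i /h /=.
by rewrite mem_cols.
Qed.

Lemma fibre_count_cat (m n : nat) (A : {set 'I_m * 'I_n}) u v :
  fibre_count A (u ++ v) = (fibre_count A u * fibre_count A v)%N.
Proof. by rewrite /fibre_count big_cat. Qed.

Section Support.
Context {R : realType} {m n : nat} {A : {set 'I_m * 'I_n}} {L : set (R * R)}
  {nu : probability (R * R)%type R}.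
Hypothesis hL : bm_carpet A L.
Hypothesis hnu : uniform_bernoulli A nu.

Let m1 := carpet_m_gt1 hL.
Let n1 := carpet_n_gt1 hL.

Lemma mass_eball_ge_box k e a x r : a \in addresses A k e -> box a x ->
  (m ^ (k + e))%:R^-1 + (n ^ k)%:R^-1 <= r ->
  #|A|%:R ^- (k + e) * (fibre_count A a.2)%:R <= mass nu (eball x r).
Proof.
move=> ha ax hr; apply: le_trans (mass_lower hL hnu k e (measurable_eball x r)).
rewrite ler_wpM2l ?invr_ge0 ?exprn_ge0 ?ler0n // big_mkcond (big_rem a) //=.
rewrite asboolT; last first.
  move=> y ay; apply: le_trans hr.
  exact: (box_dist (ltnW m1) (ltnW n1) ha ax ay).
by rewrite lerDl sumr_ge0 // => b _; case: ifP.
Qed.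

Lemma ex_level (r : R) : 0 < r -> exists k : nat, (m ^ k)%:R^-1 + (n ^ k)%:R^-1 <= r.
Proof.
move=> r0; exists (Num.bound (2 / r)); set k := Num.bound _.
have aux q : (1 < q)%N -> (q ^ k)%:R^-1 <= r / 2.
  move=> q1; rewrite -[r / 2]invrK lef_pV2 ?posrE ?invr_gt0 ?ltr0n ?expn_gt0 ?divr_gt0 ?(ltnW q1)
    //.
  rewrite invf_div; apply: (@le_trans _ _ k%:R).
    by apply/ltW/archi_boundP; rewrite divr_ge0 // ltW.
  by rewrite ler_nat ltnW // ltn_expl.
by have := aux _ m1; have := aux _ n1; lra.
Qed.

Lemma mass_eball_gt0 x r : L x -> 0 < r -> 0 < mass nu (eball x r).
Proof.
move=> Lx /ex_level[k hk]; have [a ha ax] := point_address hL k 0 Lx.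
have := @mass_eball_ge_box k 0 a x r ha ax; rewrite addn0 => /(_ hk); apply: lt_le_trans.
move: ha; rewrite mem_addresses => /and4P[_ _ _ ha].
by rewrite mulr_gt0 ?invr_gt0 ?exprn_gt0 ?ltr0n ?(carpet_card_gt0 hL) ?fibre_count_gt0.
Qed.

(** A small ball centred off the closed set [L] meets none of the cells of a high
    level, as each of them contains a point of [L]. *)
Lemma msupport_carpet : msupport nu = L.
Proof.
apply/seteqP; split => x; last first.
  move=> Lx r r0; rewrite massE ?lte_fin; last exact: measurable_eball.
  exact: mass_eball_gt0.
move=> sx; apply: contrapT => nLx.
have : nbhs x (~` L).
  by apply: open_nbhs_nbhs; split => //; apply: closed_openC; exact: carpet_closed hL.
move=> /nbhs_ballP[r /= r0 hr].
have r4 : 0 < r / 4 by rewrite divr_gt0.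
have [k hk] := ex_level r4.
have := sx _ r4; rewrite massE ?lte_fin; last exact: measurable_eball.
apply/negP; rewrite -leNgt; apply: (le_trans (mass_upper hL hnu k 0 (measurable_eball x _))).
rewrite big1_seq ?mulr0 // => a /andP[/asboolP[y [ay yr]] ha].
have [z Lz az] := box_point hL ha.
exfalso; apply: (hr z) => //.
have := box_dist (ltnW m1) (ltnW n1) ha ay az; rewrite addn0 => dyz.
have dxz := le_trans (edist_triangle y x z) (lerD yr (le_trans dyz hk)).
have := le_trans (edist_ge1 x z) dxz; have := le_trans (edist_ge2 x z) dxz => h2 h1.
by split; rewrite /ball /=; lra.
Qed.

End Support.

(** * Local dimensions *)

Section LocalDim.
Context {R : realType}.

Lemma near_right_scale (D : R) (P : set R) : 0 < D ->
  (\forall r \near 0^'+, P r) -> \forall r \near 0^'+, P (D * r).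
Proof.
move=> D0 [e /= e0 he]; exists (e / D) => /=; first by rewrite divr_gt0.
move=> r /=; rewrite sub0r normrN ltr_pdivlMr // => hr r0.
apply: he; last by rewrite mulr_gt0.
by rewrite /= sub0r normrN normrM (gtr0_norm D0) mulrC.
Qed.

Lemma cvg_right_scale (D l : R) (F : R -> R) : 0 < D ->
  F r @[r --> 0^'+] --> l -> F (D * r) @[r --> 0^'+] --> l.
Proof. by move=> D0 h P /h hP; apply: (near_right_scale (P := fun r => P (F r)) D0 hP). Qed.

Lemma near_right_lt (e : R) : 0 < e -> \forall r \near (0 : R)^'+, 0 < r < e.
Proof.
move=> e0; exists e => //= r /=; rewrite sub0r normrN => hr r0.
by rewrite r0 /=; move: hr; rewrite gtr0_norm.
Qed.

Lemma cvg_div_ln (B : R) : B / ln r @[r --> (0 : R)^'+] --> (0 : R).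
Proof.
rewrite -[X in _ --> X](mulr0 B); apply: cvgMr.
apply/ltr0_cvgV0; last exact: lnNy.
apply: filterS (near_right_lt ltr01) => r; exact: ln_lt0.
Qed.

Lemma cvg_ln_scale (D : R) : 0 < D -> ln (D * r) / ln r @[r --> (0 : R)^'+] --> (1 : R).
Proof.
move=> D0; rewrite -[X in _ --> X]add0r.
have : ln D / ln r + 1 @[r --> (0 : R)^'+] --> (0 + 1 : R).
  by apply: cvgD; [exact: cvg_div_ln|exact: cvg_cst].
apply: cvg_trans; apply: near_eq_cvg.
apply: filterS (near_right_lt ltr01) => r /andP[r0 r1].
by rewrite lnM ?posrE // mulrDl divff // lt_eqF // ln_lt0 // r0.
Qed.

(** Bounded factors add [O(1)] to the logarithms, and rescaling the radius
    multiplies [ln r] by a factor tending to 1; both disappear after division. *)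
Lemma log_rate_comparison (M M' : R -> R) (K D l : R) : 1 <= K -> 1 <= D ->
  (forall r, 0 < r -> 0 < M r) -> (forall r, 0 < r -> 0 < M' r) ->
  (forall r, 0 < r -> M' r <= K * M (D * r)) ->
  (forall r, 0 < r -> M r <= K * M' (D * r)) ->
  ln (M r) / ln r @[r --> (0 : R)^'+] --> l ->
  ln (M' r) / ln r @[r --> (0 : R)^'+] --> l.
Proof.
move=> K1 D1 M0 M0' h1 h2 hl.
have K0 : 0 < K by apply: lt_le_trans K1.
have D0 : 0 < D by apply: lt_le_trans D1.
have rate E : 0 < E -> ln (M (E * r)) / ln r @[r --> (0 : R)^'+] --> l.
  move=> E0; rewrite -[l]mulr1.
  have cv := @cvg_right_scale E l (fun r => ln (M r) / ln r) E0 hl.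
  apply: cvg_trans (cvgM cv (cvg_ln_scale E0)); apply: near_eq_cvg.
  have e0 : 0 < Num.min 1 E^-1 by rewrite lt_min ltr01 invr_gt0.
  apply: filterS (near_right_lt e0) => r /andP[r0]; rewrite lt_min => /andP[r1 rE].
  rewrite /= mulrA divfK // lt_eqF // ln_lt0 // mulr_gt0 //=.
  by rewrite -ltr_pdivlMl // mulr1.
apply: (@squeeze_cvgr _ _ _ _ (fun r => ln K / ln r + ln (M (D * r)) / ln r) (fun r =>
  - ln K / ln r + ln (M (D^-1 * r)) / ln r)).
- apply: filterS (near_right_lt ltr01) => r /andP[r0 r1].
  have lr : ln r < 0 by rewrite ln_lt0 // r0.
  have Di0 : 0 < D^-1 * r by rewrite mulr_gt0 // invr_gt0.
  rewrite -!mulrDl !ler_nM2r ?invr_lt0 //.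
  have := h1 _ r0; have := h2 _ Di0; rewrite mulrA divff ?gt_eqF // mul1r => h2' h1'.
  apply/andP; split.
  + rewrite -lnM ?posrE ?M0 ?mulr_gt0 // ler_ln ?posrE ?M0' //.
    by rewrite mulr_gt0 ?M0 // mulr_gt0.
  + rewrite addrC lerBlDl -lnM ?posrE ?M0' // ler_ln ?posrE ?M0 // mulr_gt0 //; exact: M0'.
- rewrite -[X in _ --> X]add0r; apply: cvgD; [exact: cvg_div_ln|exact: rate].
- rewrite -[X in _ --> X]add0r; apply: cvgD; [exact: cvg_div_ln|apply: rate].
  by rewrite invr_gt0.
Qed.

End LocalDim.

(** * Hausdorff dimension *)

Section Hausdorff.
Context {R : realType}.
Implicit Types X U : set (R * R).

Lemma ediam_image_le (f : R * R -> R * R) (C : R) X U : 0 <= C ->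
  (forall x y, X x -> X y -> edist (f x) (f y) <= C * edist x y) ->
  (ediam (f @` (U `&` X)) <= C%:E * ediam U)%E.
Proof.
move=> C0 lip; apply: ge_ereal_sup => _ [_ [_ [[x [Ux Xx] <-] [y [Uy Xy] <-] ->]]].
apply: (@le_trans _ _ (C%:E * (edist x y)%:E)%E); first by rewrite -EFinM lee_fin lip.
by apply: lee_wpmul2l; rewrite ?lee_fin //; apply: ereal_sup_ubound; exists x, y.
Qed.

Lemma ediam_ge0 U : U !=set0 -> (0 <= ediam U)%E.
Proof.
move=> [x Ux]; apply: (@le_trans _ _ (edist x x)%:E); first by rewrite lee_fin edist_ge0.
by apply: ereal_sup_ubound; exists x, x.
Qed.

Lemma hausdorff_premeasure_ge0 (s d : R) X : (0 <= hausdorff_premeasure s d X)%E.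
Proof.
apply: le_ereal_inf_tmp => _ [U [_ _ ->]]; apply: nneseries_ge0 => i _ _; exact: poweR_ge0.
Qed.

Lemma hausdorff_measure_eq0 (s : R) X :
  hausdorff_measure s X = 0%E <-> forall d, 0 < d -> hausdorff_premeasure s d X = 0%E.
Proof.
split => [h d d0|h].
- apply/eqP; rewrite eq_le hausdorff_premeasure_ge0 andbT -h.
  by apply: ereal_sup_ubound; exists d.
- apply/eqP; rewrite eq_le; apply/andP; split.
  + by apply: ge_ereal_sup => _ [d /= d0 <-]; rewrite h.
  + rewrite -(h 1 ltr01); by apply: ereal_sup_ubound; exists 1 => //=.
Qed.

(** The images of the members of a cover of [X], cut down to [X], cover the image,
    and their diameters grow by at most [C]. *)
Lemma hausdorff_premeasure_image (f : R * R -> R * R) (C s d : R) X :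
  0 < C -> 0 <= s -> 0 < d ->
  (forall x y, X x -> X y -> edist (f x) (f y) <= C * edist x y) ->
  (hausdorff_premeasure s d (f @` X) <= (C `^ s)%:E * hausdorff_premeasure s (d / C) X)%E.
Proof.
move=> C0 s0 d0 lip; rewrite -lee_pdivrMl ?powR_gt0 //.
apply: le_ereal_inf_tmp => _ [U [XU Ud ->]]; rewrite lee_pdivrMl ?powR_gt0 //.
pose V i := f @` (U i `&` X).
have VU i : (ediam (V i) <= C%:E * ediam (U i))%E by apply: ediam_image_le => //; exact: ltW.
apply: (@le_trans _ _ (\sum_(i <oo | V i != set0) poweR (ediam (V i)) s)%E).
  apply: ereal_inf_lbound; exists V; split => //.
  - move=> _ [x Xx <-]; have [i _ Ux] := XU _ Xx; exists i => //; by exists x.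
  - by move=> i; apply: (le_trans (VU i)); rewrite muleC -lee_pdivlMr ?EFinM.
rewrite -nneseriesZl; last by move=> i _; apply: poweR_ge0.
rewrite [leLHS]eseries_mkcond [leRHS]eseries_mkcond.
apply: lee_nneseries => i _; first by move=> _; case: ifP => // _; exact: poweR_ge0.
case: ifP => [/set0P Vi|_]; last first.
  by case: ifP => // _; rewrite mule_ge0 ?poweR_ge0 // lee_fin powR_ge0.
have Ui : U i !=set0 by case: Vi => _ [x [Ux _] _]; exists x.
rewrite ifT; last exact/set0P.
have dU := ediam_ge0 Ui.
have Ufin : ediam (U i) \is a fin_num.
  by rewrite ge0_fin_numE //; apply: le_lt_trans (Ud i) _; rewrite ltry.
apply: (@le_trans _ _ (poweR (C%:E * ediam (U i)) s)).
  apply: gt0_ler_poweR => //; rewrite in_itv /= leey andbT.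
  - exact: ediam_ge0.
  - by rewrite mule_ge0 // lee_fin ltW.
rewrite -(fineK Ufin) -EFinM !poweR_EFin -EFinM lee_fin powRM ?(ltW C0) //.
by rewrite -lee_fin fineK.
Qed.

Lemma hausdorff_dim_image_le (f : R * R -> R * R) (C : R) X : 0 < C ->
  (forall x y, X x -> X y -> edist (f x) (f y) <= C * edist x y) ->
  (hausdorff_dim (f @` X) <= hausdorff_dim X)%E.
Proof.
move=> C0 lip; apply: le_ereal_inf_tmp => _ [s [s0 /hausdorff_measure_eq0 hs] <-].
apply: ereal_inf_lbound; exists s => //; split => //; apply/hausdorff_measure_eq0 => d d0.
apply/eqP; rewrite eq_le hausdorff_premeasure_ge0 andbT.
apply: (le_trans (hausdorff_premeasure_image C0 s0 d0 lip)).
by rewrite hs ?mule0 // divr_gt0.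
Qed.

End Hausdorff.

(** * Multifractal spectra *)

Section SpectrumComparison.
Context {R : realType}.
Context {m n : nat} {A : {set 'I_m * 'I_n}} {L : set (R * R)}.
Context {m' n' : nat} {A' : {set 'I_m' * 'I_n'}} {L' : set (R * R)}.
Context {nu nu' : probability (R * R)%type R}.
Hypothesis hL : bm_carpet A L.
Hypothesis hL' : bm_carpet A' L'.
Hypothesis hnu : uniform_bernoulli A nu.
Hypothesis hnu' : uniform_bernoulli A' nu'.
Context {C : R} {f : R * R -> R * R}.
Hypothesis C1 : 1 <= C.
Hypothesis hf : bilip_onto C f L L'.

Lemma mass_eball_equivalence : exists2 K : R, 1 <= K & exists2 D : R, 1 <= D &
  forall x r, L x -> 0 < r ->
    mass nu' (eball (f x) r) <= K * mass nu (eball x (D * r)) /\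
    mass nu (eball x r) <= K * mass nu' (eball (f x) (D * r)).
Proof.
have [g [hg gf _]] := bilip_inverse C1 hf.
have [K1 hK1 [D1 hD1 h1]] := mass_eball_comparison hL hL' hnu hnu' C1 hf.
have [K2 hK2 [D2 hD2 h2]] := mass_eball_comparison hL' hL hnu' hnu C1 hg.
exists (Num.max K1 K2); first by rewrite le_max hK1.
exists (Num.max D1 D2) => [|x r Lx r0]; first by rewrite le_max hD1.
split.
- apply: (le_trans (h1 x r Lx r0)); apply: ler_pM; rewrite ?mass_ge0 ?le_max ?lexx //.
    exact: le_trans ler01 hK1.
  apply: mass_mono; [exact: measurable_eball|exact: measurable_eball|].
  by apply: eball_mono; rewrite ler_pM2r // le_max lexx.
- have := h2 (f x) r (bilip_mem hf Lx) r0; rewrite gf // => h.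
  apply: (le_trans h); apply: ler_pM; rewrite ?mass_ge0 ?le_max ?lexx ?orbT //.
    exact: le_trans ler01 hK2.
  apply: mass_mono; [exact: measurable_eball|exact: measurable_eball|].
  by apply: eball_mono; rewrite ler_pM2r // le_max lexx orbT.
Qed.

Lemma has_local_dim_bilip x alpha : L x ->
  has_local_dim nu x alpha <-> has_local_dim nu' (f x) alpha.
Proof.
move=> Lx; have [K K1 [D D1 h]] := mass_eball_equivalence.
have g0 r : 0 < r -> 0 < mass nu (eball x r) by move=> r0; apply: (mass_eball_gt0 hL hnu).
have g0' r : 0 < r -> 0 < mass nu' (eball (f x) r).
  by move=> r0; apply: (mass_eball_gt0 hL' hnu') => //; apply: bilip_mem hf _ Lx.
have h1 r (r0 : 0 < r) := (h x r Lx r0).1; have h2 r (r0 : 0 < r) := (h x r Lx r0).2.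
split; exact: log_rate_comparison K1 D1 _ _ _ _.
Qed.

(** The map carries each level set of the local dimension onto the corresponding
    one, and Lipschitz maps do not raise the Hausdorff dimension. *)
Lemma multifractal_spectrum_le alpha :
  (multifractal_spectrum nu' alpha <= multifractal_spectrum nu alpha)%E.
Proof.
rewrite /multifractal_spectrum (msupport_carpet hL hnu) (msupport_carpet hL' hnu').
have -> : [set y | L' y /\ has_local_dim nu' y alpha] =
    f @` [set x | L x /\ has_local_dim nu x alpha].
  apply/seteqP; split => [y [L'y ly]|_ [x [Lx lx] <-]].
  - have [x Lx fx] := bilip_surj hf L'y; exists x => //; split => //.
    by apply/has_local_dim_bilip; rewrite ?fx.
  - by split; [exact: bilip_mem hf _ Lx|apply/(has_local_dim_bilip _ Lx)].
apply: (@hausdorff_dim_image_le _ f C); first exact: lt_le_trans C1.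
by move=> x y [Lx _] [Ly _]; apply: bilip_le hf _ _ Lx Ly.
Qed.

End SpectrumComparison.

(** * Moments over approximate squares *)

Definition column_power_sum {R : realType} (m n : nat) (A : {set 'I_m * 'I_n}) (q : R) : R :=
  \sum_(i <- cols A) (column_size A i)%:R `^ q.

(** The exponential growth rate of the moments of the approximate squares of side
    [delta], whose levels are [k = ln delta^-1 / ln n] and
    [k + e = ln delta^-1 / ln m]. *)
Definition Lq_exponent {R : realType} (m n : nat) (A : {set 'I_m * 'I_n}) (q : R) : R :=
  (ln #|A|%:R - ln (column_power_sum A q)) / ln n%:R +
  (ln (column_power_sum A q) - q * ln #|A|%:R) / ln m%:R.

Definition box_mass {R : realType} (m n : nat) (A : {set 'I_m * 'I_n}) k e
  (a : seq ('I_m * 'I_n) * seq 'I_m) : R := #|A|%:R ^- (k + e) * (fibre_count A a.2)%:R.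

Lemma powR_prod (R : realType) (T : Type) (s : seq T) (g : T -> R) (q : R) :
  (forall x, 0 <= g x) -> (\prod_(x <- s) g x) `^ q = \prod_(x <- s) (g x `^ q).
Proof.
move=> g0; elim: s => [|x s IH]; first by rewrite !big_nil powR1.
by rewrite !big_cons powRM ?IH // prodr_ge0.
Qed.

Section Moments.
Context {R : realType} {m n : nat} {A : {set 'I_m * 'I_n}} {L : set (R * R)}.
Hypothesis hL : bm_carpet A L.
Implicit Types q : R.

Let m1 := carpet_m_gt1 hL.
Let mn := carpet_mn hL.
Let n1 := carpet_n_gt1 hL.

Lemma card_gt0R : 0 < #|A|%:R :> R.
Proof. by rewrite ltr0n (carpet_card_gt0 hL). Qed.

Lemma box_mass_gt0 k e a : a \in addresses A k e -> 0 < box_mass A k e a :> R.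
Proof.
rewrite mem_addresses => /and4P[_ _ _ ha].
by rewrite mulr_gt0 ?invr_gt0 ?exprn_gt0 ?card_gt0R // ltr0n fibre_count_gt0.
Qed.

Lemma column_power_sum_gt0 q : 0 < column_power_sum A q.
Proof.
have [i hi] : exists i, i \in cols A.
  by have := num_columns_gt0 hL; rewrite -size_cols; case: (cols A) => // i s; exists i;
    rewrite mem_head.
rewrite /column_power_sum (big_rem i) //= ltr_wpDr ?sumr_ge0 // ?powR_gt0 ?ltr0n -?mem_cols //.
Qed.

(** The mass of a square is a product over its further columns, so the sum over the
    words of columns factorizes. *)
Lemma box_moment k e q :
  \sum_(a <- addresses A k e) box_mass A k e a `^ q =
  #|A|%:R ^+ k * (#|A|%:R ^- (k + e)) `^ q * column_power_sum A q ^+ e.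
Proof.
rewrite big_addresses /=.
rewrite (eq_bigr (fun _ => (#|A|%:R ^- (k + e)) `^ q * column_power_sum A q ^+ e)) => [|w _].
  by rewrite big_const_seq count_predT size_words -cardE iter_addr_0 -[LHS]mulr_natl natrX mulrA.
rewrite -big_words_prod mulr_sumr; apply: eq_bigr => u _.
rewrite /box_mass powRM ?invr_ge0 ?exprn_ge0 ?ler0n // /fibre_count natr_prod powR_prod //.
Qed.

Lemma scale_log (delta : R) k e : scale m n delta k e ->
  0 <= k%:R + ln delta / ln n%:R <= 1 /\ 0 <= (k + e)%:R + ln delta / ln m%:R <= 1.
Proof.
move=> sc; have d0 := scale_delta_gt0 m1 mn sc.
have bd p j : (1 < p)%N -> 1 <= delta * (p ^ j)%:R < p%:R ->
    0 <= j%:R + ln delta / ln p%:R <= 1.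
  move=> p1 /andP[h1 h2]; have p0 : 0 < p%:R :> R by rewrite ltr0n ltnW.
  have lp : 0 < ln p%:R :> R by rewrite ln_gt0 // ltr1n.
  have h0 : 0 < delta * (p ^ j)%:R by apply: lt_le_trans h1.
  have -> : j%:R + ln delta / ln p%:R = ln (delta * (p ^ j)%:R) / ln p%:R.
    rewrite natrX lnM ?posrE ?exprn_gt0 // lnXn // -(mulr_natr (ln _)) mulrDl mulrAC divff
      ?gt_eqF //.
    by rewrite mul1r addrC.
  rewrite (divr_ge0 (ln_ge0 h1) (ltW lp)) /= ler_pdivrMr // mul1r ler_ln ?posrE //; exact: ltW.
by have [s1 s2] := sc; split; apply: bd.
Qed.

(** Substituting the logarithmic values of the levels costs a bounded amount, each
    level being off by at most 1. *)
Lemma ln_box_moment q : exists c : R, forall delta k e, scale m n delta k e ->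
  `|ln (\sum_(a <- addresses A k e) box_mass A k e a `^ q) + ln delta * Lq_exponent A q| <= c.
Proof.
set N := ln #|A|%:R : R; set P := ln (column_power_sum A q).
exists (`|N - P| + `|P - q * N|) => delta k e /scale_log[hu hv].
have N0 := card_gt0R; have P0 := column_power_sum_gt0 q.
have -> : ln (\sum_(a <- addresses A k e) box_mass A k e a `^ q) =
    (N - P) * k%:R + (P - q * N) * (k + e)%:R.
  rewrite box_moment !lnM ?posrE ?mulr_gt0 ?exprn_gt0 ?powR_gt0 ?invr_gt0 ?exprn_gt0 //.
  rewrite ln_powR lnV ?posrE ?exprn_gt0 // !lnXn // -!(mulr_natr (ln _)) -/N !natrD.
  by rewrite -/P; ring.
have -> : (N - P) * k%:R + (P - q * N) * (k + e)%:R + ln delta * Lq_exponent A q =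
    (N - P) * (k%:R + ln delta / ln n%:R) + (P - q * N) * ((k + e)%:R + ln delta / ln m%:R).
  by rewrite /Lq_exponent -/N -/P; ring.
apply: (le_trans (ler_normD _ _)).
by case/andP: hu hv => u0 u1 /andP[v0 v1]; rewrite lerD // normrM ler_piMr // ger0_norm.
Qed.

(** The exponent of the mass of an approximate square all of whose further columns
    have [v] elements. *)
Definition box_exponent (v : nat) : R :=
  (ln #|A|%:R - ln v%:R) / ln m%:R + ln v%:R / ln n%:R.

Lemma ln_box_extreme (v : nat) : exists c : R, forall delta k e, scale m n delta k e ->
  `|e%:R * ln v%:R - (k + e)%:R * ln #|A|%:R - ln delta * box_exponent v| <= c.
Proof.
set N := ln #|A|%:R : R; set V := ln v%:R : R.
exists (`|V - N| + `|V|) => delta k e /scale_log[hu hv].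
have -> : e%:R * V - (k + e)%:R * N - ln delta * box_exponent v =
    (V - N) * ((k + e)%:R + ln delta / ln m%:R) - V * (k%:R + ln delta / ln n%:R).
  by rewrite /box_exponent -/N -/V natrD; ring.
apply: (le_trans (ler_normB _ _)).
by case/andP: hu hv => u0 u1 /andP[v0 v1]; rewrite lerD // normrM ler_piMr // ger0_norm.
Qed.

End Moments.
Arguments box_exponent {R m n} A v.

(** * Upper bounds for moments *)

(** A negative power reverses the inequality, so the sign of [q] decides which of
    the two bounds is called for. *)
Lemma powR_le_sym (R : realType) (q E x y : R) : 1 <= E -> 0 < x -> 0 < y ->
  (0 <= q -> x <= E * y) -> (q < 0 -> y <= E * x) -> x `^ q <= E `^ `|q| * y `^ q.
Proof.
move=> E1 x0 y0 h1 h2; have E0 : 0 < E by apply: lt_le_trans E1.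
have [q0|q0] := leP 0 q.
- rewrite ger0_norm // -powRM ?(ltW E0) ?(ltW y0) //.
  by apply: ge0_ler_powR; rewrite ?nnegrE ?mulr_ge0 ?(ltW x0) ?(ltW E0) ?(ltW y0) ?h1.
- have nq : 0 <= - q by rewrite oppr_ge0 ltW.
  have -> : `|q| = - q by rewrite ltr0_norm.
  move: nq; have -> : q = - (- q) by rewrite opprK.
  move: (- q) => p; rewrite opprK => p0; rewrite !powRN.
  rewrite ler_pdivlMr ?powR_gt0 // mulrC ler_pdivrMr ?powR_gt0 //.
  rewrite -powRM ?(ltW E0) ?(ltW x0) //.
  by apply: ge0_ler_powR; rewrite ?nnegrE ?mulr_ge0 ?(ltW x0) ?(ltW E0) ?(ltW y0) ?h2.
Qed.

Lemma sum_le_size_max (R : realType) (T : eqType) (S : seq T) (t : T -> R) :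
  S != [::] -> exists2 b, b \in S & \sum_(a <- S) t a <= (size S)%:R * t b.
Proof.
elim: S => [|a S IH] // _; have [->|S0] := eqVneq S [::].
  by exists a; rewrite ?mem_head // big_seq1 mul1r.
have [b bS hb] := IH S0; rewrite big_cons /=.
have hS c : (size S).+1%:R * c = (size S)%:R * c + c by rewrite -natr1 mulrDl mul1r.
have [ab|ba] := leP (t a) (t b).
- by exists b; rewrite ?inE ?bS ?orbT // hS addrC lerD.
- exists a; rewrite ?mem_head // hS addrC lerD // (le_trans hb) // ler_wpM2l ?ler0n //.
  exact: ltW.
Qed.

Section MomentUpper.
Context {R : realType} {m n : nat} {A : {set 'I_m * 'I_n}} {L : set (R * R)}
  {nu : probability (R * R)%type R}.
Hypothesis hL : bm_carpet A L.
Hypothesis hnu : uniform_bernoulli A nu.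
Implicit Types q : R.

Let m1 := carpet_m_gt1 hL.
Let mn := carpet_mn hL.
Let n1 := carpet_n_gt1 hL.

Let adr k e (x : R * R) : seq ('I_m * 'I_n) * seq 'I_m :=
  xget ([::], [::]) [set a | a \in addresses A k e /\ box a x].

Let adrP k e x : L x -> adr k e x \in addresses A k e /\ box (adr k e x) x.
Proof.
move=> /(point_address hL k e)[a ha ax]; rewrite /adr.
by case: xgetP => [b -> //|/(_ a)]; case.
Qed.

Lemma scale_box_dist (delta : R) k e a x y : scale m n delta k e ->
  a \in addresses A k e -> box a x -> box a y -> edist x y <= 2 * delta.
Proof.
move=> sc ha ax ay; apply: (le_trans (box_dist (ltnW m1) (ltnW n1) ha ax ay)).
by have := scale_side1 m1 sc; have := scale_side2 m1 mn sc; lra.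
Qed.

(** In units of the sides, a set of diameter [B * delta] spreads over at most
    [B * n] in each direction. *)
Definition neighbour_bound (B : R) : nat :=
  let c := Num.bound (B * n%:R) in ((2 * c.+1).+1 * (2 * c.+1).+1)%N.

Lemma size_neighbours (delta B : R) k e (P : pred _) : 0 <= B -> scale m n delta k e ->
  (forall a b, a \in addresses A k e -> b \in addresses A k e -> P a -> P b ->
    exists x y : R * R, [/\ box a x, box b y & edist x y <= B * delta]) ->
  (size [seq a <- addresses A k e | P a] <= neighbour_bound B)%N.
Proof.
move=> B0 sc h; set c := Num.bound (B * n%:R).
apply: (size_boxes_le (R := R) (c := c) (d := c)) => a b ha hb Pa Pb.
have [x [y [ax by' hxy]]] := h a b ha hb Pa Pb; exists x, y.
have cb : B * n%:R <= c%:R by apply/ltW/archi_boundP; rewrite mulr_ge0.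
have d0 := scale_delta_gt0 m1 mn sc.
have aux (u y0 : R) p : u <= edist x y -> 0 <= y0 -> delta * y0 < p%:R -> (p <= n)%N ->
    u * y0 <= c%:R.
  move=> hu y0' hy hp; apply: (le_trans _ cb); apply: (@le_trans _ _ (B * delta * y0)).
    by rewrite ler_wpM2r // (le_trans hu).
  by rewrite -mulrA ler_wpM2l // (le_trans (ltW hy)) // ler_nat.
have [/andP[_ s1] /andP[_ s2]] := sc.
split => //.
- by apply: (aux _ _ m) => //; rewrite ?edist_ge1 // ltnW.
- by apply: (aux _ _ n) => //; rewrite edist_ge2.
Qed.

(** The ball is covered by boundedly many approximate squares; the heaviest of
    those accounts for its mass up to that number. *)
Lemma mass_le_neighbours (delta : R) k e x r (B : R) : 0 < r -> 0 <= B ->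
  scale m n delta k e -> L x -> 2 * r <= B * delta ->
  exists b, [/\ b \in addresses A k e, box b `&` eball x r !=set0 &
    mass nu (eball x r) <= (neighbour_bound B)%:R * box_mass A k e b].
Proof.
move=> r0 B0 sc Lx hr; set S := [seq b <- addresses A k e | `[< box b `&` eball x r !=set0 >]].
have hS : (size S <= neighbour_bound B)%N.
  apply: (size_neighbours B0 sc) => a b ha hb /asboolP[y [ay yr]] /asboolP[z [bz zr]].
  exists y, z; split => //; apply: le_trans hr; apply: (le_trans (edist_triangle x _ _)).
  by rewrite edistC; move: yr zr; rewrite /eball /=; lra.
have up := mass_upper hL hnu k e (measurable_eball x r).
rewrite -big_filter -/S mulr_sumr in up.
have S0 : S != [::].
  apply/eqP => S0; move: up; rewrite S0 big_nil; apply/negP; rewrite -ltNge.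
  exact: (mass_eball_gt0 hL hnu).
have [b bS hb] := sum_le_size_max (box_mass (R := R) A k e) S0.
move: (bS); rewrite mem_filter => /andP[/asboolP hb' bA]; exists b; split => //.
apply: (le_trans up); apply: (le_trans hb); rewrite ler_wpM2r ?ler_nat //.
exact/ltW/(box_mass_gt0 hL).
Qed.

(** For [q >= 0] the mass of a ball is bounded above by that of one of the boundedly
    many squares that it meets; for [q < 0] it is bounded below by that of a square
    which it contains. Either way a ball is charged to a nearby square, and the
    separation of the centres limits how often a square is charged. The values
    [M x] are only comparable to masses of balls, so that masses transported from
    another carpet may be inserted. *)
Lemma moment_upper q (E : R) : 1 <= E -> exists2 c : R, 0 < c &
  forall rho (s : seq (R * R)) (M : R * R -> R), 0 < rho <= 1 -> uniq s ->
    (forall x, x \in s -> L x) ->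
    {in s &, forall x y, x != y -> rho < edist x y} ->
    (forall x, x \in s -> 0 < M x /\ mass nu (eball x (rho / E)) <= E * M x /\
       M x <= E * mass nu (eball x (E * rho))) ->
  \sum_(x <- s) M x `^ q <= c * expR (- (ln rho * Lq_exponent A q)).
Proof.
move=> E1; have E0 : 0 < E by apply: lt_le_trans E1.
pose B := 6 * E ^+ 2; have B0 : 0 <= B by rewrite mulr_ge0 // sqr_ge0.
pose nb := neighbour_bound B.
have nb1 : 1 <= nb%:R :> R by rewrite ler1n /nb /neighbour_bound.
have [c2 hc2] := ln_box_moment hL q.
exists ((E * nb%:R) `^ `|q| * nb%:R * expR (c2 + ln (2 * E) * Lq_exponent A q)).
  by rewrite !mulr_gt0 ?powR_gt0 ?expR_gt0 ?mulr_gt0 // (lt_le_trans ltr01 nb1).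
move=> rho s M /andP[r0 r1] us sL sep hM.
pose d := rho / (2 * E); have d0 : 0 < d by rewrite divr_gt0 // mulr_gt0.
have rd : rho = 2 * E * d by rewrite /d mulrC divfK // gt_eqF // mulr_gt0.
have d1 : 0 < d <= 1.
  by rewrite d0 /= /d ler_pdivrMr ?mulr_gt0 // mul1r (le_trans r1) //; lra.
have [k [e sc]] := ex_scale m1 mn d1.
have EE : 1 <= E ^+ 2 by rewrite exprn_ege1.
have near x : x \in s -> exists b, [/\ b \in addresses A k e,
    exists2 z, box b z & edist x z <= E * rho &
    M x `^ q <= (E * nb%:R) `^ `|q| * box_mass A k e b `^ q].
  move=> xs; have Lx := sL x xs; have [M0 [M1 M2]] := hM x xs.
  have [q0|q0] := leP 0 q.
  - have hr : 2 * (E * rho) <= B * d by rewrite rd /B; nra.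
    have [b [hb [z [bz zr]] hbm]] := mass_le_neighbours (mulr_gt0 E0 r0) B0 sc Lx hr.
    exists b; split => //; first by exists z.
    apply: powR_le_sym => //; rewrite ?(box_mass_gt0 hL) //.
    + by rewrite -[X in X <= _]mulr1 ler_pM.
    + by move=> _; apply: (le_trans M2); rewrite -mulrA ler_wpM2l // ltW.
    + by rewrite ltNge q0.
  - have [ha ax] := adrP k e Lx; exists (adr k e x); split => //.
      by exists x; rewrite // edistxx mulr_ge0 // ltW.
    have b0 := box_mass_gt0 (R := R) hL ha.
    apply: powR_le_sym => //; first by rewrite -[X in X <= _]mulr1 ler_pM.
      by rewrite leNgt q0.
    move=> _; apply: (@le_trans _ _ (E * M x)).
      apply: le_trans M1; apply: (mass_eball_ge_box hL hnu ha ax).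
      have -> : rho / E = 2 * d by rewrite rd mulrAC mulrK // unitfE gt_eqF.
      by have := scale_side1 m1 sc; have := scale_side2 m1 mn sc; lra.
    by rewrite ler_pM2r // -[X in X <= _]mulr1 ler_pM2l.
have {near}near x : x \in s -> M x `^ q <= (E * nb%:R) `^ `|q| *
    \sum_(b <- addresses A k e | `[< exists2 z, box b z & edist x z <= E * rho >]) box_mass A k e
      b `^ q.
  move=> /near[b [hb hz hM']]; apply: (le_trans hM'); rewrite ler_wpM2l ?powR_ge0 //.
  rewrite big_mkcond (big_rem b) //= asboolT // lerDl sumr_ge0 // => a _.
  by case: ifP => // _; apply: powR_ge0.
apply: (@le_trans _ _ (\sum_(x <- s) (E * nb%:R) `^ `|q| *
    \sum_(b <- addresses A k e | `[< exists2 z, box b z & edist x z <= E * rho >]) box_mass A k e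
      b `^ q)).
  by rewrite big_seq [leRHS]big_seq; apply: ler_sum.
rewrite -mulr_sumr -!mulrA ler_wpM2l ?powR_ge0 //.
rewrite (exchange_big_dep xpredT) //=.
apply: (@le_trans _ _ (nb%:R * \sum_(a <- addresses A k e) box_mass A k e a `^ q)).
  rewrite mulr_sumr big_seq [leRHS]big_seq; apply: ler_sum => b hb.
  rewrite big_const_seq iter_addr_0 -[leLHS]mulr_natl ler_wpM2r ?powR_ge0 // ler_nat.
  rewrite -size_filter.
  pose P (a : seq ('I_m * 'I_n) * seq 'I_m) := `[< exists x, [/\ x \in s, box a x & exists2 z,
    box b z & edist x z <= E * rho] >].
  apply: (@leq_trans (size [seq a <- addresses A k e | P a])); last first.
    apply: (size_neighbours B0 sc) => a a' ha ha' /asboolP[x [xs ax [z bz xz]]].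
    move=> /asboolP[y [ys ay [w bw yw]]]; exists x, y; split => //.
    apply: (le_trans (edist_triangle z _ _)).
    have := edist_triangle w z y; have := scale_box_dist sc hb bz bw; rewrite (edistC w y).
    move=> h1 h2; have h3 := lerD xz (le_trans h2 (lerD h1 yw)).
    apply: (le_trans h3); rewrite rd /B; nra.
  rewrite -(size_map (adr k e)); apply: uniq_leq_size.
    rewrite map_inj_in_uniq ?filter_uniq // => x y; rewrite !mem_filter.
    move=> /andP[_ xs] /andP[_ ys] exy; apply/eqP; apply/negPn/negP => nxy.
    have := sep x y xs ys nxy; apply/negP; rewrite -leNgt.
    have [ha ax] := adrP k e (sL x xs); have [_ ay] := adrP k e (sL y ys).
    rewrite -exy in ay; apply: (le_trans (scale_box_dist sc ha ax ay)); rewrite rd; nra.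
  move=> w /mapP[x]; rewrite mem_filter => /andP[/asboolP hx xs] ->.
  have [ha ax] := adrP k e (sL x xs).
  by rewrite mem_filter ha andbT; apply/asboolP; exists x.
rewrite ler_wpM2l ?ler0n // -expRD.
set S := \sum_(a <- _) _.
have S0 : 0 < S.
  rewrite /S (box_moment (R := R)) ?mulr_gt0 ?exprn_gt0 ?powR_gt0 ?invr_gt0 ?exprn_gt0 //.
  - exact: card_gt0R hL.
  - exact: card_gt0R hL.
  - exact: column_power_sum_gt0 hL q.
rewrite -[S]lnK ?posrE // ler_expR.
have := hc2 _ _ _ sc; rewrite -/S ler_norml => /andP[_].
have -> : ln d = ln rho - ln (2 * E) by rewrite /d ln_div ?posrE ?mulr_gt0.
lra.
Qed.

End MomentUpper.

(** * Lower bounds for moments *)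

Lemma pow_linear_growth m k : (m ^ k * (m + k) <= m * m.+1 ^ k)%N.
Proof.
elim: k => [|k IH]; first by rewrite !expn0 addn0 mul1n muln1.
rewrite !expnS; apply: (@leq_trans (m.+1 * (m ^ k * (m + k)))%N); last first.
  by rewrite [leqRHS]mulnCA leq_mul2l IH orbT.
by rewrite -mulnA [leqRHS]mulnCA [leqLHS]mulnCA leq_mul2l; nia.
Qed.

(** As [n >= m.+1], the ratio [(n / m) ^ k] grows at least linearly in [k], whereas
    [n ^ k <= n * m ^ (k + e)] bounds it by [n * m ^ e]. *)
Lemma scale_columns_ge (R : realType) (m n : nat) (J : nat) : (1 < m)%N -> (m < n)%N ->
  exists2 d0 : R, 0 < d0 & forall delta k e, delta <= d0 -> scale m n delta k e -> (J <= e)%N.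
Proof.
move=> m1 mn; pose K0 := (m * n * m ^ J)%N; exists (n ^ K0)%:R^-1.
  by rewrite invr_gt0 ltr0n expn_gt0; lia.
move=> delta k e hd sc; have d0 := scale_delta_gt0 m1 mn sc.
have kK : (K0 <= k)%N.
  apply: (scale_ge m1 mn sc); rewrite -ler_pdivlMr ?mul1r // ltr0n expn_gt0; lia.
rewrite leqNgt; apply/negP => eJ.
have [/andP[h1 _] /andP[_ h2]] := sc.
have h3 : (n ^ k < n * m ^ (k + e))%N.
  rewrite -(ltr_nat R) natrM -(ltr_pM2l d0) (lt_le_trans h2) //.
  by rewrite mulrCA ler_peMr.
have h4 : (n * m ^ (k + e) <= n * (m ^ k * m ^ J))%N.
  by rewrite -expnD leq_mul2l leq_pexp2l ?orbT //; lia.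
have h5 := pow_linear_growth m k.
have h6 : (m.+1 ^ k <= n ^ k)%N by case: (posnP k) => [->|k0] //; rewrite leq_exp2r.
have h7 : (m * n ^ k < m * (n * (m ^ k * m ^ J)))%N by rewrite ltn_mul2l (leq_trans h3 h4) andbT;
  lia.
have h8 : (m ^ k * (m + k) < m ^ k * K0)%N.
  apply: (leq_ltn_trans h5); apply: (@leq_ltn_trans (m * n ^ k)%N);
    first by rewrite leq_mul2l h6 orbT.
  by apply: (leq_trans h7); rewrite /K0; apply: eq_leq; ring.
have mk : (0 < m ^ k)%N by rewrite expn_gt0; lia.
rewrite ltn_pmul2l // in h8; lia.
Qed.

Section CentralPoints.
Context {R : realType} {m n : nat} {A : {set 'I_m * 'I_n}} {L : set (R * R)}
  {nu : probability (R * R)%type R}.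
Hypothesis hL : bm_carpet A L.
Hypothesis hnu : uniform_bernoulli A nu.
Context {b1 b2 : 'I_m * 'I_n}.
Hypothesis b1A : b1 \in A.
Hypothesis b2A : b2 \in A.
Hypothesis b12 : (b1.1 < b2.1)%N.
Implicit Types q : R.

Let m1 := carpet_m_gt1 hL.
Let mn := carpet_mn hL.
Let n1 := carpet_n_gt1 hL.

Lemma word_map_fst (w : seq ('I_m * 'I_n)) (y : R * R) :
  (word_map w y).1 * (m ^ size w)%:R = y.1 + (ordval (unzip1 w))%:R.
Proof. by rewrite /word_map /cell_map /= divfK // pnatr_eq0 -lt0n expn_gt0 (ltnW m1). Qed.

(** Two distinct columns [b1.1 < b2.1] in succession keep a point away from both
    vertical sides of its cell. *)
Lemma interior_abscissa (t : seq ('I_m * 'I_n)) (p : R * R) : L p -> all (mem A) t ->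
  1 <= (word_map [:: b1, b2 & t] p).1 * (m ^ 2)%:R <= (m ^ 2)%:R - 1.
Proof.
move=> Lp tA; have [m0 n0] := (carpet_m_gt0 hL, carpet_n_gt0 hL).
rewrite word_map_cons // word_map_cons // /bm_map /=.
have [/andP[]] : unit_square (word_map t p).
  by apply: (carpet_unit_square hL); apply: (carpet_word_map hL).
set y := (word_map t p).1 => y0 y1 _.
have mR : m%:R != 0 :> R by rewrite pnatr_eq0 -lt0n.
have -> : ((y + b2.1%:R) / m%:R + b1.1%:R) / m%:R * (m ^ 2)%:R = y + b2.1%:R + b1.1%:R * m%:R.
  by rewrite natrX; field.
have h1 : b1.1%:R + 1 <= b2.1%:R :> R by rewrite natr1 ler_nat.
have h2 : b2.1%:R + 1 <= m%:R :> R by rewrite natr1 ler_nat.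
have h3 := ler0n R b1.1; have h4 : 0 <= m%:R :> R by rewrite ler0n.
rewrite natrX; apply/andP; split; nra.
Qed.

Lemma column_size_le (i : 'I_m) : (column_size A i <= #|A|)%N.
Proof.
have inj : injective (pair i : 'I_n -> 'I_m * 'I_n) by move=> j j' [].
rewrite /column_size -(card_imset _ inj).
by apply/subset_leq_card/fintype.subsetP => _ /imsetP[j + ->]; rewrite inE.
Qed.

(** Forgetting [J] columns loses at most a bounded factor. *)
Lemma fibre_count_drop_le J (u : seq 'I_m) :
  (fibre_count A u <= #|A| ^ J * fibre_count A (drop J u))%N.
Proof.
rewrite -{1}(cat_take_drop J u) /fibre_count big_cat /= leq_mul2r; apply/orP; right.
apply: (@leq_trans (#|A| ^ size (take J u))%N); last first.
  by rewrite leq_pexp2l ?(carpet_card_gt0 hL) // size_take; case: ltnP => // /ltnW.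
elim: (take J u) => [|i v IH]; first by rewrite big_nil.
by rewrite big_cons /= expnS leq_mul ?column_size_le.
Qed.

Let ix (a : seq ('I_m * 'I_n) * seq 'I_m) : nat := ordval (unzip1 a.1 ++ a.2).

(** The letters [b1] and [b2], inserted after those that address the square, centre
    a point in its vertical strip. A ball of comparable radius around that point
    meets only squares of the same strip; these have the same further columns,
    hence the same mass. The constant [2 * n ^ 3] makes the radius less than
    [m ^ -2] times the width of the strip and less than half the height of a row. *)
Lemma central_point J rho k e a (p : R * R) (P := 2 * n%:R ^+ 3 : R) :
  L p -> 0 < rho -> scale m n (P * rho) k e -> 2 * P <= (m ^ J)%:R -> (J <= e)%N ->
  a \in addresses A k e ->
  exists V x, [/\ all (mem A) V, size V = (k + e + J.+2)%N & x = word_map V p] /\ [/\ L x, box a x,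
    (ix a)%:R + rho * (m ^ (k + e))%:R < x.1 * (m ^ (k + e))%:R < (ix a)%:R + 1 - rho * (m ^ (k +
      e))%:R,
    mass nu (eball x rho) <= (neighbour_bound (n := n) (1 : R))%:R * box_mass A k e a &
    box_mass A k e a <= (#|A| ^ (2 * J + 2))%:R * mass nu (eball x rho)].
Proof.
move=> Lp r0 sc hJ Je ha; have [m0 n0] := (carpet_m_gt0 hL, carpet_n_gt0 hL).
have n2 : 2 <= n%:R :> R by rewrite ler_nat.
have mnR : m%:R + 1 <= n%:R :> R by rewrite natr1 ler_nat.
have m2 : 2 <= m%:R :> R by rewrite ler_nat.
have n3 : 8 <= n%:R ^+ 3 :> R.
  have -> : 8 = 2 ^+ 3 :> R by rewrite -natrX.
  by rewrite lerXn2r ?nnegrE ?ler0n.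
have P0 : 0 < P by rewrite /P; lra.
case: a ha => w u ha; have := ha; rewrite mem_addresses /= => /and4P[/eqP sw wA /eqP su uA].
have [z zA zu] := column_word_lift uA.
have sz : size z = e by rewrite -(size_map fst) -/(unzip1 z) zu.
pose t := nseq J b1; have tA : all (mem A) t by apply/allP => b /nseqP[-> _].
pose sg := [:: b1, b2 & t].
have sgA : all (mem A) sg by rewrite /= tA b1A b2A.
have ssg : size sg = J.+2 by rewrite /= size_nseq.
pose x := word_map (w ++ (z ++ sg)) p.
have Lx : L x by apply: (carpet_word_map hL) => //; rewrite !all_cat wA zA sgA.
have up : unit_square p := carpet_unit_square hL Lp.
have ax : box (w, u) x.
  have := box_word_map m0 n0 w (z ++ sg) up; rewrite -/x /unzip1 map_cat -/(unzip1 z) zu.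
  exact: box_catr.
have [/andP[s1 s2] /andP[s3 s4]] := sc.
set Q := (m ^ (k + e))%:R in s1 s2 *.
have rQ : rho * Q * P < m%:R by rewrite mulrC mulrA.
have Q0 : 0 < Q by rewrite ltr0n expn_gt0 m0.
have strict : (ix (w, u))%:R + rho * Q < x.1 * Q < (ix (w, u))%:R + 1 - rho * Q.
  have hx : x.1 * Q = (word_map sg p).1 + (ix (w, u))%:R.
    have -> : Q = (m ^ size (w ++ z))%:R by rewrite size_cat sw sz.
    rewrite /x catA word_map_cat // word_map_fst /ix /= -zu.
    by rewrite /unzip1 map_cat.
  have := interior_abscissa Lp tA; rewrite -/sg.
  rewrite hx natrX; set y := (word_map sg p).1 => /andP[y1 y2].
  have rq0 : 0 < rho * Q by rewrite mulr_gt0.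
  have small : rho * Q * m%:R ^+ 2 < 1.
    rewrite -(ltr_pM2r (_ : 0 < m%:R :> R)) ?ltr0n // mul1r.
    apply: le_lt_trans rQ; rewrite -(mulrA (rho * Q)) ler_wpM2l ?(ltW rq0) // -exprSr /P.
    have : m%:R ^+ 3 <= n%:R ^+ 3 :> R by rewrite lerXn2r ?nnegrE ?ler0n //; lra.
    lra.
  have mm : 0 < m%:R ^+ 2 :> R by rewrite exprn_gt0 // ltr0n.
  have y1' : rho * Q < y by rewrite -(ltr_pM2r mm); apply: lt_le_trans y1.
  have y2' : y < 1 - rho * Q.
    rewrite -(ltr_pM2r mm) mulrBl; apply: (le_lt_trans y2); lra.
  by apply/andP; split; lra.
exists (w ++ (z ++ sg)), x; split.
  by split; rewrite ?all_cat ?wA ?zA ?sgA // !size_cat sw sz ssg addnA.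
split => //.
- have hr : 2 * rho <= 1 * (P * rho) by rewrite mul1r ler_pM2r // /P; lra.
  have [b [hb [y [b_y yr]] hm]] := mass_le_neighbours hL hnu r0 ler01 sc Lx hr.
  apply: (le_trans hm).
  suff e2 : b.2 = u by rewrite /box_mass e2.
  (* the ball stays in one strip, so all the digits of the abscissa agree *)
  have eix : ix b = ix (w, u).
    move: (hb); rewrite mem_addresses => /and4P[/eqP sb1 _ /eqP sb2 _].
    move: b_y => [/andP[c1 c2] _]; rewrite sb1 sb2 -/Q -/(ix b) in c1 c2.
    have dy : `|x.1 - y.1| <= rho by apply: le_trans yr; apply: edist_ge1.
    have dyQ : `|x.1 - y.1| * Q <= rho * Q by rewrite ler_pM2r.
    move: dyQ; rewrite -[Q in X in X <= _](gtr0_norm Q0) -normrM mulrBl ler_norml.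
    move=> /andP[d1 d2]; move: strict => /andP[e1 e2].
    have l1 : (ix b < (ix (w, u)).+1)%N.
      by rewrite -(ltr_nat R) -[(ix (w, u)).+1%:R]natr1; lra.
    have l2 : (ix (w, u) < (ix b).+1)%N.
      by rewrite -(ltr_nat R) -[(ix b).+1%:R]natr1; lra.
    by apply/eqP; rewrite eqn_leq; apply/andP; split; rewrite -ltnS.
  move: (hb); rewrite mem_addresses => /and4P[/eqP sb1 _ /eqP sb2 _].
  have ss : size (unzip1 b.1 ++ b.2) = size (unzip1 w ++ u).
    by rewrite !size_cat !size_map sb1 sb2 sw su.
  have /eqP := ordval_inj ss eix.
  by rewrite eqseq_cat ?size_map ?sb1 ?sw // => /andP[_ /eqP].
(* a square [J] levels further down, small enough for the ball to contain it *)
- pose a' := (w ++ take J z, drop J u ++ unzip1 sg).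
  have ha' : a' \in addresses A (k + J) (e + 2).
    rewrite mem_addresses /= !size_cat !all_cat size_takel ?sz // sw eqxx wA /=.
    rewrite size_drop su /= size_map size_nseq.
    have -> : (e - J + J.+2)%N = (e + 2)%N by rewrite -addn2 addnA subnK.
    rewrite eqxx /=; apply/and3P; split.
    + by move: zA; rewrite -{1}(cat_take_drop J z) all_cat => /andP[].
    + by move: uA; rewrite -{1}(cat_take_drop J u) all_cat => /andP[].
    + exact: (unzip1_cols sgA).
  have ax' : box a' x.
    have := box_word_map m0 n0 (w ++ take J z) (drop J z ++ sg) up.
    rewrite -catA [take J z ++ _]catA cat_take_drop -/x /unzip1 map_cat map_drop.
    by rewrite -/(unzip1 z) zu.
  have mJ0 : 0 < (m ^ J)%:R :> R by rewrite ltr0n expn_gt0 m0.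
  have side1 : (m ^ (k + J + (e + 2)))%:R^-1 <= rho / 2.
    rewrite -[rho / 2]invrK lef_pV2 ?posrE ?invr_gt0 ?divr_gt0 ?ltr0n ?expn_gt0 ?m0 //.
    rewrite invf_div; apply: (@le_trans _ _ (Q * (m ^ J)%:R)).
      rewrite ler_pdivrMr //.
      have : 2 * P * (rho * Q) <= (m ^ J)%:R * (rho * Q) by rewrite ler_wpM2r // mulr_ge0 ?(ltW
        r0) ?(ltW Q0).
      lra.
    by rewrite -natrM ler_nat -expnD leq_pexp2l // addnACA leq_add2l leq_addr.
  have side2 : (n ^ (k + J))%:R^-1 <= rho / 2.
    rewrite -[rho / 2]invrK lef_pV2 ?posrE ?invr_gt0 ?divr_gt0 ?ltr0n ?expn_gt0 ?n0 //.
    rewrite invf_div ler_pdivrMr // expnD natrM.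
    have nJ : (m ^ J)%:R <= (n ^ J)%:R :> R.
      by rewrite ler_nat; case: (posnP J) => [->|J0] //; rewrite leq_exp2r // ltnW.
    have nk0 : 0 < (n ^ k)%:R :> R by rewrite ltr0n expn_gt0 n0.
    have : 2 * P * (rho * (n ^ k)%:R) <= (n ^ J)%:R * (rho * (n ^ k)%:R).
      rewrite ler_wpM2r ?mulr_ge0 ?(ltW r0) ?(ltW nk0) //; exact: le_trans nJ.
    lra.
  have lo := mass_eball_ge_box hL hnu ha' ax' (_ : _ <= rho).
  apply: (@le_trans _ _ ((#|A| ^ (2 * J + 2))%:R * (#|A|%:R ^- (k + J + (e + 2)) * (fibre_count A
    a'.2)%:R))).
    have N0 : 0 < #|A|%:R :> R := card_gt0R hL.
    have -> : #|A|%:R ^- (k + J + (e + 2)) = #|A|%:R ^- (k + e) * #|A|%:R ^- (J + 2) :> R.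
      by rewrite -invfM -exprD; congr (_ ^- _); exact: addnACA.
    rewrite /box_mass /= [leRHS]mulrCA -mulrA ler_wpM2l ?invr_ge0 ?exprn_ge0 ?ler0n //.
    rewrite ler_pdivlMl ?exprn_gt0 // -natrX -!natrM ler_nat.
    rewrite fibre_count_cat.
    have h1 := fibre_count_drop_le J u.
    have h2 : (0 < fibre_count A (unzip1 sg))%N by apply: fibre_count_gt0; apply: (unzip1_cols sgA).
    have -> : (2 * J + 2 = J + 2 + J)%N by rewrite mul2n -addnn addnAC.
    rewrite (expnD _ (J + 2) J) -mulnA leq_mul2l; apply/orP; right.
    apply: (leq_trans h1); rewrite leq_mul2l; apply/orP; right; exact: leq_pmulr.
  rewrite ler_wpM2l ?ler0n //; apply: lo; lra.
Qed.

End CentralPoints.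

Section MomentLower.
Context {R : realType} {m n : nat} {A : {set 'I_m * 'I_n}} {L : set (R * R)}
  {nu : probability (R * R)%type R}.
Hypothesis hL : bm_carpet A L.
Hypothesis hnu : uniform_bernoulli A nu.
Context {b1 b2 : 'I_m * 'I_n}.
Hypothesis b1A : b1 \in A.
Hypothesis b2A : b2 \in A.
Hypothesis b12 : (b1.1 < b2.1)%N.
Implicit Types q : R.

Let m1 := carpet_m_gt1 hL.
Let mn := carpet_mn hL.
Let n1 := carpet_n_gt1 hL.

Lemma edist_lt_balls (x y : R * R) (r : R) :
  (exists z, eball x r z /\ eball y r z) -> edist x y <= 2 * r.
Proof.
move=> [z [xz yz]]; apply: (le_trans (edist_triangle z _ _)).
by rewrite (edistC z y); move: xz yz; rewrite /eball /=; lra.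
Qed.

Let ix (a : seq ('I_m * 'I_n) * seq 'I_m) : nat := ordval (unzip1 a.1 ++ a.2).
Let iy (a : seq ('I_m * 'I_n) * seq 'I_m) : nat := ordval (unzip2 a.1).

Let central k e (rho : R) a (x : R * R) : Prop :=
  (ix a)%:R + rho * (m ^ (k + e))%:R < x.1 * (m ^ (k + e))%:R
    < (ix a)%:R + 1 - rho * (m ^ (k + e))%:R.

Let central_index k e rho a x y (hx : central k e rho a x) : eball x rho y ->
  (ix a)%:R < y.1 * (m ^ (k + e))%:R < (ix a)%:R + 1.
Proof.
move: hx; rewrite /central; set Q := (m ^ (k + e))%:R => /andP[a1 a2] xy.
have Q0 : 0 < Q by rewrite ltr0n expn_gt0 (ltnW m1).
have := le_trans (edist_ge1 x y) xy; rewrite -(ler_pM2r Q0).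
rewrite -[Q in X in X <= _](gtr0_norm Q0) -normrM mulrBl ler_norml => /andP[h1 h2].
by apply/andP; split; lra.
Qed.

(** Balls around central points of squares in different strips are disjoint, and
    in one strip rows of equal parity have a whole row between them. *)
Let central_disjoint k e rho a b (xa xb y : R * R) :
  a \in addresses A k e -> b \in addresses A k e -> a != b -> odd (iy a) = odd (iy b) ->
  2 * (rho * (n ^ k)%:R) < 1 -> box a xa -> box b xb ->
  central k e rho a xa -> central k e rho b xb ->
  eball xa rho y -> eball xb rho y -> False.
Proof.
move=> aA bA ab par small boxa boxb ca cb ya yb.
have /andP[a1 a2] := central_index ca ya; have /andP[c1 c2] := central_index cb yb.
have eix : ix a = ix b.
  apply/eqP; rewrite eqn_leq; apply/andP; split; rewrite -ltnS -(ltr_nat R).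
  - by rewrite -[(ix b).+1%:R]natr1; lra.
  - by rewrite -[(ix a).+1%:R]natr1; lra.
have neq : iy a != iy b.
  apply: contra ab => /eqP eiy; apply/eqP; apply: (box_index_inj aA bA).
  by congr pair.
move: boxa boxb => [_ ha] [_ hb].
move: aA bA ha hb; rewrite !mem_addresses => /and4P[/eqP sa _ _ _] /and4P[/eqP sb _ _ _].
rewrite sa sb; rewrite -/(iy a) -/(iy b).
have Q0 : 0 < (n ^ k)%:R :> R by rewrite ltr0n expn_gt0 (ltnW n1).
have hd : `|xa.2 - xb.2| <= 2 * rho.
  apply: (le_trans (edist_ge2 xa xb)); apply: edist_lt_balls; by exists y.
have : `|xa.2 - xb.2| * (n ^ k)%:R <= 2 * rho * (n ^ k)%:R by rewrite ler_pM2r.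
rewrite -[(n ^ k)%:R in X in X <= _ -> _](gtr0_norm Q0) -normrM mulrBl ler_norml => /andP[d1 d2].
move=> /andP[p1 p2] /andP[p3 p4].
have [lt|lt|//] := ltngtP (iy a) (iy b); last by move=> e'; rewrite e' eqxx in neq.
- have h : ((iy a).+2 <= iy b)%N.
    rewrite ltn_neqAle lt andbT; apply/eqP => e'; move: par; rewrite -e' /=; by case: odd.
  have : (iy a)%:R + 2 <= (iy b)%:R :> R by rewrite -natrD ler_nat addn2.
  by move: p1 p2 p3 p4 d1 d2 small; lra.
- have h : ((iy b).+2 <= iy a)%N.
    rewrite ltn_neqAle lt andbT; apply/eqP => e'; move: par; rewrite -e' /=; by case: odd.
  have : (iy b)%:R + 2 <= (iy a)%:R :> R by rewrite -natrD ler_nat addn2.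
  by move: p1 p2 p3 p4 d1 d2 small; lra.
Qed.

(** The central points of the squares whose rows have the same parity carry
    disjoint balls, and one of the two parities has at least half of the moment. *)
Lemma moment_lower_scale J rho k e q (E : R) (P := 2 * n%:R ^+ 3 : R) :
  0 < rho -> scale m n (P * rho) k e -> 2 * P <= (m ^ J)%:R -> (J <= e)%N ->
  1 <= E -> (neighbour_bound (n := n) (1 : R))%:R <= E -> (#|A| ^ (2 * J + 2))%:R <= E ->
  (((2 * E `^ `|q|)^-1 * \sum_(a <- addresses A k e) box_mass A k e a `^ q)%:E
    <= Lq_moment nu q rho)%E.
Proof.
move=> r0 sc hJ Je E1 hE1 hE2.
have E0 : 0 < E by apply: lt_le_trans E1.
pose good a (x : R * R) := [/\ L x, box a x, central k e rho a x,
    mass nu (eball x rho) <= E * box_mass A k e a & box_mass A k e a <= E * mass nu (eball x rho)].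
pose pt a := xget (0, 0) [set x | good a x].
have ptP a : a \in addresses A k e -> good a (pt a).
  move=> aA; have bm0 := box_mass_gt0 (R := R) hL aA.
  have [p Lp] := carpet_ex hL.
  have [V [x [_ [Lx ax cx h1 h2]]]] := central_point hL hnu b1A b2A b12 Lp r0 sc hJ Je aA.
  have gx : good a x.
    split => //; first by apply: (le_trans h1); rewrite ler_wpM2r // ltW.
    by apply: (le_trans h2); rewrite ler_wpM2r // mass_ge0.
  by rewrite /pt; case: xgetP => [y -> //|/(_ x)].
have small : 2 * (rho * (n ^ k)%:R) < 1.
  have [_ /andP[_ s4]] := sc.
  have Q0' : 0 < (n ^ k)%:R :> R by rewrite ltr0n expn_gt0 (ltnW n1).
  have n2 : 2 <= n%:R :> R by rewrite ler_nat.
  have rQ : rho * (n ^ k)%:R * P < n%:R by rewrite mulrC mulrA.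
  have n0R : 0 < n%:R :> R by lra.
  rewrite -(ltr_pM2r n0R) mul1r; apply: le_lt_trans rQ; rewrite /P.
  have := mulr_gt0 r0 Q0'; set u := rho * _ => u0.
  have : n%:R <= n%:R ^+ 3 :> R by rewrite -[X in X <= _]expr1 ler_eXn2l //; lra.
  move=> h; have := ler_wpM2l (ltW u0) h; lra.
have half (par : bool) : ((\sum_(a <- addresses A k e | odd (iy a) == par)
     (E `^ `|q|)^-1 * box_mass A k e a `^ q)%:E <= Lq_moment nu q rho)%E.
  pose S := [seq a <- addresses A k e | odd (iy a) == par].
  have SA a : a \in S -> a \in addresses A k e by rewrite mem_filter => /andP[].
  have Sp a : a \in S -> odd (iy a) = par by rewrite mem_filter => /andP[/eqP].
  have uS : uniq S by rewrite filter_uniq // addresses_uniq.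
  have pack : ball_packing nu rho (map pt S).
    split; first by move=> _ /mapP[a /SA /ptP[La _ _ _ _] ->]; rewrite (msupport_carpet hL hnu).
    apply/trivIsetP => i j; rewrite size_map => /= iS jS ij.
    apply/seteqP; split => // y; case: S uS SA Sp iS jS => // a0 S' uS SA Sp iS jS [].
    rewrite !(nth_map a0) //; set a := nth _ _ i; set b := nth _ _ j => ya yb.
    have hab : a != b by rewrite nth_uniq.
    have aS : a \in a0 :: S' by rewrite mem_nth.
    have bS : b \in a0 :: S' by rewrite mem_nth.
    have [_ boxa ca _ _] := ptP a (SA _ aS); have [_ boxb cb _ _] := ptP b (SA _ bS).
    apply: (central_disjoint (SA _ aS) (SA _ bS) hab _ small boxa boxb ca cb ya yb).
    by rewrite (Sp _ aS) (Sp _ bS).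
  apply: (@le_trans _ _ (\sum_(x <- map pt S) poweR (nu (eball x rho)) q)%E); last first.
    by apply: ereal_sup_ubound; exists (map pt S).
  rewrite big_map -sumEFin -[X in (X <= _)%E]big_filter -/S big_seq [leRHS]big_seq.
  apply: lee_sum => a /SA aA; have [La _ _ h1 h2] := ptP a aA.
  have bm0 := box_mass_gt0 (R := R) hL aA.
  have m0 := mass_eball_gt0 hL hnu La r0.
  rewrite massE ?poweR_EFin ?lee_fin; last exact: measurable_eball.
  rewrite ler_pdivrMl ?powR_gt0 //; exact: powR_le_sym.
rewrite invfM -mulrA mulr_sumr (bigID (fun a => odd (iy a) == true)) /=.
rewrite [X in (2^-1 * (_ + X))%:E](eq_bigl (fun a => odd (iy a) == false)); last first.
  by move=> a; case: odd.
set x1 := \sum_(a <- _ | _) _; set x2 := \sum_(a <- _ | _) _.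
have [h|h] := leP x1 x2.
- apply: le_trans (half false); rewrite lee_fin -/x2; lra.
- apply: le_trans (half true); rewrite lee_fin -/x1; lra.
Qed.

Lemma moment_lower q : exists2 c : R, 0 < c & exists2 rho0 : R, 0 < rho0 &
  forall rho, 0 < rho <= rho0 ->
    ((c * expR (- (ln rho * Lq_exponent A q)))%:E <= Lq_moment nu q rho)%E.
Proof.
pose P : R := 2 * n%:R ^+ 3.
have n2 : 2 <= n%:R :> R by rewrite ler_nat.
have n3 : 0 < n%:R ^+ 3 :> R by rewrite exprn_gt0 //; lra.
have P0 : 0 < P by rewrite /P; lra.
pose J := Num.bound (2 * P).
have hJ : 2 * P <= (m ^ J)%:R.
  apply: (@le_trans _ _ J%:R); last by rewrite ler_nat ltnW // ltn_expl.
  by apply/ltW/archi_boundP; lra.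
have [d0 d00 hd0] := @scale_columns_ge R m n J m1 mn.
pose E : R := Num.max (Num.max 1 (neighbour_bound (n := n) (1 : R))%:R) (#|A| ^ (2 * J + 2))%:R.
have E1 : 1 <= E by rewrite /E !le_max lexx.
have E0 : 0 < E by apply: lt_le_trans E1.
have [c2 hc2] := ln_box_moment hL q.
exists ((2 * E `^ `|q|)^-1 * expR (- c2 - ln P * Lq_exponent A q)).
  by rewrite mulr_gt0 ?expR_gt0 // invr_gt0 mulr_gt0 // powR_gt0.
exists (Num.min 1 d0 / P); first by rewrite divr_gt0 // lt_min ltr01.
move=> rho /andP[r0]; rewrite ler_pdivlMr // le_min mulrC => /andP[r1 rd].
have Pr : 0 < P * rho <= 1 by rewrite mulr_gt0.
have [k [e sc]] := ex_scale m1 mn Pr.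
apply: le_trans (moment_lower_scale q r0 sc hJ (hd0 _ _ _ rd sc) E1 _ _); last 2 first.
- by rewrite /E !le_max lexx orbT.
- by rewrite /E !le_max lexx !orbT.
rewrite lee_fin -mulrA ler_wpM2l ?invr_ge0 ?mulr_ge0 ?powR_ge0 // -expRD.
set S := \sum_(a <- _) _.
have S0 : 0 < S.
  rewrite /S (box_moment (R := R)) ?mulr_gt0 ?exprn_gt0 ?powR_gt0 ?invr_gt0 ?exprn_gt0 //.
  - exact: card_gt0R hL.
  - exact: card_gt0R hL.
  - exact: column_power_sum_gt0 hL q.
rewrite -[S]lnK ?posrE // ler_expR.
have := hc2 _ _ _ sc; rewrite -/S ler_norml => /andP[+ _].
rewrite lnM ?posrE //; lra.
Qed.

End MomentLower.

(** * The L^q spectrum *)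

(** Otherwise the midpoint belongs to both balls. *)
Lemma balls_disjoint_dist (R : realType) (x y : R * R) (r : R) :
  eball x r `&` eball y r = set0 -> 2 * r < edist x y.
Proof.
move=> dis; rewrite ltNge; apply/negP => h.
pose z : R * R := ((x.1 + y.1) / 2, (x.2 + y.2) / 2).
have hz (u : R * R) : (u.1 - z.1) ^+ 2 + (u.2 - z.2) ^+ 2 =
    2^-1 ^+ 2 * ((x.1 - y.1) ^+ 2 + (x.2 - y.2) ^+ 2) -> eball u r z.
  move=> e; rewrite /eball /= /edist e sqrtrM ?sqr_ge0 // sqrtr_sqr ger0_norm ?invr_ge0 //.
  by rewrite ler_pdivrMl.
have : (eball x r `&` eball y r) z by split; apply: hz; rewrite /z /=; field.
by rewrite dis.
Qed.

Section MomentUpperBilip.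
Context {R : realType}.
Context {m n : nat} {A : {set 'I_m * 'I_n}} {L : set (R * R)}.
Context {m' n' : nat} {A' : {set 'I_m' * 'I_n'}} {L' : set (R * R)}.
Context {nu nu' : probability (R * R)%type R}.
Hypothesis hL : bm_carpet A L.
Hypothesis hL' : bm_carpet A' L'.
Hypothesis hnu : uniform_bernoulli A nu.
Hypothesis hnu' : uniform_bernoulli A' nu'.
Context {C : R} {f : R * R -> R * R}.
Hypothesis C1 : 1 <= C.
Hypothesis hf : bilip_onto C f L L'.

(** A packing of [L] is mapped to a separated set of [L'], so its moments are
    bounded by those of the squares of [L']. The identity map gives the bound of a
    carpet by itself. *)
Lemma moment_upper_bilip q : exists2 c : R, 0 < c & forall rho, 0 < rho <= 1 ->
  (Lq_moment nu q rho <= (c * expR (- (ln rho * Lq_exponent A' q)))%:E)%E.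
Proof.
have C0 : 0 < C by exact: lt_le_trans C1.
have [K K1 [D D1 cmp]] := mass_eball_equivalence hL hL' hnu hnu' C1 hf.
have [g [_ gf _]] := bilip_inverse C1 hf.
have [K0 D0] : 0 < K /\ 0 < D by split; [exact: lt_le_trans K1|exact: lt_le_trans D1].
have KD1 : 1 <= K * D by rewrite -[X in X <= _]mulr1 ler_pM.
have DC1 : 1 <= D * C by rewrite -[X in X <= _]mulr1 ler_pM.
pose E := K * D * C; have E1 : 1 <= E by rewrite -[X in X <= _]mulr1 ler_pM.
have E0 : 0 < E by apply: lt_le_trans E1.
have KE : K <= E by rewrite /E -mulrA ler_peMr // ltW.
have DCE : D * C <= E by rewrite /E -mulrA ler_peMl // mulr_ge0 // ltW.
have [c c0 hc] := moment_upper hL' hnu' q E1.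
exists (c * expR (ln C * Lq_exponent A' q)); first by rewrite mulr_gt0 ?expR_gt0.
move=> rho /andP[r0 r1]; apply: ge_ereal_sup => _ [s [sL dis] <-].
have {}sL x : x \in s -> L x by move=> /sL; rewrite (msupport_carpet hL hnu).
have sep i j : (i < size s)%N -> (j < size s)%N -> i != j ->
    2 * rho < edist (nth (0, 0) s i) (nth (0, 0) s j).
  by move=> hi hj /eqP ij; apply: balls_disjoint_dist; move/trivIsetP: dis; apply => //; apply/eqP.
have us : uniq s.
  apply/(uniqP (0, 0)) => i j; rewrite !inE => hi hj e; apply/eqP/negPn/negP => ij.
  have := sep i j hi hj ij; rewrite e edistxx; lra.
have {}sep : {in s &, forall x y, x != y -> 2 * rho < edist x y}.
  move=> x y xs ys xy; rewrite -(nth_index (0, 0) xs) -(nth_index (0, 0) ys).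
  apply: sep; rewrite ?index_mem //; apply: contra xy => /eqP e.
  by rewrite -(nth_index (0, 0) xs) e nth_index.
pose M y := mass nu (eball (g y) rho).
have -> : (\sum_(x <- s) poweR (nu (eball x rho)) q)%E = (\sum_(y <- map f s) M y `^ q)%:E.
  rewrite big_map -sumEFin big_seq [RHS]big_seq; apply: eq_bigr => x xs.
  by rewrite /M (gf _ (sL _ xs)) massE ?poweR_EFin //; exact: measurable_eball.
rewrite lee_fin.
have rC : 0 < rho / C <= 1.
  by rewrite divr_gt0 //= ler_pdivrMr // mul1r (le_trans r1).
apply: (le_trans (hc (rho / C) (map f s) M rC _ _ _ _)).
- rewrite map_inj_in_uniq // => x y /sL Lx /sL Ly; exact: bilip_inj C1 hf _ _ Lx Ly.
- by move=> _ /mapP[x /sL Lx ->]; apply: bilip_mem hf _ Lx.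
- move=> _ _ /mapP[x xs ->] /mapP[y ys ->] nxy.
  have xy : x != y by apply: contra nxy => /eqP ->.
  rewrite ltr_pdivrMr // mulrC; apply: (@lt_le_trans _ _ (edist x y)).
    apply: (le_lt_trans _ (sep x y xs ys xy)); lra.
  exact: bilip_ge C1 hf _ _ (sL _ xs) (sL _ ys).
- move=> _ /mapP[x /sL Lx ->]; rewrite /M gf //; split;
    first exact: mass_eball_gt0 hL hnu _ _ Lx r0.
  have mono y r1' r2 : r1' <= r2 -> mass nu' (eball y r1') <= mass nu' (eball y r2).
    move=> h; apply: mass_mono; [exact: measurable_eball|exact: measurable_eball|].
    exact: eball_mono.
  split.
  + have rD : 0 < rho / D by rewrite divr_gt0.
    have [h _] := cmp x (rho / D) Lx rD.
    rewrite [D * _]mulrC divfK ?gt_eqF // in h.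
    apply: (le_trans (mono _ _ (rho / D) _)).
      rewrite -mulrA -invfM ler_wpM2l ?(ltW r0) // lef_pV2 ?posrE ?mulr_gt0 //.
      apply: (@le_trans _ _ (D * C)); first by rewrite ler_peMr // ltW.
      by apply: (le_trans DCE); rewrite ler_peMl // ltW.
    apply: (le_trans h); rewrite ler_wpM2r ?mass_ge0 //.
  + have [_ h] := cmp x rho Lx r0; apply: (le_trans h).
    apply: ler_pM; rewrite ?mass_ge0 ?(ltW K0) //.
    apply: mono; rewrite mulrA ler_pdivlMr // mulrAC ler_wpM2r ?(ltW r0) //.
have -> : ln (rho / C) = ln rho - ln C by rewrite ln_div ?posrE.
rewrite -mulrA -expRD ler_wpM2l ?(ltW c0) // ler_expR; lra.
Qed.

End MomentUpperBilip.

Section Limit.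
Context {R : realType}.

(** Bounded factors vanish when logarithms are divided by [ln r]. *)
Lemma log_rate_limit (F : R -> \bar R) (c1 c2 T : R) : 0 < c1 -> 0 < c2 ->
  (\forall r \near 0^'+, ((c1 * expR (- (ln r * T)))%:E <= F r <= (c2 * expR (- (ln r *
    T)))%:E)%E) ->
  (lne (F r) * ((- ln r)^-1)%:E)%E @[r --> 0^'+] --> T%:E.
Proof.
move=> c10 c20 hF.
pose G r := T - ln (fine (F r) / expR (- (ln r * T))) / ln r.
have eqG : \forall r \near 0^'+, (lne (F r) * ((- ln r)^-1)%:E)%E = (G r)%:E.
  near=> r.
  have /andP[r0 r1] : 0 < r < 1 by near: r; apply: near_right_lt.
  have /andP[h1 h2] : ((c1 * expR (- (ln r * T)))%:E <= F r <= (c2 * expR (- (ln r * T)))%:E)%E.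
    by near: r.
  have lr : ln r < 0 by rewrite ln_lt0 // r0.
  have fF : F r \is a fin_num.
    by rewrite fin_numElt (lt_le_trans _ h1) ?ltNyr // (le_lt_trans h2) ?ltry.
  have F0 : 0 < fine (F r).
    rewrite -lte_fin fineK //; apply: lt_le_trans h1; rewrite lte_fin mulr_gt0 ?expR_gt0 //.
  rewrite -[F r in LHS]fineK //= leNgt F0 /= -EFinM /G; congr EFin.
  rewrite ln_div ?posrE ?expR_gt0 // expRK; field; by rewrite lt_eqF.
have limG : G r @[r --> 0^'+] --> T.
  have l c : T - ln c / ln r @[r --> 0^'+] --> T.
    rewrite -[X in _ --> X]subr0; apply: cvgB; [exact: cvg_cst|exact: cvg_div_ln].
  apply: (squeeze_cvgr _ (l c1) (l c2)); near=> r.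
  have /andP[r0 r1] : 0 < r < 1 by near: r; apply: near_right_lt.
  have /andP[h1 h2] : ((c1 * expR (- (ln r * T)))%:E <= F r <= (c2 * expR (- (ln r * T)))%:E)%E.
    by near: r.
  have lr : ln r < 0 by rewrite ln_lt0 // r0.
  have fF : F r \is a fin_num.
    by rewrite fin_numElt (lt_le_trans _ h1) ?ltNyr // (le_lt_trans h2) ?ltry.
  move: h1 h2; rewrite -[F r]fineK // !lee_fin => h1 h2.
  have e0 := expR_gt0 (- (ln r * T)).
  have q1 : c1 <= fine (F r) / expR (- (ln r * T)) by rewrite ler_pdivlMr.
  have q2 : fine (F r) / expR (- (ln r * T)) <= c2 by rewrite ler_pdivrMr.
  rewrite /G /= !lerD2l !lerN2 !ler_nM2r ?invr_lt0 //.
  rewrite !ler_ln ?posrE ?q1 ?q2 //; exact: lt_le_trans q1.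
have limE : (G r)%:E @[r --> 0^'+] --> T%:E.
  by apply: cvg_EFin => //; near=> r.
apply: cvg_trans limE; apply: near_eq_cvg.
by apply: filterS eqG => r ->.
Unshelve. all: by end_near. Qed.

(** A strict inequality in the wrong direction would make the quotient of the two
    powers unbounded. *)
Lemma exponent_le (c1 c2 T1 T2 : R) : 0 < c1 -> 0 < c2 ->
  (\forall r \near 0^'+, c1 * expR (- (ln r * T1)) <= c2 * expR (- (ln r * T2))) -> T1 <= T2.
Proof.
move=> c10 c20 h; rewrite -subr_le0 leNgt; apply/negP => T0.
have l : ln (c2 / c1) / ln r @[r --> (0 : R)^'+] --> (0 : R) by exact: cvg_div_ln.
have T0' : - (T1 - T2) < 0 by rewrite oppr_lt0.
have l' : \forall r \near (0 : R)^'+, - (T1 - T2) < ln (c2 / c1) / ln r by exact: cvgr_gt l _ T0'.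
suff : \forall r \near (0 : R)^'+, False.
  by move=> [e /= e0 /(_ (e / 2))]; apply; rewrite /= ?divr_gt0 // sub0r normrN gtr0_norm
    ?divr_gt0 //; lra.
near=> r.
have /andP[r0 r1] : 0 < r < 1 by near: r; apply: near_right_lt.
have lr : ln r < 0 by rewrite ln_lt0 // r0.
have h1 : c1 * expR (- (ln r * T1)) <= c2 * expR (- (ln r * T2)) by near: r.
have : - (T1 - T2) < ln (c2 / c1) / ln r by near: r.
rewrite ltr_ndivlMr // => h2.
move: h1; rewrite -ler_ln ?posrE ?mulr_gt0 ?expR_gt0 // !lnM ?posrE ?expR_gt0 // !expRK.
move: h2; rewrite ln_div ?posrE //; lra.
Unshelve. all: by end_near. Qed.

End Limit.

Section Spectrum.
Context {R : realType}.
Context {m n : nat} {A : {set 'I_m * 'I_n}} {L : set (R * R)} {nu : probability (R * R)%type R}.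
Hypothesis hL : bm_carpet A L.
Hypothesis hnu : uniform_bernoulli A nu.
Context {b1 b2 : 'I_m * 'I_n}.
Hypothesis b1A : b1 \in A.
Hypothesis b2A : b2 \in A.
Hypothesis b12 : (b1.1 < b2.1)%N.

Lemma bilip_id (X : set (R * R)) : bilip_onto 1 id X X.
Proof. by split; rewrite ?image_id // => x y _ _; rewrite invr1 !mul1r lexx. Qed.

Lemma Lq_spectrum_exponent : is_Lq_spectrum nu (Lq_exponent A).
Proof.
move=> q; have [c1 c10 [r0 r00 lo]] := moment_lower hL hnu b1A b2A b12 q.
have [c2 c20 up] := moment_upper_bilip hL hL hnu hnu (lexx 1) (bilip_id L) q.
apply: (log_rate_limit c10 c20).
have e0 : 0 < Num.min 1 r0 by rewrite lt_min ltr01.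
apply: filterS (near_right_lt e0) => r /andP[rp]; rewrite lt_min => /andP[r1 rr0].
by rewrite lo ?up // rp ltW.
Qed.

Lemma Lq_exponent_le {m' n' : nat} {A' : {set 'I_m' * 'I_n'}} {L' : set (R * R)}
    {nu' : probability (R * R)%type R} {C : R} {f : R * R -> R * R} (q : R) :
  bm_carpet A' L' -> uniform_bernoulli A' nu' -> 1 <= C -> bilip_onto C f L L' ->
  Lq_exponent A q <= Lq_exponent A' q.
Proof.
move=> hL' hnu' C1 hf; have [c1 c10 [r0 r00 lo]] := moment_lower hL hnu b1A b2A b12 q.
have [c2 c20 up] := moment_upper_bilip hL hL' hnu hnu' C1 hf q.
apply: (exponent_le c10 c20).
have e0 : 0 < Num.min 1 r0 by rewrite lt_min ltr01.
apply: filterS (near_right_lt e0) => r /andP[rp]; rewrite lt_min => /andP[r1 rr0].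
by rewrite -lee_fin (le_trans (lo r _)) ?up // rp ltW.
Qed.

End Spectrum.

(** * The exponents of the extreme approximate squares *)

Lemma nonuniform_extremes (m n : nat) (A : {set 'I_m * 'I_n}) : nonuniform_fibres A ->
  exists i j, [/\ i \in cols A, j \in cols A, (column_size A i < column_size A j)%N &
    forall c, c \in cols A -> (column_size A i <= column_size A c <= column_size A j)%N].
Proof.
rewrite /nonuniform_fibres /num_sizes /column_sizes size_sort -/(cols A) => h.
have ext (le : rel nat) : total le -> transitive le -> reflexive le ->
    exists2 i, i \in cols A & forall c, c \in cols A -> le (column_size A i) (column_size A c).
  move=> tot tr rf; case: (cols A) h => // i s _.
  elim: s i => [|j s IH] i; first by exists i; rewrite ?mem_head // => c; rewrite inE => /eqP ->.
  have [k kS hk] := IH j; have [hik|hki] := orP (tot (column_size A i) (column_size A k)).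
  - exists i; first by rewrite mem_head.
    by move=> c; rewrite inE => /orP[/eqP ->//|/hk]; apply: tr.
  - exists k; first by rewrite inE kS orbT.
    by move=> c; rewrite inE => /orP[/eqP ->//|/hk].
have [i iA hi] := ext leq leq_total leq_trans leqnn.
have [j jA hj] := ext geq (fun x y => leq_total y x) (fun y x z h1 h2 => leq_trans h2 h1) leqnn.
exists i, j; split => //; last by move=> c cA; apply/andP; split; [exact: hi|exact: hj].
rewrite ltn_neqAle hi // andbT; apply/negP => /eqP e.
have : (size (undup [seq column_size A i | i <- cols A]) <= size [:: column_size A i])%N.
  apply: uniq_leq_size; first exact: undup_uniq.
  move=> v; rewrite mem_undup => /mapP[c cA ->]; rewrite inE eqn_leq hi // andbT e; exact: hj.
by rewrite leqNgt h.
Qed.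

Lemma nonuniform_columns (p r : nat) (B : {set 'I_p * 'I_r}) : nonuniform_fibres B ->
  exists b1 b2, [/\ b1 \in B, b2 \in B & (b1.1 < b2.1)%N].
Proof.
move=> /nonuniform_extremes[i [j [iB jB ij _]]].
move: iB jB; rewrite !mem_cols => /column_size_gt0P[a ia] /column_size_gt0P[b jb].
have := ltngtP i j; case=> [lt|gt|/ord_inj e].
- by exists (i, a), (j, b).
- by exists (j, b), (i, a).
- by rewrite e ltnn in ij.
Qed.

Section Extremes.
Context {R : realType} {m n : nat} {A : {set 'I_m * 'I_n}} {L : set (R * R)}.
Hypothesis hL : bm_carpet A L.

(** When [q] favours the columns of size [v], the power sum lies between one and
    [num_columns A] copies of [v ^ q], so the exponent is affine in [q] up to a
    bounded error. *)
Lemma Lq_exponent_asymptote (v : nat) (i : 'I_m) : i \in cols A -> column_size A i = v ->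
  exists c : R, forall q : R,
    (forall j, j \in cols A -> (column_size A j)%:R `^ q <= v%:R `^ q) ->
    `|Lq_exponent A q + q * box_exponent A v| <= c.
Proof.
move=> iA iv; set N := ln #|A|%:R : R; set V := ln v%:R : R.
have v0 : 0 < v%:R :> R by rewrite ltr0n -iv -mem_cols.
pose M : R := (num_columns A)%:R; have M0 : 0 < M by rewrite ltr0n (num_columns_gt0 hL).
have lnm0 : 0 < ln m%:R :> R by rewrite ln_gt0 // ltr1n (carpet_m_gt1 hL).
have lnn0 : 0 < ln n%:R :> R by rewrite ln_gt0 // ltr1n (carpet_n_gt1 hL).
exists (`|N / ln n%:R| + ln M * `|(ln m%:R)^-1 - (ln n%:R)^-1|) => q hq.
pose s := ln (column_power_sum A q) - q * V.
have P0 := column_power_sum_gt0 hL q.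
have lo : v%:R `^ q <= column_power_sum A q.
  by rewrite /column_power_sum (big_rem i) //= iv lerDl sumr_ge0.
have up : column_power_sum A q <= M * v%:R `^ q.
  rewrite /column_power_sum big_seq; apply: (@le_trans _ _ (\sum_(j <- cols A) v%:R `^ q)).
    by rewrite [leRHS]big_seq; apply: ler_sum => j /hq.
  by rewrite big_const_seq count_predT iter_addr_0 size_cols -[leLHS]mulr_natl.
have s0 : 0 <= s.
  by rewrite /s subr_ge0 -(ln_powR v%:R q) ler_ln ?posrE ?powR_gt0.
have sM : s <= ln M.
  by rewrite /s lerBlDr -(ln_powR v%:R q) -lnM ?posrE ?powR_gt0 // ler_ln ?posrE ?mulr_gt0
    ?powR_gt0.
have -> : Lq_exponent A q + q * box_exponent A v =
    N / ln n%:R + s * ((ln m%:R)^-1 - (ln n%:R)^-1).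
  rewrite /Lq_exponent /box_exponent -/N -/V /s; ring.
apply: (le_trans (ler_normD _ _)); by rewrite lerD // normrM ler_wpM2r // ger0_norm.
Qed.

End Extremes.

Lemma slope_eq (R : realType) (a b c : R) : (forall q, 0 <= q -> `|q * (a - b)| <= c) -> a = b.
Proof.
move=> h; apply/eqP; rewrite -subr_eq0 -normr_le0; apply: (@le0_of_natmul_bounded _ _ c) => k.
by have := h k%:R (ler0n _ _); rewrite normrM normr_nat mulrC.
Qed.

(** The two exponents are the slopes of the common function at [-oo] and [+oo]. *)
Lemma extreme_exponents_eq (R : realType) (m n : nat) (A : {set 'I_m * 'I_n}) (L : set (R * R))
    (m' n' : nat) (A' : {set 'I_m' * 'I_n'}) (L' : set (R * R)) i j i' j' :
  bm_carpet A L -> bm_carpet A' L' -> (forall q : R, Lq_exponent A q = Lq_exponent A' q) ->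
  i \in cols A -> j \in cols A -> i' \in cols A' -> j' \in cols A' ->
  (forall c, c \in cols A -> (column_size A i <= column_size A c <= column_size A j)%N) ->
  (forall c, c \in cols A' -> (column_size A' i' <= column_size A' c <= column_size A' j')%N) ->
  box_exponent A (column_size A i) = box_exponent A' (column_size A' i') :> R /\
  box_exponent A (column_size A j) = box_exponent A' (column_size A' j') :> R.
Proof.
move=> hL hL' T iA jA iA' jA' h h'.
have pos (p r : nat) (B : {set 'I_p * 'I_r}) c : c \in cols B -> 0 < (column_size B c)%:R :> R.
  by rewrite mem_cols ltr0n.
have pow (x y q : R) : 0 < x -> x <= y -> 0 <= q -> x `^ q <= y `^ q.
  by move=> x0 xy q0; apply: ge0_ler_powR; rewrite ?nnegrE ?(ltW x0) ?(ltW (lt_le_trans x0 xy)).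
have powN (x y q : R) : 0 < x -> x <= y -> 0 <= q -> y `^ (- q) <= x `^ (- q).
  move=> x0 xy q0; rewrite !powRN lef_pV2 ?posrE ?powR_gt0 ?pow //; exact: lt_le_trans xy.
have [c1 h1] := Lq_exponent_asymptote hL iA erefl; have [c2 h2] :=
  Lq_exponent_asymptote hL' iA' erefl.
have [d1 g1] := Lq_exponent_asymptote hL jA erefl; have [d2 g2] :=
  Lq_exponent_asymptote hL' jA' erefl.
split.
- apply: (@slope_eq _ _ _ (c1 + c2)) => q q0.
  have e1 := h1 (- q) _; have e2 := h2 (- q) _.
  have -> : q * (box_exponent A (column_size A i) - box_exponent A' (column_size A' i')) =
     (Lq_exponent A' (- q) + (- q) * box_exponent A' (column_size A' i')) -
     (Lq_exponent A (- q) + (- q) * box_exponent A (column_size A i)) by rewrite T; ring.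
  apply: (le_trans (ler_normB _ _)); rewrite addrC lerD //.
  + apply: e1 => c cA; apply: powN; rewrite ?pos // ler_nat; by have /andP[] := h c cA.
  + apply: e2 => c cA; apply: powN; rewrite ?pos // ler_nat; by have /andP[] := h' c cA.
- apply: (@slope_eq _ _ _ (d1 + d2)) => q q0.
  have e1 := g1 q _; have e2 := g2 q _.
  have -> : q * (box_exponent A (column_size A j) - box_exponent A' (column_size A' j')) =
     (Lq_exponent A q + q * box_exponent A (column_size A j)) -
     (Lq_exponent A' q + q * box_exponent A' (column_size A' j')) by rewrite T; ring.
  apply: (le_trans (ler_normB _ _)); rewrite lerD //.
  + apply: e1 => c cA; apply: pow; rewrite ?pos // ler_nat; by have /andP[] := h c cA.
  + apply: e2 => c cA; apply: pow; rewrite ?pos // ler_nat; by have /andP[] := h' c cA.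
Qed.


(** * Prescribing digits at two scales *)

Lemma fibre_count_nseq (m n : nat) (A : {set 'I_m * 'I_n}) e i :
  fibre_count A (nseq e i) = (column_size A i ^ e)%N.
Proof. by rewrite /fibre_count; elim: e => [|e IH]; rewrite ?big_nil //= big_cons IH expnS. Qed.

Lemma fibre_count_le (m n : nat) (A : {set 'I_m * 'I_n}) v u :
  (forall i, i \in cols A -> (column_size A i <= v)%N) -> all (mem (cols A)) u ->
  (fibre_count A u <= v ^ size u)%N.
Proof.
move=> h; elim: u => [|i u IH] /=; first by rewrite /fibre_count big_nil.
by move=> /andP[iA uA]; rewrite /fibre_count big_cons expnS leq_mul ?h //; apply: IH.
Qed.

Lemma fibre_count_ge (m n : nat) (A : {set 'I_m * 'I_n}) v u :
  (forall i, i \in cols A -> (v <= column_size A i)%N) -> all (mem (cols A)) u ->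
  (v ^ size u <= fibre_count A u)%N.
Proof.
move=> h; elim: u => [|i u IH] /=; first by rewrite /fibre_count big_nil.
by move=> /andP[iA uA]; rewrite /fibre_count big_cons expnS leq_mul ?h //; apply: IH.
Qed.

(** The digits between [a] and [c] lie both in a range that is nearly as rich as
    possible and in one that is nearly as poor as possible. Each of them costs
    [ln vmax - ln vmin] in one of the two estimates. *)
Lemma overlap_bound (R : realType) (m n : nat) (A : {set 'I_m * 'I_n}) (u : seq 'I_m)
    (vmin vmax a b c : nat) (c1 c2 : R) :
  (0 < vmin < vmax)%N -> (forall i, i \in cols A -> (vmin <= column_size A i <= vmax)%N) ->
  all (mem (cols A)) u -> (b <= a)%N -> (a <= c)%N -> (c <= size u)%N ->
  (size u - a)%:R * ln vmax%:R - c1 <= ln (fibre_count A (drop a u))%:R :> R ->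
  ln (fibre_count A (take (c - b) (drop b u)))%:R <= (c - b)%:R * ln vmin%:R + c2 ->
  (c - a)%:R * (ln vmax%:R - ln vmin%:R) <= c1 + c2.
Proof.
move=> /andP[v0 vv] h uA ba ac cu h1 h2.
pose o := take (c - a) (drop a u).
have posF w : all (mem (cols A)) w -> 0 < (fibre_count A w)%:R :> R.
  by move=> wA; rewrite ltr0n fibre_count_gt0.
have subA w j l : all (mem (cols A)) w -> all (mem (cols A)) (take j (drop l w)).
  by move=> /allP wA; apply/allP => x /mem_take /mem_drop /wA.
have dropA j w : all (mem (cols A)) w -> all (mem (cols A)) (drop j w).
  by move=> /allP wA; apply/allP => x /mem_drop /wA.
have takeA j w : all (mem (cols A)) w -> all (mem (cols A)) (take j w).
  by move=> /allP wA; apply/allP => x /mem_take /wA.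
have vx : 0 < vmax%:R :> R by rewrite ltr0n (ltn_trans v0).
have vn : 0 < vmin%:R :> R by rewrite ltr0n.
have e1 : ln (fibre_count A (drop a u))%:R <= ln (fibre_count A o)%:R + (size u - c)%:R * ln
  vmax%:R :> R.
  rewrite -(cat_take_drop (c - a) (drop a u)) -/o fibre_count_cat natrM.
  rewrite lnM ?posrE ?posF ?subA ?dropA // lerD2l.
  have -> : (size u - c)%:R * ln vmax%:R = ln (vmax ^ (size u - c))%:R :> R.
    by rewrite natrX lnXn // mulr_natl.
  rewrite ler_ln ?posrE ?posF ?dropA // ?ltr0n ?expn_gt0 ?(ltn_trans v0) // ler_nat.
  rewrite drop_drop subnK // -(size_drop c u); apply: fibre_count_le; last exact: dropA.
  by move=> i /h /andP[].
have e2 : ln (fibre_count A o)%:R + (a - b)%:R * ln vmin%:R <= ln (fibre_count A (take (c - b)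
  (drop b u)))%:R :> R.
  have -> : take (c - b) (drop b u) = take (a - b) (drop b u) ++ o.
    have da : drop a u = drop (a - b) (drop b u) by rewrite drop_drop subnK.
    have cb : (c - b = (a - b) + (c - a))%N by lia.
    by rewrite /o da cb takeD.
  rewrite fibre_count_cat natrM lnM ?posrE ?posF ?subA // addrC lerD2r.
  have -> : (a - b)%:R * ln vmin%:R = ln (vmin ^ (a - b))%:R :> R.
    by rewrite natrX lnXn // mulr_natl.
  rewrite ler_ln ?posrE ?posF ?subA // ?ltr0n ?expn_gt0 ?v0 // ler_nat.
  have sz : size (take (a - b) (drop b u)) = (a - b)%N by rewrite size_takel // size_drop; lia.
  rewrite -[X in (_ ^ X <= _)%N]sz.
  by apply: fibre_count_ge; [move=> i /h /andP[]|exact: subA].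
have -> : (c - a)%:R = (size u - a)%:R - (size u - c)%:R :> R.
  by rewrite -natrB; [congr _%:R; lia|lia].
have q2 : (c - b)%:R = (c - a)%:R + (a - b)%:R :> R by rewrite -natrD; congr _%:R; lia.
have q3 : (c - a)%:R = (size u - a)%:R - (size u - c)%:R :> R.
  by rewrite -natrB; [congr _%:R; lia|lia].
rewrite q2 q3 in h2; nra.
Qed.

Section Source.
Context {R : realType} {m n : nat} {A : {set 'I_m * 'I_n}} {L : set (R * R)}
  {nu : probability (R * R)%type R}.
Hypothesis hL : bm_carpet A L.
Hypothesis hnu : uniform_bernoulli A nu.
Context {b1 b2 : 'I_m * 'I_n}.
Hypothesis b1A : b1 \in A.
Hypothesis b2A : b2 \in A.
Hypothesis b12 : (b1.1 < b2.1)%N.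

Let m0 := carpet_m_gt0 hL.
Let n0 := carpet_n_gt0 hL.

(** The masses at the two scales depend on the abscissa digits in the positions
    from [k1] to [k1 + e1] and from [k2] to [k2 + e2]. When the second range starts
    after the first ends, both can be prescribed, here as constant words. *)
Lemma two_scale_point J rho k1 e1 k2 e2 (delta2 : R) i j (P := 2 * n%:R ^+ 3 : R) :
  0 < rho -> scale m n (P * rho) k1 e1 -> 2 * P <= (m ^ J)%:R -> (J <= e1)%N ->
  scale m n delta2 k2 e2 -> (k1 + e1 + J.+2 <= k2)%N -> i \in cols A -> j \in cols A ->
  exists x, [/\ L x,
    mass nu (eball x rho) <= (neighbour_bound (n := n) (1 : R))%:R *
      (#|A|%:R ^- (k1 + e1) * (column_size A i ^ e1)%:R) &
    #|A|%:R ^- (k2 + e2) * (column_size A j ^ e2)%:R <= mass nu (eball x (2 * delta2))].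
Proof.
move=> r0 sc1 hJ Je sc2 hk iA jA.
have nseqA l c : c \in cols A -> all (mem (cols A)) (nseq l c).
  by move=> cA; apply/allP => x /nseqP[->].
have lift1 l c : c \in cols A -> exists2 z, all (mem A) z & size z = l /\ unzip1 z = nseq l c.
  move=> cA; have [z zA zu] := column_word_lift (nseqA l c cA); exists z => //; split => //.
  by rewrite -(size_map fst) -/(unzip1 z) zu size_nseq.
have [w wA [sw _]] := lift1 k1 i iA.
have ha1 : (w, nseq e1 i) \in addresses A k1 e1.
  by rewrite mem_addresses /= sw wA size_nseq !eqxx nseqA.
have [r rA [sr _]] := lift1 (k2 - (k1 + e1 + J.+2))%N i iA.
have [s sA [ss su]] := lift1 e2 j jA.
have [p0 Lp0] := carpet_ex hL.
have Lp : L (word_map (r ++ s) p0) by apply: (carpet_word_map hL) => //; rewrite all_cat rA sA.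
have [V [x [[VA sV xV] [Lx _ _ up _]]]] := central_point hL hnu b1A b2A b12 Lp r0 sc1 hJ Je ha1.
exists x; split => //; first by apply: (le_trans up); rewrite /box_mass /= fibre_count_nseq.
have ha2 : (V ++ r, nseq e2 j) \in addresses A k2 e2.
  by rewrite mem_addresses /= size_cat all_cat VA rA sV sr subnKC // size_nseq !eqxx nseqA.
have ax : box (V ++ r, nseq e2 j) x.
  have := box_word_map m0 n0 (V ++ r) s (carpet_unit_square hL Lp0).
  by rewrite su -catA word_map_cat // -xV.
have [m1 mn] := (carpet_m_gt1 hL, carpet_mn hL).
have := mass_eball_ge_box hL hnu ha2 ax (r := 2 * delta2).
rewrite /= fibre_count_nseq; apply.
by have := scale_side1 m1 sc2; have := scale_side2 m1 mn sc2; lra.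
Qed.

(** Conversely, if the smaller of two nested balls is heavy, some square [b] near its
    centre is heavy; any point of [b] has a neighbourhood inside the larger ball, so
    its digits at the larger scale cannot be rich if that ball is light. Both
    constraints thus concern one word, the columns of that point. *)
Lemma two_scale_digits (y : R * R) (D rho delta2 mu1 mu2 : R) k1 e1 k2 e2 :
  L y -> 1 <= D -> 0 < rho -> scale m n (rho / 4) k1 e1 -> scale m n delta2 k2 e2 ->
  8 * D * delta2 <= rho ->
  mu2 <= mass nu (eball y (2 * D * delta2)) -> mass nu (eball y rho) <= mu1 ->
  exists u, [/\ all (mem (cols A)) u, size u = (k2 + e2)%N,
    mu2 <= (neighbour_bound (n := n) (4 * D))%:R *
       (#|A|%:R ^- (k2 + e2) * (fibre_count A (drop k2 u))%:R) &
    (k1 <= k2)%N /\ (k1 + e1 <= k2 + e2)%N /\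
    #|A|%:R ^- (k1 + e1) * (fibre_count A (take e1 (drop k1 u)))%:R <= mu1].
Proof.
move=> Ly D1 r0 sc1 sc2 hr h2 h1.
have [m1 mn] := (carpet_m_gt1 hL, carpet_mn hL).
have D0 : 0 < D by apply: lt_le_trans D1.
have d0 := scale_delta_gt0 m1 mn sc2.
have rb : 2 * (2 * D * delta2) <= 4 * D * delta2 by lra.
have R0 : 0 < 2 * D * delta2 by rewrite !mulr_gt0.
have B0 : 0 <= 4 * D by rewrite mulr_ge0 // ltW.
have [b [hb [z0 [bz0 zy]] hm]] := mass_le_neighbours hL hnu R0 B0 sc2 Ly rb.
move: (hb); rewrite mem_addresses => /and4P[/eqP sb1 b1A' /eqP sb2 /column_word_lift[zz zzA zu]].
have [p Lp] := carpet_ex hL.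
pose W := b.1 ++ zz; pose z := word_map W p.
have WA : all (mem A) W by rewrite all_cat b1A' zzA.
have Lz : L z by apply: (carpet_word_map hL).
have szz : size zz = e2 by rewrite -(size_map fst) -/(unzip1 zz) zu.
have sW : size W = (k2 + e2)%N by rewrite size_cat sb1 szz.
have up := carpet_unit_square hL Lp.
have bz : box b z.
  by rewrite [b]surjective_pairing -zu; apply: box_word_map.
have dyz : edist y z <= 2 * D * delta2 + 2 * delta2.
  apply: (le_trans (edist_triangle z0 _ _)); apply: lerD => //.
  exact: (scale_box_dist hL sc2 hb bz0 bz).
have d2rho : delta2 <= rho / 4 by nra.
have mono l1 l2 q : (1 < q)%N -> 1 <= delta2 * (q ^ l2)%:R -> rho / 4 * (q ^ l1)%:R < q%:R ->
  (l1 <= l2)%N.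
  move=> q1 g1 g2; rewrite -ltnS -(ltn_exp2l _ _ q1) -(ltr_nat R) expnS natrM.
  have q0 : 0 < q%:R :> R by rewrite ltr0n ltnW.
  have r4 : 0 < rho / 4 by rewrite divr_gt0.
  rewrite -(ltr_pM2l r4); apply: (lt_le_trans g2); rewrite mulrCA ler_peMr ?(ltW q0) //.
  by apply: (le_trans g1); rewrite ler_wpM2r ?ler0n.
have [/andP[s1 s2] /andP[s3 s4]] := sc1; have [/andP[t1 t2] /andP[t3 t4]] := sc2.
have kk : (k1 <= k2)%N by apply: mono t3 s4; exact: carpet_n_gt1 hL.
have ll : (k1 + e1 <= k2 + e2)%N by apply: mono t1 s2.
exists (unzip1 W); split.
- exact: unzip1_cols WA.
- by rewrite size_map.
- have -> : drop k2 (unzip1 W) = b.2.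
    by rewrite /unzip1 map_cat drop_size_cat ?size_map // -/(unzip1 zz).
  exact: le_trans hm.
- split => //; split => //; apply: le_trans h1.
  pose a := (take k1 W, take e1 (unzip1 (drop k1 W))).
  have -> : take e1 (drop k1 (unzip1 W)) = a.2 by rewrite /a /= /unzip1 map_drop.
  have aA : a \in addresses A k1 e1.
    rewrite mem_addresses /= size_takel ?sW ?(leq_trans kk) ?leq_addr //.
    rewrite size_takel ?size_map ?size_drop ?sW ?leq_subRL ?(leq_trans kk) ?leq_addr // !eqxx /=.
    apply/andP; split; first by apply/allP => x /mem_take; apply/allP.
    apply/allP => x /mem_take; apply/allP; apply: unzip1_cols.
    by apply/allP => t /mem_drop; apply/allP.
  have az : box a z.
    have : box (take k1 W, unzip1 (drop k1 W)) z.
      by rewrite /z -[X in word_map X](cat_take_drop k1); apply: box_word_map.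
    by rewrite -[unzip1 _](cat_take_drop e1); apply: box_catr.
  have := mass_eball_ge_box hL hnu aA az (r := rho / 2); rewrite -/m => h.
  apply: (le_trans (h _)).
    by have := scale_side1 m1 sc1; have := scale_side2 m1 mn sc1; lra.
  apply: mass_mono; [exact: measurable_eball|exact: measurable_eball|].
  apply: subset_trans (eball_triangle dyz) _; apply: eball_mono; nra.
Qed.

End Source.

(** * Bi-Lipschitz equivalent carpets have the same ratio of logarithms *)

Section BoundedOverlap.
Context {R : realType}.
Context {m n : nat} {A : {set 'I_m * 'I_n}} {L : set (R * R)}.
Context {m' n' : nat} {A' : {set 'I_m' * 'I_n'}} {L' : set (R * R)}.
Context {nu nu' : probability (R * R)%type R}.
Hypothesis hL : bm_carpet A L.
Hypothesis hL' : bm_carpet A' L'.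
Hypothesis hnu : uniform_bernoulli A nu.
Hypothesis hnu' : uniform_bernoulli A' nu'.
Context {C : R} {f : R * R -> R * R}.
Hypothesis C1 : 1 <= C.
Hypothesis hf : bilip_onto C f L L'.
Context {b1 b2 : 'I_m * 'I_n}.
Hypothesis b1A : b1 \in A.
Hypothesis b2A : b2 \in A.
Hypothesis b12 : (b1.1 < b2.1)%N.
Context {i j : 'I_m} {i' j' : 'I_m'}.
Hypothesis iA : i \in cols A.
Hypothesis jA : j \in cols A.
Hypothesis iA' : i' \in cols A'.
Hypothesis jA' : j' \in cols A'.
Hypothesis ij' : (column_size A' i' < column_size A' j')%N.
Hypothesis ext' : forall c, c \in cols A' ->
  (column_size A' i' <= column_size A' c <= column_size A' j')%N.
Hypothesis expi : box_exponent A (column_size A i) = box_exponent A' (column_size A' i') :> R.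
Hypothesis expj : box_exponent A (column_size A j) = box_exponent A' (column_size A' j') :> R.

Let P : R := 2 * n%:R ^+ 3.

Let P0 : 0 < P.
Proof. by rewrite /P mulr_gt0 // exprn_gt0 // ltr0n (carpet_n_gt0 hL). Qed.

Let ln_mass (p r : nat) (B : {set 'I_p * 'I_r}) (K : R) l (v : nat) :
  (0 < #|B|)%N -> 0 < K -> (0 < v)%N ->
  ln (K * (#|B|%:R ^- l * v%:R)) = ln K + ln v%:R - l%:R * ln #|B|%:R.
Proof.
move=> N0 K0 v0; rewrite !lnM ?posrE ?mulr_gt0 ?invr_gt0 ?exprn_gt0 ?ltr0n //.
rewrite lnV ?posrE ?exprn_gt0 ?ltr0n // lnXn ?ltr0n // -mulr_natl; ring.
Qed.

Let lnX (v e : nat) : (0 < v)%N -> ln (v ^ e)%:R = e%:R * ln v%:R :> R.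
Proof. by move=> v0; rewrite natrX lnXn ?ltr0n // mulr_natl. Qed.

(** Take a point of [L] which at scale [rho] sees poorest columns and at the next
    admissible scale, about [n ^ - (k1 + e1)], richest ones. Its image has extreme
    masses at the same two scales, because the extreme exponents of the two carpets
    agree. By [overlap_bound] the two ranges of digits that these scales involve in
    [L'] overlap in boundedly many positions. *)
Lemma bounded_overlap : exists (D : R) (J : nat) (c rho0 : R), [/\ 1 <= D, 0 < rho0 &
  forall rho, 0 < rho <= rho0 -> exists k1 e1 k2 e2 k3 e3,
    [/\ scale m n (P * rho) k1 e1, scale m' n' ((n ^ (k1 + e1 + J))%:R^-1 : R) k2 e2,
        scale m' n' (rho / D / 4) k3 e3 & (k3 + e3)%:R - k2%:R <= c]].
Proof.
have [K K1 [D D1 cmp]] := mass_eball_equivalence hL hL' hnu hnu' C1 hf.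
have [K0 D0] : 0 < K /\ 0 < D by split; [exact: lt_le_trans K1|exact: lt_le_trans D1].
have [m1 mn] := (carpet_m_gt1 hL, carpet_mn hL); have [m1' mn'] :=
  (carpet_m_gt1 hL', carpet_mn hL').
have n0 := carpet_n_gt0 hL; have m0 := carpet_m_gt0 hL.
have big (x : R) : 0 <= x -> exists J, x <= (m ^ J)%:R.
  move=> x0; exists (Num.bound x); apply: (@le_trans _ _ (Num.bound x)%:R).
    exact/ltW/archi_boundP.
  by rewrite ler_nat ltnW // ltn_expl.
have [J hJ] : exists J, 2 * P <= (m ^ J)%:R by apply: big; have := P0; lra.
have [J0 hJ0] : exists J, 8 * D ^+ 2 * P <= (m ^ J)%:R.
  by apply: big; rewrite !mulr_ge0 ?exprn_ge0 ?(ltW P0) ?(ltW D0).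
have [d0 d00 hd0] := @scale_columns_ge R m n J m1 mn.
have N0 := carpet_card_gt0 hL; have N0' := carpet_card_gt0 hL'.
have [vi vj] : (0 < column_size A i)%N /\ (0 < column_size A j)%N by rewrite -!mem_cols.
have [vi' vj'] : (0 < column_size A' i')%N /\ (0 < column_size A' j')%N by rewrite -!mem_cols.
have [ci hci] := ln_box_extreme hL (column_size A i).
have [cj hcj] := ln_box_extreme hL (column_size A j).
have [ci' hci'] := ln_box_extreme hL' (column_size A' i').
have [cj' hcj'] := ln_box_extreme hL' (column_size A' j').
pose nb : R := (neighbour_bound (n := n) (1 : R))%:R.
pose nb' : R := (neighbour_bound (n := n') (4 * D))%:R.
have nb0 : 0 < nb by rewrite ltr0n /neighbour_bound.
have nb0' : 0 < nb' by rewrite ltr0n /neighbour_bound.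
pose c1 := ln K + ln nb' + cj + cj'.
pose c2 := ln K + ln nb + ci + ci' + (ln P + ln D + ln 4) * box_exponent A (column_size A i).
pose eta : R := ln (column_size A' j')%:R - ln (column_size A' i')%:R.
have eta0 : 0 < eta by rewrite subr_gt0 ltr_ln ?posrE ?ltr0n // ltr_nat.
exists D, (J.+2 + J0)%N, (Num.max 0 ((c1 + c2) / eta)), (Num.min 1 d0 / P).
split => //; first by rewrite divr_gt0 // lt_min ltr01.
move=> rho /andP[r0]; rewrite ler_pdivlMr // le_min mulrC => /andP[r1 rd].
have Pr : 0 < P * rho <= 1 by rewrite mulr_gt0.
have [k1 [e1 sc1]] := ex_scale m1 mn Pr.
pose d2 : R := (n ^ (k1 + e1 + (J.+2 + J0)))%:R^-1.
have nK0 : 0 < (n ^ (k1 + e1 + (J.+2 + J0)))%:R :> R by rewrite ltr0n expn_gt0 n0.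
have d2_01 : 0 < d2 <= 1 by rewrite invr_gt0 nK0 /= invf_le1 // ler1n expn_gt0 n0.
have [k2 [e2 sc2]] := ex_scale m1 mn d2_01.
have [k2' [e2' sc2']] := ex_scale m1' mn' d2_01.
have P1 : 1 <= P.
  have : 1 <= n%:R ^+ 3 :> R by rewrite exprn_ege1 // ler1n.
  by rewrite /P; lra.
have rD : 0 < rho / D / 4 <= 1.
  rewrite !divr_gt0 //= !ler_pdivrMr // mul1r.
  have : rho <= P * rho by rewrite ler_peMl // ltW.
  by have : 0 < 4 :> R by []; nra.
have [k3 [e3 sc3]] := ex_scale m1' mn' rD.
exists k1, e1, k2', e2', k3, e3; split => //.
have k12 : (k1 + e1 + J.+2 <= k2)%N.
  apply: leq_trans (_ : (k1 + e1 + (J.+2 + J0) <= k2)%N); first by rewrite leq_add2l leq_addr.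
  by apply: (scale_ge m1 mn sc2); rewrite mulVf // gt_eqF.
have Je : (J <= e1)%N := hd0 _ _ _ rd sc1.
have [x [Lx x1 x2]] := two_scale_point hL hnu b1A b2A b12 r0 sc1 hJ Je sc2 k12 iA jA.
have d2r : 8 * D * d2 <= rho / D.
  rewrite ler_pdivlMr // mulrAC -ler_pdivlMr ?invr_gt0 // invrK.
  have [/andP[s1 _] _] := sc1.
  have h1 : (m ^ (k1 + e1))%:R * (m ^ J0)%:R <= (n ^ (k1 + e1 + (J.+2 + J0)))%:R :> R.
    rewrite -natrM -expnD ler_nat.
    apply: (@leq_trans (n ^ (k1 + e1 + J0))); first by case: (posnP (k1 + e1 + J0)) => [->|p] //;
      rewrite leq_exp2r // ltnW.
    by rewrite leq_pexp2l // leq_add2l leq_addl.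
  have h2 : rho * ((m ^ (k1 + e1))%:R * (m ^ J0)%:R) <= rho * (n ^ (k1 + e1 + (J.+2 + J0)))%:R.
    by rewrite ler_pM2l.
  apply: le_trans h2; set q := (m ^ (k1 + e1))%:R in s1 *.
  have q0 : 0 < rho * q by rewrite mulr_gt0 // ltr0n expn_gt0 m0.
  have h3 : 8 * D ^+ 2 * P * (rho * q) <= (m ^ J0)%:R * (rho * q) by rewrite ler_wpM2r // ltW.
  have h4 : 8 * D ^+ 2 * 1 <= 8 * D ^+ 2 * (P * rho * q) by rewrite ler_wpM2l // mulr_ge0 //
    exprn_ge0 // ltW.
  rewrite [rho * (q * _)]mulrA [leRHS]mulrC; apply: le_trans h3.
  have -> : 8 * D * D = 8 * D ^+ 2 * 1 by ring.
  by apply: (le_trans h4); rewrite !mulrA.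
have rD0 : 0 < rho / D by rewrite divr_gt0.
have mu1 : mass nu' (eball (f x) (rho / D)) <= K * nb * (#|A|%:R ^- (k1 + e1) * (column_size A i
  ^ e1)%:R).
  have [h _] := cmp x (rho / D) Lx rD0; apply: (le_trans h).
  by rewrite [D * _]mulrC divfK ?gt_eqF // -mulrA ler_wpM2l // ltW.
have mu2 : K^-1 * (#|A|%:R ^- (k2 + e2) * (column_size A j ^ e2)%:R) <= mass nu' (eball (f x) (2
  * D * d2)).
  have d20 : 0 < 2 * d2 by rewrite mulr_gt0 // (andP d2_01).1.
  have [_ h] := cmp x (2 * d2) Lx d20; rewrite ler_pdivrMl //.
  apply: (le_trans x2); apply: (le_trans h); by rewrite mulrCA mulrA.
have [u [uA su d1 [k32 [l32 d3]]]] :=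
  two_scale_digits hL' hnu' (bilip_mem hf Lx) D1 rD0 sc3 sc2' d2r mu2 mu1.
rewrite le_max; have [lt|ge] := ltnP (k3 + e3) k2'.
  by apply/orP; left; rewrite subr_le0 ler_nat ltnW.
apply/orP; right; rewrite -natrB // ler_pdivlMr //.
have fpos w : all (mem (cols A')) w -> (0 < fibre_count A' w)%N by exact: fibre_count_gt0.
have dA : all (mem (cols A')) (drop k2' u) by apply/allP => t /mem_drop; apply/allP.
have tA : all (mem (cols A')) (take e3 (drop k3 u)).
  by apply/allP => t /mem_take /mem_drop; apply/allP.
have Kn : 0 < K * nb by rewrite mulr_gt0.
have vve (v e : nat) : (0 < v)%N -> (0 < v ^ e)%N by rewrite expn_gt0 => ->.
have g1 : ln (K^-1 * (#|A|%:R ^- (k2 + e2) * (column_size A j ^ e2)%:R)) <=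
    ln (nb' * (#|A'|%:R ^- (k2' + e2') * (fibre_count A' (drop k2' u))%:R)).
  by rewrite ler_ln ?posrE ?mulr_gt0 ?invr_gt0 ?exprn_gt0 ?ltr0n ?vve ?fpos.
have g2 : ln (1 * (#|A'|%:R ^- (k3 + e3) * (fibre_count A' (take e3 (drop k3 u)))%:R)) <=
    ln (K * nb * (#|A|%:R ^- (k1 + e1) * (column_size A i ^ e1)%:R)).
  by rewrite ler_ln ?posrE ?mulr_gt0 ?invr_gt0 ?exprn_gt0 ?ltr0n ?vve ?fpos // mul1r.
move: g1 g2; rewrite !ln_mass ?invr_gt0 ?vve ?fpos // !lnX // ln1 lnV ?posrE // lnM ?posrE //.
have := hci _ _ _ sc1; have := hcj _ _ _ sc2; have := hci' _ _ _ sc3; have := hcj' _ _ _ sc2'.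
rewrite -expi -expj !ler_norml.
have -> : ln (rho / D / 4) = ln rho - ln D - ln 4 by rewrite !ln_div ?posrE.
have -> : ln (P * rho) = ln P + ln rho by rewrite lnM ?posrE.
move=> /andP[a1 a2] /andP[a3 a4] /andP[a5 a6] /andP[a7 a8] g1 g2.
apply: (@overlap_bound R m' n' A' u (column_size A' i') (column_size A' j') k2' k3 (k3 + e3) c1
  c2) => //.
- by rewrite vi' ij'.
- by rewrite su.
- by rewrite su addKn /c1; lra.
- by rewrite addKn /c2; lra.
Qed.

End BoundedOverlap.

Section LogRatio.
Context {R : realType}.
Context {m n : nat} {A : {set 'I_m * 'I_n}} {L : set (R * R)}.
Context {m' n' : nat} {A' : {set 'I_m' * 'I_n'}} {L' : set (R * R)}.
Context {nu nu' : probability (R * R)%type R}.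
Hypothesis hL : bm_carpet A L.
Hypothesis hL' : bm_carpet A' L'.
Hypothesis hnu : uniform_bernoulli A nu.
Hypothesis hnu' : uniform_bernoulli A' nu'.
Context {C : R} {f : R * R -> R * R}.
Hypothesis C1 : 1 <= C.
Hypothesis hf : bilip_onto C f L L'.
Hypothesis hA : nonuniform_fibres A.
Hypothesis hA' : nonuniform_fibres A'.
Hypothesis hT : forall q : R, Lq_exponent A q = Lq_exponent A' q.

(** The first range ends near [ln rho^-1 / ln m'] and the second one starts near
    [ln n / ln m * ln rho^-1 / ln n']. As [rho] tends to 0, a strict inequality
    in the other direction would make the overlap of [bounded_overlap] unbounded. *)
Lemma log_ratio_le : ln n'%:R / ln m'%:R <= ln n%:R / ln m%:R :> R.
Proof.
have [i [j [iA jA _ ext]]] := nonuniform_extremes hA.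
have [i' [j' [iA' jA' ij' ext']]] := nonuniform_extremes hA'.
have [b1 [b2 [b1A b2A b12]]] := nonuniform_columns hA.
have [e1 e2] := extreme_exponents_eq hL hL' hT iA jA iA' jA' ext ext'.
have [D [J [c [r0 [D1 r00 h]]]]] :=
  bounded_overlap hL hL' hnu hnu' C1 hf b1A b2A b12 iA jA iA' jA' ij' ext' e1 e2.
have ln0 p : (1 < p)%N -> 0 < ln p%:R :> R by move=> p1; rewrite ln_gt0 // ltr1n.
have [n1 n1'] := (carpet_n_gt1 hL, carpet_n_gt1 hL').
have [m1 mn] := (carpet_m_gt1 hL, carpet_mn hL); have [m1' mn'] :=
  (carpet_m_gt1 hL', carpet_mn hL').
have := ln0 _ m1; have := ln0 _ n1; have := ln0 _ m1'; have := ln0 _ n1'.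
set P : R := 2 * n%:R ^+ 3 in h.
have P0 : 0 < P by rewrite /P mulr_gt0 // exprn_gt0 // ltr0n (carpet_n_gt0 hL).
have D0 : 0 < D by apply: lt_le_trans D1.
rewrite leNgt => b0' a0' b0 a0; apply/negP => lt.
pose z : R := (ln m%:R)^-1; pose x : R := (ln m'%:R)^-1; pose y : R := ln n%:R / ln n'%:R.
have y0 : 0 <= y by rewrite divr_ge0 // ltW.
have th0 : 0 < x - z * y.
  rewrite subr_gt0 /x /y /z mulrA ltr_pdivrMr // mulrC [X in _ < X]mulrC; exact: lt.
pose c3 := c + 1 + (1 + J%:R - ln P * z) * y - (ln D + ln 4) * x.
(* the overlap at this [rho] exceeds the bound by 1 *)
pose rho := Num.min r0 (expR (- ((`|c3| + 1) / (x - z * y)))).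
have rp : 0 < rho by rewrite lt_min r00 expR_gt0.
have rr : 0 < rho <= r0 by rewrite rp /= ge_min lexx.
have [k1 [l1 [k2 [l2 [k3 [l3 [s1 s2 s3 hc]]]]]]] := h rho rr.
have [_ /andP[_ u1]] := scale_log hL s1.
have [/andP[_ u2] _] := scale_log hL' s2.
have [_ /andP[u3 _]] := scale_log hL' s3.
have lam : (`|c3| + 1) <= - ln rho * (x - z * y).
  rewrite -ler_pdivrMr // lerNr -[leRHS]expRK ler_ln ?posrE ?expR_gt0 //.
  by rewrite ge_min lexx orbT.
have e1' : ln (P * rho) = ln P + ln rho by rewrite lnM ?posrE.
have e3 : ln (rho / D / 4) = ln rho - ln D - ln 4 by rewrite !ln_div ?posrE ?divr_gt0.
have e2' : ln (n ^ (k1 + l1 + J))%:R^-1 / ln n'%:R = - ((k1 + l1)%:R + J%:R) * y :> R.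
  have np : 0 < n%:R :> R by rewrite ltr0n (carpet_n_gt0 hL).
  by rewrite natrX lnV ?posrE ?exprn_gt0 // lnXn // -(mulr_natl (ln _)) natrD /y; ring.
rewrite e1' -/z in u1; rewrite e2' in u2; rewrite e3 -/x in u3.
have u1' : ((k1 + l1)%:R + (ln P + ln rho) * z) * y <= 1 * y by rewrite ler_wpM2r.
have := ler_norm c3; move: lam; rewrite /c3 => lam hc3.
lra.
Qed.

End LogRatio.

(** * Powers of Dirichlet polynomials *)

Section Dirichlet.
Context {R : realType}.

Lemma interpolating_poly (pts : seq R) (g : R -> R) :
  exists p : {poly R}, forall v, v \in pts -> p.[v] = g v.
Proof.
elim: pts => [|a pts [p hp]]; first by exists 0.
have [ap|ap] := boolP (a \in pts).
  by exists p => v; rewrite inE => /orP[/eqP ->|]; apply: hp.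
pose r := \prod_(b <- pts) ('X - b%:P) : {poly R}.
have ra : r.[a] != 0.
  rewrite horner_prod prodf_seq_neq0; apply/allP => b hb /=.
  by rewrite hornerXsubC subr_eq0; apply: contra ap => /eqP ->.
exists (p + ((g a - p.[a]) / r.[a]) *: r) => v; rewrite inE hornerD hornerZ.
move=> /orP[/eqP ->|vp]; first by rewrite divfK // addrC subrK.
suff -> : r.[v] = 0 by rewrite mulr0 addr0 hp.
apply/eqP; rewrite horner_prod prodf_seq_eq0; apply/hasP; exists v => //=.
by rewrite hornerXsubC subrr.
Qed.

(** The exponentials [k |-> v ^ k] are independent, so a linear relation between
    them survives when they are replaced by arbitrary functions of [v]. *)
Lemma power_relation_lift (I : Type) (l : seq I) (e v : I -> R) (g : R -> R) :
  (forall k, \sum_(x <- l) e x * v x ^+ k = 0) -> \sum_(x <- l) e x * g (v x) = 0.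
Proof.
move=> h; have [p hp] := interpolating_poly (map v l) g.
have -> : \sum_(x <- l) e x * g (v x) = \sum_(x <- l) e x * p.[v x].
  elim: l hp {h} => [|x l IH] hp; first by rewrite !big_nil.
  rewrite !big_cons hp ?mem_head // IH // => w wl; apply: hp; by rewrite inE wl orbT.
under eq_bigr do rewrite horner_coef mulr_sumr.
rewrite exchange_big big1 // => i _ /=.
by under eq_bigr do rewrite mulrCA; rewrite -mulr_sumr h mulr0.
Qed.

Definition expsum (l : seq nat) (a b : nat -> R) (q : R) : R :=
  \sum_(v <- l) expR (q * a v + b v).

Lemma expsum_gt0 l a b q : l != [::] -> 0 < expsum l a b q.
Proof.
by case: l => // v l _; rewrite /expsum big_cons ltr_wpDr ?expR_gt0 // sumr_ge0 // => w _;
  exact: expR_ge0.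
Qed.

Lemma is_derive_expsum l a b (q : R) :
  is_derive q 1 (expsum l a b) (\sum_(v <- l) a v * expR (q * a v + b v)).
Proof.
rewrite (_ : expsum l a b = fun q => \sum_(v <- l) expR (q * a v + b v)) //.
elim: l => [|v l IH].
  rewrite big_nil (_ : (fun _ => _) = cst 0); first exact: is_derive_cst.
  by apply/funext => x; rewrite big_nil.
rewrite big_cons (_ : (fun q => _) = (fun q => expR (q * a v + b v)) + (fun q =>
  \sum_(v <- l) expR (q * a v + b v))).
  apply: is_deriveD => //; rewrite mulrC; apply: (is_derive1_comp (f := expR)).
  have -> : (fun q : R => q * a v + b v) = id * cst (a v) + cst (b v) by apply/funext.
  have d := is_deriveD (is_deriveM (is_derive_id q (1 : R)) (is_derive_cst (a v) q (1 : R)))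
    (is_derive_cst (b v) q (1 : R)).
  by apply: (is_derive_eq d); rewrite /= scaler0 add0r addr0 /GRing.scale /= mulr1.
by apply/funext => x; rewrite big_cons.
Qed.

Lemma expsum_lse l a b q v0 : v0 \in l ->
  (forall v, v \in l -> q * a v + b v <= q * a v0 + b v0) ->
  q * a v0 + b v0 <= ln (expsum l a b q) <= q * a v0 + b v0 + ln (size l)%:R.
Proof.
move=> vl h.
have l0 : l != [::] by case: (l) vl.
have s0 : 0 < (size l)%:R :> R by rewrite ltr0n; case: (l) l0.
have e0 := expsum_gt0 a b q l0.
apply/andP; split.
- rewrite -[leLHS]expRK ler_ln ?posrE ?expR_gt0 //.
  rewrite /expsum (big_rem v0) //= lerDl sumr_ge0 // => w _; exact: expR_ge0.
- rewrite -[q * a v0 + b v0]expRK -lnM ?posrE ?expR_gt0 // ler_ln ?posrE ?mulr_gt0 ?expR_gt0 //.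
  apply: (@le_trans _ _ (\sum_(v <- l) expR (q * a v0 + b v0))).
    by rewrite /expsum big_seq [leRHS]big_seq; apply: ler_sum => v /h; rewrite ler_expR.
  by rewrite big_const_seq count_predT iter_addr_0 mulr_natr.
Qed.

Context {s1 s2 : seq nat} {beta B0 : R}.
Hypothesis s1_0 : s1 != [::].
Hypothesis s2_0 : s2 != [::].
Hypothesis s1_pos : forall v, v \in s1 -> (0 < v)%N.
Hypothesis s2_pos : forall v, v \in s2 -> (0 < v)%N.

Let G (b : nat -> R) (q : R) : R :=
  beta * ln (expsum s1 (fun v => ln v%:R) b q) - ln (expsum s2 (fun v => ln v%:R) b q) - B0 * q.

Let H (b : nat -> R) (q : R) : R :=
  \sum_(x <- [seq (v, w) | v <- s1, w <- s2]) (beta * ln x.1%:R - ln x.2%:R - B0) *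
    (expR (q * ln x.1%:R + b x.1) * expR (q * ln x.2%:R + b x.2)).

Let G_derive b (q : R) : is_derive q (1 : R) (G b)
  (H b q / (expsum s1 (fun v => ln v%:R) b q * expsum s2 (fun v => ln v%:R) b q)).
Proof.
set E1 := expsum s1 _ b; set E2 := expsum s2 _ b.
have p1 : 0 < E1 q by apply: expsum_gt0.
have p2 : 0 < E2 q by apply: expsum_gt0.
pose D1 := \sum_(v <- s1) ln v%:R * expR (q * ln v%:R + b v).
pose D2 := \sum_(v <- s2) ln v%:R * expR (q * ln v%:R + b v).
have dl1 : is_derive q 1 (ln (R := R) \o E1) ((E1 q)^-1 * D1).
  by apply: is_derive1_comp; [exact: is_derive1_ln|exact: is_derive_expsum].
have dl2 : is_derive q 1 (ln (R := R) \o E2) ((E2 q)^-1 * D2).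
  by apply: is_derive1_comp; [exact: is_derive1_ln|exact: is_derive_expsum].
have -> : G b = (cst beta * (ln (R := R) \o E1) - (ln (R := R) \o E2)) - cst B0 * id.
  by apply/funext.
have d := is_deriveB (is_deriveB (is_deriveM (is_derive_cst beta q (1 : R)) dl1) dl2)
  (is_deriveM (is_derive_cst B0 q (1 : R)) (is_derive_id q (1 : R))).
apply: (is_derive_eq d); rewrite /= !scaler0 !addr0 /GRing.scale /= mulr1.
have -> : H b q = beta * D1 * E2 q - E1 q * D2 - B0 * E1 q * E2 q.
  rewrite /H big_allpairs_dep /= /D1 /D2 /E1 /E2 /expsum.
  rewrite [beta * _]mulr_sumr [B0 * _]mulr_sumr !mulr_suml -!sumrB.
  apply: eq_bigr => v _; rewrite !mulr_sumr -!sumrB; apply: eq_bigr => w _; ring.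
by field; rewrite !gt_eqF.
Qed.

(** Let [f1] and [f2] be the two Dirichlet polynomials. Differentiating the relation
    in [q] and clearing denominators gives a linear relation between the functions
    [(v * w) ^ q], whose coefficients must cancel for each value of the product
    [v * w]. It therefore survives multiplication of each term by
    [expR (lam (v * w))], which is the same relation for the deformed sums. *)
Lemma dirichlet_power_deform (lam : nat -> R) A0 :
  (forall q : R, beta * ln (\sum_(v <- s1) v%:R `^ q) = ln (\sum_(v <- s2) v%:R `^ q) + A0 + B0 *
    q) ->
  (forall v w, (0 < v)%N -> (0 < w)%N -> lam (v * w)%N = lam v + lam w) ->
  forall q, G lam q = G lam 0.
Proof.
move=> rel addl.
have E0 s q : (forall v, v \in s -> (0 < v)%N) ->
    expsum s (fun v => ln v%:R) (fun _ => 0) q = \sum_(v <- s) v%:R `^ q.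
  move=> sp; rewrite /expsum big_seq [RHS]big_seq; apply: eq_bigr => v /sp v0.
  by rewrite /powR pnatr_eq0 gtn_eqF // addr0.
have G0 q : G (fun _ => 0) q = A0 by rewrite /G !E0 // rel; ring.
have H0 q : H (fun _ => 0) q = 0.
  have d1 := G_derive (fun _ => 0) q.
  have e : G (fun _ => 0) = cst A0 by apply/funext => x; rewrite G0.
  rewrite e in d1; have d2 := is_derive_cst A0 q (1 : R).
  have := @derive_val _ _ _ _ _ _ _ d1; rewrite (@derive_val _ _ _ _ _ _ _ d2) => /esym/eqP.
  have p1 := expsum_gt0 (fun v => ln v%:R) (fun _ => 0) q s1_0.
  have p2 := expsum_gt0 (fun v => ln v%:R) (fun _ => 0) q s2_0.
  have p12 := lt0r_neq0 (mulr_gt0 p1 p2).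
  by rewrite mulf_eq0 invr_eq0 (negPf p12) orbF => /eqP.
have posx x : x \in [seq (v, w) | v <- s1, w <- s2] -> (0 < x.1)%N /\ (0 < x.2)%N.
  by move=> /allpairsP[[v w] /= [/s1_pos v0 /s2_pos w0 ->]].
have Hq q : H lam q = 0.
  rewrite /H (eq_big_seq (fun x : nat * nat => (beta * ln x.1%:R - ln x.2%:R - B0) *
    expR (q * ln (x.1 * x.2)%:R + lam (x.1 * x.2)%N))); last first.
    move=> x /posx[v0 w0]; rewrite -expRD addl // natrM lnM ?posrE ?ltr0n //.
    by congr (_ * expR _); ring.
  (* the bases are natural numbers, so [lam] can be read off their real images *)
  pose g (u : R) := expR (q * ln u + lam (Num.truncn u)).
  rewrite (eq_bigr (fun x : nat * nat => (beta * ln x.1%:R - ln x.2%:R - B0) * g (x.1 * x.2)%:R)).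
    apply: power_relation_lift => k.
    rewrite -[RHS](H0 k%:R) /H; apply: eq_big_seq => x /posx[v0 w0].
    rewrite !addr0 -expRD -mulrDr -lnM ?posrE ?ltr0n // -natrM; congr (_ * _).
    by rewrite mulr_natl -lnXn ?ltr0n ?muln_gt0 ?v0 // lnK // posrE exprn_gt0 // ltr0n muln_gt0 v0.
  by move=> x _; rewrite /g natrK.
move=> q; apply: is_derive_0_is_cst => x.
by have := G_derive lam x; rewrite Hq mul0r.
Qed.

Lemma seq_argmax (T : eqType) (l : seq T) (F : T -> R) : l != [::] ->
  exists2 x, x \in l & forall y, y \in l -> F y <= F x.
Proof.
case: l => // x l _; elim: l x => [|y l IH] x.
  by exists x; rewrite ?mem_head // => z; rewrite inE => /eqP ->.
have [z zl hz] := IH y; have [xz|zx] := leP (F x) (F z).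
- by exists z; [rewrite inE zl orbT|move=> t; rewrite inE => /orP[/eqP ->|/hz]].
- exists x; first by rewrite mem_head.
  by move=> t; rewrite inE => /orP[/eqP ->//|/hz h]; apply: le_trans h (ltW zx).
Qed.

(** A sum of exponentials is its largest term up to the number of terms. *)
Let G_bounds (b : nat -> R) (q : R) v w : 0 < beta -> v \in s1 -> w \in s2 ->
  (forall u, u \in s1 -> q * ln u%:R + b u <= q * ln v%:R + b v) ->
  (forall u, u \in s2 -> q * ln u%:R + b u <= q * ln w%:R + b w) ->
  `|G b q - (q * (beta * ln v%:R - ln w%:R - B0) + (beta * b v - b w))| <=
    beta * ln (size s1)%:R + ln (size s2)%:R.
Proof.
move=> b0 vs ws hv hw.
have /andP[l1 l2] := expsum_lse vs hv; have /andP[l3 l4] := expsum_lse ws hw.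
have ln0 (l : seq nat) : l != [::] -> 0 <= ln (size l)%:R :> R.
  by move=> l0; rewrite ln_ge0 // ler1n; case: (l) l0.
have := ln0 _ s1_0; have := ln0 _ s2_0; rewrite /G => p2 p1.
set e1 := ln (expsum s1 _ _ _) in l1 l2 *; set e2 := ln (expsum s2 _ _ _) in l3 l4 *.
have k1 : beta * (q * ln v%:R + b v) <= beta * e1 by rewrite ler_pM2l.
have k2 : beta * e1 <= beta * (q * ln v%:R + b v + ln (size s1)%:R) by rewrite ler_pM2l.
have k3 : 0 <= beta * ln (size s1)%:R by rewrite mulr_ge0 // ltW.
rewrite ler_norml; apply/andP; split; lra.
Qed.

(** A deformation shifts the exponents by constants, which the differences of the
    terms [q * ln v] outgrow. *)
Lemma dominant_base (l : seq nat) (V : nat) (b : nat -> R) : (forall v, v \in l ->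
  (0 < v <= V)%N) ->
  exists q0 : R, forall q, q0 <= q -> forall v, v \in l -> q * ln v%:R + b v <= q * ln V%:R + b V.
Proof.
elim: l => [|u l IH] h; first by exists 0.
have [v vl|q1 hq1] := IH; first by apply: h; rewrite inE vl orbT.
have /andP[u0 uV] := h u (mem_head _ _).
have [->|uV'] := eqVneq u V.
  by exists q1 => q hq v; rewrite inE => /orP[/eqP ->//|]; apply: hq1.
have d0 : 0 < ln V%:R - ln u%:R :> R.
  by rewrite subr_gt0 ltr_ln ?posrE ?ltr0n ?(leq_trans u0) // ltr_nat ltn_neqAle uV'.
exists (Num.max q1 ((b u - b V) / (ln V%:R - ln u%:R))) => q; rewrite ge_max => /andP[h1 h2] v.
rewrite inE => /orP[/eqP ->|vl]; last exact: hq1.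
by move: h2; rewrite ler_pdivrMr // mulrBr; lra.
Qed.

(** By [dirichlet_power_deform], [G] with the deformation [s * lam] does not depend
    on [q]. As [q] tends to infinity the largest bases [V] and [W] dominate; at
    [q = 0] the maximisers [v1] and [w1] of [lam] do. The errors are bounded
    independently of [s], so comparing the coefficients of [s] gives the relation. *)
Lemma extremal_relation (lam : nat -> R) A0 V W v1 w1 : 0 < beta ->
  (forall q : R, beta * ln (\sum_(v <- s1) v%:R `^ q) = ln (\sum_(v <- s2) v%:R `^ q) + A0 + B0 *
    q) ->
  (forall v w, (0 < v)%N -> (0 < w)%N -> lam (v * w)%N = lam v + lam w) ->
  V \in s1 -> W \in s2 -> v1 \in s1 -> w1 \in s2 ->
  (forall v, v \in s1 -> (v <= V)%N) -> (forall v, v \in s2 -> (v <= W)%N) ->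
  (forall v, v \in s1 -> lam v <= lam v1) -> (forall v, v \in s2 -> lam v <= lam w1) ->
  beta * (lam v1 - lam V) = lam w1 - lam W.
Proof.
move=> b0 rel addl Vs Ws vs ws hV hW hv hw.
set c := beta * ln (size s1)%:R + ln (size s2)%:R.
(* the slope in [q] of [G] at infinity, zero because [G] is constant *)
pose kap : R := beta * ln V%:R - ln W%:R - B0.
have lnle u U : (0 < u)%N -> (u <= U)%N -> ln u%:R <= ln U%:R :> R.
  by move=> u0 uU; rewrite ler_ln ?posrE ?ltr0n ?(leq_trans u0) // ler_nat.
have kap0 : kap = 0.
  apply: (@slope_eq _ _ _ (c + `|G (fun _ => 0) 0|)) => q q0; rewrite subr0.
  have := @G_bounds (fun _ => 0) q V W b0 Vs Ws.
  rewrite (dirichlet_power_deform (lam := fun _ => 0) rel) => [|v w _ _]; last by rewrite addr0.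
  rewrite mulr0 subr0 -/kap -/c => h.
  have -> : q * kap = G (fun _ => 0) 0 - (G (fun _ => 0) 0 - q * kap) by ring.
  apply: (le_trans (ler_normB _ _)); rewrite addrC lerD2r -[q * kap]addr0; apply: h => u us;
    rewrite !addr0.
  - by rewrite ler_wpM2l // lnle ?s1_pos ?hV.
  - by rewrite ler_wpM2l // lnle ?s2_pos ?hW.
apply: (@slope_eq _ _ _ (c + c)) => s s0.
pose b v := s * lam v.
have Gc q : G b q = G b 0.
  by apply: (dirichlet_power_deform rel) => v w v0 w0; rewrite /b addl // mulrDr.
have [q1 hq1] : exists q0 : R, forall q, q0 <= q -> forall v, v \in s1 ->
  q * ln v%:R + b v <= q * ln V%:R + b V.
  by apply: dominant_base => v vl; rewrite s1_pos ?hV.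
have [q2 hq2] : exists q0 : R, forall q, q0 <= q -> forall v, v \in s2 ->
  q * ln v%:R + b v <= q * ln W%:R + b W.
  by apply: dominant_base => v vl; rewrite s2_pos ?hW.
pose q := Num.max q1 q2.
have h1 := @G_bounds b q V W b0 Vs Ws (hq1 q _) (hq2 q _).
rewrite Gc -/kap kap0 mulr0 add0r -/c !le_max !lexx orbT in h1.
have -> : s * (beta * (lam v1 - lam V) - (lam w1 - lam W)) =
    (G b 0 - (beta * b V - b W)) - (G b 0 - (beta * b v1 - b w1)) by rewrite /b; ring.
apply: (le_trans (ler_normB _ _)); apply: lerD; first exact: h1.
rewrite (_ : beta * b v1 - b w1 =
  0 * (beta * ln v1%:R - ln w1%:R - B0) + (beta * b v1 - b w1)); last by rewrite mul0r add0r.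
by apply: G_bounds => // u us; rewrite !mul0r !add0r /b ler_wpM2l // ?hv ?hw.
Qed.

(** Choose a prime whose valuation is not constant on the bases in [s1]. For this
    valuation or its opposite [extremal_relation] equates [beta] times a non-zero
    integer with an integer. *)
Lemma dirichlet_power_rational A0 : 0 < beta ->
  (forall q : R, beta * ln (\sum_(v <- s1) v%:R `^ q) = ln (\sum_(v <- s2) v%:R `^ q) + A0 + B0 *
    q) ->
  (exists v w, [/\ v \in s1, w \in s1 & v != w]) ->
  exists a b : nat, [/\ (0 < a)%N, (0 < b)%N & beta * b%:R = a%:R].
Proof.
move=> b0 rel [u1 [u2 [u1s u2s u12]]].
have [V Vs hV] := seq_argmax (fun v : nat => v%:R : R) s1_0.
have [W Ws hW] := seq_argmax (fun v : nat => v%:R : R) s2_0.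
have {}hV v : v \in s1 -> (v <= V)%N by move=> /hV; rewrite ler_nat.
have {}hW v : v \in s2 -> (v <= W)%N by move=> /hW; rewrite ler_nat.
have [v vs vV] : exists2 v, v \in s1 & v != V.
  have [e|] := eqVneq u1 V; last by exists u1.
  by exists u2 => //; rewrite -e eq_sym.
have [p hp] : exists p, logn p v != logn p V.
  apply: contrapT => no; move/eqP: vV; apply.
  apply: eqn_from_log; rewrite ?s1_pos // => p; apply/eqP/negPn/negP => h; apply: no; by exists p.
have addl a b : (0 < a)%N -> (0 < b)%N -> (logn p (a * b))%:R = (logn p a)%:R + (logn p b)%:R :> R.
  by move=> a0 b0'; rewrite lognM // natrD.
have conclude (x y x' y' : nat) : (y < x)%N -> beta * (x%:R - y%:R) = x'%:R - y'%:R ->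
    exists a b : nat, [/\ (0 < a)%N, (0 < b)%N & beta * b%:R = a%:R].
  move=> yx e; exists (x' - y')%N, (x - y)%N.
  have y'x' : (y' < x')%N by rewrite -(ltr_nat R) -subr_gt0 -e mulr_gt0 // subr_gt0 ltr_nat.
  by split; rewrite ?subn_gt0 // !natrB ?(ltnW yx) // ltnW.
have [lt|gt|e] := ltngtP (logn p V) (logn p v); last by rewrite e eqxx in hp.
- have [v1 v1s hv1] := seq_argmax (fun v => (logn p v)%:R : R) s1_0.
  have [w1 w1s hw1] := seq_argmax (fun v => (logn p v)%:R : R) s2_0.
  apply: (conclude _ _ _ _ _ (extremal_relation b0 rel addl Vs Ws v1s w1s hV hW hv1 hw1)).
  by apply: (leq_trans lt); rewrite -(ler_nat R) hv1.
- have addn a b : (0 < a)%N -> (0 < b)%N ->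
      - (logn p (a * b))%:R = - (logn p a)%:R + - (logn p b)%:R :> R.
    by move=> a0 b0'; rewrite addl // opprD.
  have [v1 v1s hv1] := seq_argmax (fun v => - (logn p v)%:R : R) s1_0.
  have [w1 w1s hw1] := seq_argmax (fun v => - (logn p v)%:R : R) s2_0.
  have := extremal_relation b0 rel addn Vs Ws v1s w1s hV hW hv1 hw1.
  rewrite !opprK => e; apply: (@conclude (logn p V) (logn p v1) (logn p W) (logn p w1)).
    apply: leq_ltn_trans gt; by have := hv1 v vs; rewrite lerN2 ler_nat.
  by rewrite addrC e addrC.
Qed.

End Dirichlet.

(** * Iterated carpets *)

(** The sides [p] and [q] of the grid are kept apart from [m ^ s] and [n ^ s]
    because two carpets are to be put on one grid. *)
Definition iterate_set (m n : nat) (A : {set 'I_m * 'I_n}) (s p q : nat) : {set 'I_p * 'I_q} :=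
  [set c : 'I_p * 'I_q | has (fun w => (ordval (unzip1 w) == c.1) && (ordval (unzip2 w) == c.2))
    (words (enum A) s)].

Section Iterate.
Context {R : realType} {m n : nat} {A : {set 'I_m * 'I_n}} {L : set (R * R)}.
Hypothesis hL : bm_carpet A L.
Context {s p q : nat}.
Hypothesis s0 : (0 < s)%N.
Hypothesis hp : p = (m ^ s)%N.
Hypothesis hq : q = (n ^ s)%N.

Let m1 := carpet_m_gt1 hL.
Let mn := carpet_mn hL.

Lemma iterate_setP (c : 'I_p * 'I_q) : reflect
  (exists w, [/\ size w = s, all (mem A) w, ordval (unzip1 w) = c.1 :> nat & ordval (unzip2 w) =
    c.2 :> nat])
  (c \in (iterate_set A s p q)).
Proof.
rewrite inE; apply: (iffP hasP) => [[w]|[w [sw wA h1 h2]]].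
  rewrite mem_words all_enum => /andP[/eqP sw wA] /andP[/eqP h1 /eqP h2]; by exists w.
by exists w; rewrite ?mem_words ?all_enum ?sw ?wA ?h1 ?h2 ?eqxx.
Qed.

Lemma iterate_cell_ex (w : seq ('I_m * 'I_n)) : size w = s -> all (mem A) w ->
  exists c : 'I_p * 'I_q, [/\ c \in (iterate_set A s p q),
    ordval (unzip1 w) = c.1 :> nat & ordval (unzip2 w) = c.2 :> nat].
Proof.
move=> sw wA.
have h1 : (ordval (unzip1 w) < p)%N by rewrite hp -sw -[X in (_ < m ^ X)%N](size_map fst) ordval_lt.
have h2 : (ordval (unzip2 w) < q)%N by rewrite hq -sw -[X in (_ < n ^ X)%N](size_map snd) ordval_lt.
exists (Ordinal h1, Ordinal h2); split => //; apply/iterate_setP; by exists w.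
Qed.

Lemma iterate_bm_map (w : seq ('I_m * 'I_n)) (c : 'I_p * 'I_q) (y : R * R) : size w = s ->
  ordval (unzip1 w) = c.1 :> nat -> ordval (unzip2 w) = c.2 :> nat -> bm_map c y = word_map w y.
Proof. by move=> sw h1 h2; rewrite /word_map bm_map_cell_map -h1 -h2 sw -hp -hq. Qed.

Lemma iterate_carpet : bm_carpet (iterate_set A s p q) L.
Proof.
case: (hL) => _ A0 L0 cL eL.
have nseqA (a : 'I_m * 'I_n) : a \in A -> all (mem A) (nseq s a).
  by move=> aA; apply/allP => x /nseqP[->].
split => //.
- rewrite hp hq; apply/andP; split; last by rewrite ltn_exp2r.
  by rewrite -[1%N](exp1n s) ltn_exp2r.
- have /finset.set0Pn[a aA] := A0.
  have [c [cA _ _]] := iterate_cell_ex (size_nseq s a) (nseqA a aA).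
  by apply/finset.set0Pn; exists c.
- apply/seteqP; split => [x Lx|x [c /= /iterate_setP[w [sw wA h1 h2]] [y Ly <-]]].
  + have [w [y [hw Ly ->]]] := carpet_words hL s Lx.
    move: hw; rewrite mem_words all_enum => /andP[/eqP sw wA].
    have [c [cA h1 h2]] := iterate_cell_ex sw wA.
    by exists c => //; exists y => //; rewrite (iterate_bm_map _ sw h1 h2).
  + by rewrite (iterate_bm_map _ sw h1 h2); apply: (carpet_word_map hL).
Qed.

(** Distinct words of length [s] give distinct cells of the grid. *)
Lemma sum_iterate (V : nmodType) (F : nat * nat -> V) :
  \sum_(c in (iterate_set A s p q)) F (val c.1, val c.2) =
  \sum_(w <- words (enum A) s) F (ordval (unzip1 w), ordval (unzip2 w)).
Proof.
rewrite -big_enum /= -(big_map (fun c : 'I_p * 'I_q => (val c.1, val c.2)) xpredT F).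
rewrite -[RHS](big_map (fun w => (ordval (unzip1 w), ordval (unzip2 w))) xpredT F).
apply: perm_big; apply: uniq_perm.
- rewrite map_inj_uniq ?enum_uniq // => -[a b] [a' b'] /= [h1 h2].
  by congr pair; apply: val_inj.
- rewrite map_inj_in_uniq; first exact/words_uniq/enum_uniq.
  move=> w w'; rewrite !mem_words => /andP[/eqP sw _] /andP[/eqP sw' _] [h1 h2].
  rewrite -[w]zip_unzip -[w']zip_unzip.
  have -> : unzip1 w = unzip1 w' by apply: ordval_inj => //; rewrite !size_map sw sw'.
  by have -> : unzip2 w = unzip2 w' by apply: ordval_inj => //; rewrite !size_map sw sw'.
- move=> x; apply/mapP/mapP => [[c]|[w]].
  + rewrite mem_enum => /iterate_setP[w [sw wA h1 h2]] ->; exists w; last by rewrite h1 h2.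
    by rewrite mem_words all_enum sw wA eqxx.
  + rewrite mem_words all_enum => /andP[/eqP sw wA] ->.
    have [c [cA h1 h2]] := iterate_cell_ex sw wA; exists c; rewrite ?mem_enum //.
    by rewrite h1 h2.
Qed.

Lemma card_iterate : #|(iterate_set A s p q)| = (#|A| ^ s)%N.
Proof.
rewrite -sum1_card (sum_iterate (fun _ => 1%N)) sum1_size size_words cardE.
by [].
Qed.

Lemma iterate_bernoulli (nu : probability (R * R)%type R) :
  uniform_bernoulli A nu -> uniform_bernoulli (iterate_set A s p q) nu.
Proof.
move=> hnu E mE; rewrite massE // (mass_words hL hnu s mE) card_iterate natrX EFinM;
  congr (_ * _)%E.
rewrite -sumEFin.
have := sum_iterate (fun x => (mass nu ((cell_map (R := R) p q x.1 x.2) @^-1` E))%:E).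
rewrite /= => e.
rewrite (eq_bigr (fun c : 'I_p * 'I_q => (mass nu (cell_map (R := R) p q c.1 c.2 @^-1` E))%:E));
  last first.
  move=> c _; rewrite massE //; rewrite -[_ @^-1` _]setTI; exact: measurable_cell_map.
rewrite e big_seq [RHS]big_seq; apply: eq_bigr => w.
by rewrite mem_words /word_map => /andP[/eqP -> _]; rewrite -hp -hq.
Qed.

Lemma iterate_columns b1 b2 : b1 \in A -> b2 \in A -> (b1.1 < b2.1)%N ->
  exists c1 c2, [/\ c1 \in (iterate_set A s p q), c2 \in (iterate_set A s p q) & (c1.1 < c2.1)%N].
Proof.
move=> b1A b2A b12.
have nseqA (a : 'I_m * 'I_n) : a \in A -> all (mem A) (nseq s a).
  by move=> aA; apply/allP => x /nseqP[->].
have [c1 [c1A h1 _]] := iterate_cell_ex (size_nseq s b1) (nseqA b1 b1A).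
have [c2 [c2A h2 _]] := iterate_cell_ex (size_nseq s b2) (nseqA b2 b2A).
have neq : c1.1 != c2.1 :> nat.
  apply/eqP => e; rewrite -h1 -h2 in e.
  have /ordval_inj/(_ e) : size (unzip1 (nseq s b1)) = size (unzip1 (nseq s b2)).
    by rewrite !size_map !size_nseq.
  rewrite /unzip1 !map_nseq; case: (s) s0 => // s' _ [e'].
  by rewrite e' ltnn in b12.
case: (ltngtP c1.1 c2.1) => h.
- by exists c1, c2.
- by exists c2, c1.
- by rewrite h eqxx in neq.
Qed.

End Iterate.

(** * Uniqueness of the digit set on a grid *)

Section Unique.
Context {R : realType}.

(** Two columns in increasing order move the abscissa off the sides, and two rows,
    which a column with two elements provides, do the same for the ordinate. *)
Lemma interior_point (m n : nat) (A : {set 'I_m * 'I_n}) (L : set (R * R)) :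
  bm_carpet A L -> nonuniform_fibres A ->
  exists2 z, L z & 0 < z.1 < 1 /\ 0 < z.2 < 1.
Proof.
move=> hL hA; have [b1 [b2 [b1A b2A b12]]] := nonuniform_columns hA.
have [m0 n0] := (carpet_m_gt0 hL, carpet_n_gt0 hL).
have mR : 0 < m%:R :> R by rewrite ltr0n.
have nR : 0 < n%:R :> R by rewrite ltr0n.
have [i [j [iA jA ij _]]] := nonuniform_extremes hA.
have [r1 [r2 [r1A r2A r12]]] : exists r1 r2, [/\ r1 \in A, r2 \in A & (r1.2 < r2.2)%N].
  have : (1 < #|[set k | (j, k) \in A]%SET|)%N.
    by apply: (@leq_trans (column_size A j)) => //; apply: leq_ltn_trans ij; rewrite -mem_cols.
  move=> /card_gt1P[x [y [+ + xy]]]; rewrite !inE => xA yA.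
  have := ltngtP x y; case=> [lt|gt|/ord_inj e]; last by rewrite e eqxx in xy.
  - by exists (j, x), (j, y).
  - by exists (j, y), (j, x).
have [p Lp] := carpet_ex hL.
pose w := [:: b1; b2; r1; r2].
have wA : all (mem A) w by rewrite /= b1A b2A r1A r2A.
exists (word_map w p); first exact: carpet_word_map hL _ _ wA Lp.
(* [b > 0] keeps off the left side, [a < d.-1] off the right side *)
have two (a b d : nat) (y : R) : (a < b)%N -> (b < d)%N -> 0 <= y <= 1 ->
    0 < ((y + b%:R) / d%:R + a%:R) / d%:R < 1.
  move=> ab bd /andP[y0 y1]; have d0 : 0 < d%:R :> R by rewrite ltr0n (leq_ltn_trans _ bd).
  have h1 : a%:R + 1 <= b%:R :> R by rewrite natr1 ler_nat.
  have h2 : b%:R + 1 <= d%:R :> R by rewrite natr1 ler_nat.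
  have h3 := ler0n R a.
  have g0 : 0 < (y + b%:R) / d%:R by rewrite divr_gt0 //; lra.
  have g1 : (y + b%:R) / d%:R <= 1 by rewrite ler_pdivrMr // mul1r; lra.
  rewrite divr_gt0 ?ltr_pdivrMr //= ?mul1r; lra.
have inner (a d : nat) (y : R) : (a < d)%N -> 0 < y < 1 -> 0 < (y + a%:R) / d%:R < 1.
  move=> ad /andP[y0 y1]; have d0 : 0 < d%:R :> R by rewrite ltr0n (leq_ltn_trans _ ad).
  have h2 : a%:R + 1 <= d%:R :> R by rewrite natr1 ler_nat.
  have h3 := ler0n R a.
  rewrite divr_gt0 ?ltr_pdivrMr //= ?mul1r; lra.
have Lr : L (word_map [:: r1; r2] p).
  by apply: carpet_word_map hL _ _ _ Lp; rewrite /= r1A r2A.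
have [ux _] := carpet_unit_square hL Lr; have [_ uy] := carpet_unit_square hL Lp.
rewrite /w -[[:: b1; b2; r1; r2]]/([:: b1; b2] ++ [:: r1; r2]) word_map_cat //.
have uy' : 0 < (word_map [:: r1; r2] p).2 < 1.
  by rewrite word_map_cons // word_map1 // /bm_map /=; apply: two.
move: (word_map [:: r1; r2] p) ux uy' => y ux uy'.
rewrite word_map_cons // word_map1 // /bm_map /=; split; first exact: two.
by apply: (inner _ _ _ (ltn_ord _)); apply: (inner _ _ _ (ltn_ord _)).
Qed.

(** A cell of a carpet contains a copy of an interior point, and such a point lies
    in no other cell. *)
Lemma carpet_set_unique (p q : nat) (B B' : {set 'I_p * 'I_q}) (L : set (R * R)) :
  bm_carpet B L -> bm_carpet B' L ->
  (exists2 z, L z & 0 < z.1 < 1 /\ 0 < z.2 < 1) -> B = B'.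
Proof.
move=> hB hB' [z Lz [/andP[z1 z2] /andP[z3 z4]]].
have aux (B1 B2 : {set 'I_p * 'I_q}) c : bm_carpet B1 L -> bm_carpet B2 L -> c \in B1 -> c \in B2.
  move=> h1 h2 c1; have : L (bm_map c z).
    by case: (h1) => _ _ _ _ ->; exists c => //; exists z.
  case: (h2) => _ _ _ _ {1}-> [d /= dB [y Ly [e1 e2]]].
  have [/andP[y1 y2] /andP[y3 y4]] := carpet_unit_square h2 Ly.
  have p0 : p%:R != 0 :> R by rewrite pnatr_eq0 -lt0n (carpet_m_gt0 h1).
  have q0 : q%:R != 0 :> R by rewrite pnatr_eq0 -lt0n (carpet_n_gt0 h1).
  have {}e1 : y.1 + d.1%:R = z.1 + c.1%:R by apply: (mulIf (invr_neq0 p0)).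
  have {}e2 : y.2 + d.2%:R = z.2 + c.2%:R by apply: (mulIf (invr_neq0 q0)).
  have key (a b : nat) (u v : R) : 0 < u -> u < 1 -> 0 <= v -> v <= 1 -> v + a%:R = u + b%:R ->
    a = b.
    move=> u0 u1 v0 v1 e; apply/eqP; rewrite eqn_leq; apply/andP; split; rewrite -ltnS -(ltr_nat R).
    - by rewrite -[b.+1%:R]natr1; lra.
    - by rewrite -[a.+1%:R]natr1; lra.
  suff <- : d = c by [].
  rewrite [d]surjective_pairing [c]surjective_pairing.
  by congr pair; apply: ord_inj; [apply: key e1|apply: key e2].
by apply/setP => c; apply/idP/idP; apply: aux.
Qed.

End Unique.

(** * Comparison of two carpets on one grid *)

Section SameGrid.
Context {R : realType} {p q : nat} {B B' : {set 'I_p * 'I_q}}.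
Context {rho kap : R}.
Hypothesis rho0 : 0 < rho.
Hypothesis kap0 : 0 < kap.
Hypothesis rel : forall t : R,
  column_power_sum B t = rho * (kap `^ t * column_power_sum B' t).

Let N (i : 'I_p) : R := (column_size B i)%:R.
Let N' (i : 'I_p) : R := (column_size B' i)%:R.

(** At natural [t] the hypothesis is a linear relation between the [t]-th powers of
    the numbers [N i] and [kap * N' i]; see [power_relation_lift]. *)
Lemma column_sum_transfer (g : R -> R) :
  \sum_(i <- cols B) g (N i) = rho * \sum_(i <- cols B') g (kap * N' i).
Proof.
pose l : seq ('I_p + 'I_p) := map inl (cols B) ++ map inr (cols B').
pose e (x : 'I_p + 'I_p) : R := if x is inl _ then 1 else - rho.
pose v (x : 'I_p + 'I_p) : R := match x with inl i => N i | inr i => kap * N' i end.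
have split_sum (F : R -> R) : \sum_(x <- l) e x * F (v x) =
    \sum_(i <- cols B) F (N i) - rho * \sum_(i <- cols B') F (kap * N' i).
  rewrite /l big_cat !big_map /= mulr_sumr -sumrN; congr (_ + _); apply: eq_bigr => i _.
  - by rewrite mul1r.
  - by rewrite mulNr.
suff : \sum_(x <- l) e x * g (v x) = 0 by rewrite split_sum => /eqP; rewrite subr_eq0 => /eqP.
apply: power_relation_lift => k; rewrite (split_sum (fun x => x ^+ k)).
have := rel k%:R; rewrite /column_power_sum powR_mulrn ?ltW // => e1.
apply/eqP; rewrite subr_eq0; apply/eqP.
transitivity (\sum_(i <- cols B) N i `^ k%:R); first by apply: eq_bigr => i _; rewrite powR_mulrn.
rewrite e1; congr (_ * _); rewrite mulr_sumr; apply: eq_bigr => i _.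
by rewrite powR_mulrn // exprMn.
Qed.

Let count_cols (A : {set 'I_p * 'I_q}) (x : R) : nat :=
  count (fun i => (column_size A i)%:R == x) (cols A).

Let count_transfer x : (count_cols B (kap * x))%:R = rho * (count_cols B' x)%:R.
Proof.
have cnt (P : pred 'I_p) (s : seq 'I_p) : \sum_(i <- s) (if P i then 1 else 0 : R) = (count P s)%:R.
  by rewrite -big_mkcond /= big_const_seq iter_addr_0.
rewrite /count_cols -!cnt (column_sum_transfer (fun y => if y == kap * x then 1 else 0)).
congr (_ * _); apply: eq_bigr => i _.
by rewrite (inj_eq (mulfI (lt0r_neq0 kap0))).
Qed.

Lemma num_columns_transfer : (num_columns B)%:R = rho * (num_columns B')%:R.
Proof.
have := column_sum_transfer (fun _ => 1).
by rewrite !big_const_seq !count_predT !iter_addr_0 !size_cols.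
Qed.

Let mem_column_sizes (A : {set 'I_p * 'I_q}) v :
  (v \in column_sizes A) = (0 < count_cols A v%:R)%N.
Proof.
rewrite /column_sizes mem_sort mem_undup -/(cols A) /count_cols -has_count.
apply/mapP/hasP => [[i iA ->]|[i iA]]; first by exists i.
by rewrite eqr_nat => /eqP <-; exists i.
Qed.

Let column_sizes_sorted (A : {set 'I_p * 'I_q}) : sorted geq (column_sizes A).
Proof. by apply: sort_sorted => x y; apply: leq_total. Qed.

Let column_sizes_uniq (A : {set 'I_p * 'I_q}) : uniq (column_sizes A).
Proof. by rewrite sort_uniq undup_uniq. Qed.

(** Multiplication by [kap] preserves the multiplicities up to [rho], hence the set
    of values, and the decreasing order. *)
Lemma column_sizes_transfer :
  [seq v%:R | v <- column_sizes B] = [seq kap * v%:R | v <- column_sizes B'].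
Proof.
apply: (@sorted_eq _ (fun x y : R => y <= x)).
- by move=> x y z h1 h2; apply: le_trans h2 h1.
- by move=> x y /andP[h1 h2]; apply/eqP; rewrite eq_le h1 h2.
- rewrite sorted_map; apply: sub_sorted (column_sizes_sorted B) => x y /=.
  by rewrite ler_nat.
- rewrite sorted_map; apply: sub_sorted (column_sizes_sorted B') => x y /=.
  by move=> yx; rewrite ler_pM2l // ler_nat.
apply: uniq_perm.
- rewrite map_inj_uniq ?column_sizes_uniq // => x y /eqP; rewrite eqr_nat => /eqP; exact.
- rewrite map_inj_uniq ?column_sizes_uniq // => x y /(mulfI (lt0r_neq0 kap0)) /eqP.
  by rewrite eqr_nat => /eqP; exact.
have pos x : (0 < count_cols B (kap * x))%N = (0 < count_cols B' x)%N.
  by rewrite -(ltr0n R) count_transfer pmulr_rgt0 // ltr0n.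
move=> x; apply/mapP/mapP => [[v vB ->]|[v vB ->]].
- have : (0 < count_cols B v%:R)%N by rewrite -mem_column_sizes.
  rewrite -[v%:R](divfK (lt0r_neq0 kap0)) mulrC pos => h.
  have := h; rewrite /count_cols -has_count => /hasP[i iB /eqP e].
  exists (column_size B' i); last by rewrite e.
  by rewrite mem_column_sizes e.
- have : (0 < count_cols B' v%:R)%N by rewrite -mem_column_sizes.
  rewrite -pos => h; have := h; rewrite /count_cols -has_count => /hasP[i iB /eqP e].
  exists (column_size B i); last by rewrite e.
  by rewrite mem_column_sizes e.
Qed.

Lemma num_sizes_transfer : num_sizes B = num_sizes B'.
Proof. by rewrite /num_sizes -(size_map (fun v => v%:R : R)) column_sizes_transfer size_map. Qed.

Lemma size_val_transfer k : (k < num_sizes B)%N ->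
  (size_val B k)%:R = kap * (size_val B' k)%:R.
Proof.
move=> kB; have kB' : (k < num_sizes B')%N by rewrite -num_sizes_transfer.
rewrite /size_val -(nth_map 0%N 0 (fun v => v%:R : R)) // column_sizes_transfer.
by rewrite (nth_map 0%N).
Qed.

Lemma size_val_gt0 (A : {set 'I_p * 'I_q}) k : (k < num_sizes A)%N -> (0 < size_val A k)%N.
Proof.
move=> kA; have : size_val A k \in column_sizes A by rewrite mem_nth.
rewrite mem_column_sizes /count_cols -has_count => /hasP[i iA].
by rewrite eqr_nat => /eqP <-; rewrite -mem_cols.
Qed.

Let size_mult_count (A : {set 'I_p * 'I_q}) k : (k < num_sizes A)%N ->
  size_mult A k = count_cols A (size_val A k)%:R.
Proof.
move=> kA; have v0 := size_val_gt0 kA.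
rewrite /size_mult /count_cols cardsE cardE size_filter /cols count_filter enumT.
apply: eq_count => i /=; rewrite unfold_in /= eqr_nat.
by rewrite eqnE; have [->|] := eqVneq (column_size A i) (size_val A k); rewrite ?v0.
Qed.

Lemma size_mult_transfer k : (k < num_sizes B)%N ->
  (size_mult B k)%:R = rho * (size_mult B' k)%:R.
Proof.
move=> kB; have kB' : (k < num_sizes B')%N by rewrite -num_sizes_transfer.
by rewrite !size_mult_count // size_val_transfer // count_transfer.
Qed.

Lemma size_mult_gt0 (A : {set 'I_p * 'I_q}) k : (k < num_sizes A)%N -> (0 < size_mult A k)%N.
Proof.
move=> kA; rewrite size_mult_count // -mem_column_sizes; exact: mem_nth.
Qed.

End SameGrid.

(** On one grid the equality of the exponents is affine in the two logarithms
    [P] and [P'] of the power sums, with the same coefficient [b - a], so that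
    [P - P'] is an affine function of [t]. Hence the sizes of the columns are
    proportional with ratio [expR kp], and their multiplicities with ratio
    [expR (- r)], where [kp = r * b / a]. *)
Lemma same_grid_parameters (R : realType) (p q : nat) (B B' : {set 'I_p * 'I_q})
    (X X' : set (R * R)) :
  bm_carpet B X -> bm_carpet B' X' ->
  (forall t : R, Lq_exponent B t = Lq_exponent B' t) ->
  num_sizes B = num_sizes B' /\
  forall k : nat, (k < num_sizes B)%N ->
    (size_val B k)%:R / (size_val B' k)%:R
      = ((size_mult B' k)%:R / (size_mult B k)%:R) `^ bm_gamma R p q /\
    ((size_mult B' k)%:R / (size_mult B k)%:R) `^ bm_gamma R p q
      = ((num_columns B')%:R / (num_columns B)%:R) `^ bm_gamma R p q.
Proof.
move=> hB hB' hT.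
have [p1 q1] := (carpet_m_gt1 hB, carpet_n_gt1 hB).
set a : R := ln p%:R; set b : R := ln q%:R.
have a0 : 0 < a by rewrite ln_gt0 // ltr1n.
have ab : a < b by rewrite ltr_ln ?posrE ?ltr0n ?(ltnW p1) ?(ltnW q1) // ltr_nat (carpet_mn hB).
have b0 : 0 < b by apply: lt_trans ab.
pose D : R := ln #|B|%:R - ln #|B'|%:R.
pose r := D / (b - a) * a; pose kp := D / (b - a) * b.
have [a0' b0'] : a != 0 /\ b != 0 by rewrite !gt_eqF.
have ba0 : b - a != 0 by rewrite subr_eq0 gt_eqF.
have rel t : column_power_sum B t = expR (- r) * (expR kp `^ t * column_power_sum B' t).
  have P0 := column_power_sum_gt0 hB t; have P0' := column_power_sum_gt0 hB' t.
  rewrite -[LHS]lnK ?posrE // -[column_power_sum B' t]lnK ?posrE // -expRM -!expRD; congr expR.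
  have := hT t; rewrite /Lq_exponent -/a -/b.
  set P := ln (column_power_sum B t); set P' := ln (column_power_sum B' t) => e.
  have {}e : (P - P') * (b - a) = D * (t * b - a).
    have : a * b * ((ln #|B|%:R - P) / b + (P - t * ln #|B|%:R) / a) =
           a * b * ((ln #|B'|%:R - P') / b + (P' - t * ln #|B'|%:R) / a) by rewrite e.
    have s (N Q : R) : a * b * ((N - Q) / b + (Q - t * N) / a) = a * (N - Q) + b * (Q - t * N).
      by field; rewrite a0' b0'.
    by rewrite !s /D => e2; nra.
  have -> : P = P' + D * (t * b - a) / (b - a) by rewrite -e mulfK // addrC subrK.
  by rewrite /r /kp; field.
have rho0 := expR_gt0 (- r); have kap0 := expR_gt0 kp.
split; first exact: num_sizes_transfer rho0 kap0 rel.
move=> k kB; have kB' : (k < num_sizes B')%N by rewrite -(num_sizes_transfer rho0 kap0 rel).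
have v' : (size_val B' k)%:R != 0 :> R by rewrite pnatr_eq0 -lt0n (size_val_gt0 (R := R) kB').
have u' : (size_mult B' k)%:R != 0 :> R by rewrite pnatr_eq0 -lt0n (size_mult_gt0 (R := R) kB').
have M' : (num_columns B')%:R != 0 :> R by rewrite pnatr_eq0 -lt0n (num_columns_gt0 hB').
rewrite (size_val_transfer rho0 kap0 rel kB) (size_mult_transfer rho0 kap0 rel kB).
rewrite (num_columns_transfer kap0 rel) mulfK //.
have inv (x : R) : x != 0 -> x / (expR (- r) * x) = expR r.
  by move=> x0; rewrite invfM mulrCA divff // mulr1 -expRN opprK.
rewrite !inv // -expRM /bm_gamma -/a -/b; split => //; congr expR.
by rewrite /r /kp; field; rewrite a0' ba0.
Qed.

(** * A common grid *)

(** Since the two ratios of logarithms agree, [m'] and [n'] are powers of [m] and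
    [n] with one exponent [beta]. Equality of the exponents then says that the power
    sum of [A] to the power [beta] is that of [A'], up to the exponential of an affine
    function, and this makes [beta] rational. *)
Lemma common_grid (R : realType) (m n : nat) (A : {set 'I_m * 'I_n}) (L : set (R * R))
    (m' n' : nat) (A' : {set 'I_m' * 'I_n'}) (L' : set (R * R)) :
  bm_carpet A L -> bm_carpet A' L' -> nonuniform_fibres A ->
  ln n%:R / ln m%:R = ln n'%:R / ln m'%:R :> R ->
  (forall t : R, Lq_exponent A t = Lq_exponent A' t) ->
  exists s t : nat, [/\ (0 < s)%N, (0 < t)%N, (m ^ s = m' ^ t)%N & (n ^ s = n' ^ t)%N].
Proof.
move=> hL hL' hA hg hT.
have [m1 mn] := (carpet_m_gt1 hL, carpet_mn hL); have [m1' mn'] :=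
  (carpet_m_gt1 hL', carpet_mn hL').
have [n1 n1'] := (carpet_n_gt1 hL, carpet_n_gt1 hL').
have ln0 (k : nat) : (1 < k)%N -> 0 < ln k%:R :> R by move=> k1; rewrite ln_gt0 // ltr1n.
have := ln0 _ m1; have := ln0 _ n1; have := ln0 _ m1'; have := ln0 _ n1'.
move: hg hT; rewrite /Lq_exponent.
have mn0 : ln m%:R < ln n%:R :> R by rewrite ltr_ln ?posrE ?ltr0n ?(ltnW m1) ?(ltnW n1) // ltr_nat.
move: mn0; set a := ln m%:R; set b := ln n%:R; set a' := ln m'%:R; set b' := ln n'%:R.
move=> ab hg hT b0' a0' b0 a0.
pose beta : R := a' / a; have beta0 : 0 < beta by rewrite divr_gt0.
have ea : a' = beta * a by rewrite /beta divfK // gt_eqF.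
have eb : b' = beta * b.
  by rewrite /beta mulrAC -mulrA hg mulrC divfK // gt_eqF.
have [a1 b1] : a != 0 /\ b != 0 by rewrite !gt_eqF.
have be1 : beta != 0 by rewrite gt_eqF.
have ba0 : b - a != 0 by rewrite subr_eq0 gt_eqF.
set N : R := ln #|A|%:R in hT; set N' : R := ln #|A'|%:R in hT.
pose A0 := a * (N' - beta * N) / (b - a); pose B0 := b * (beta * N - N') / (b - a).
pose s1 := [seq column_size A i | i <- cols A]; pose s2 := [seq column_size A' i | i <- cols A'].
have rel (t : R) : beta * ln (\sum_(v <- s1) v%:R `^ t) = ln (\sum_(v <- s2) v%:R `^ t) + A0 + B0
  * t.
  rewrite !big_map -/(column_power_sum A t) -/(column_power_sum A' t).
  have := hT t; set P := ln _; set P' := ln _; rewrite ea eb => e.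
  have {}e : a * (beta * N - beta * P) + b * (beta * P - t * (beta * N)) = a * (N' - P') + b *
    (P' - t * N').
    have : beta * a * b * ((N - P) / b + (P - t * N) / a) =
        beta * a * b * ((N' - P') / (beta * b) + (P' - t * N') / (beta * a)) by rewrite e.
    have -> : beta * a * b * ((N - P) / b + (P - t * N) / a) =
      a * (beta * N - beta * P) + b * (beta * P - t * (beta * N)) by field; rewrite a1 b1.
    by move=> ->; field; rewrite a1 b1 be1.
  apply: (mulIf ba0); rewrite /A0 /B0 !mulrDl mulrAC divfK // [b * _ / _ * t]mulrAC divfK //.
  by move: e; nra.
have ne1 : s1 != [::].
  by rewrite -size_eq0 size_map size_cols -lt0n (num_columns_gt0 hL).
have ne2 : s2 != [::].
  by rewrite -size_eq0 size_map size_cols -lt0n (num_columns_gt0 hL').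
have pos1 v : v \in s1 -> (0 < v)%N by move=> /mapP[i iA ->]; rewrite -mem_cols.
have pos2 v : v \in s2 -> (0 < v)%N by move=> /mapP[i iA ->]; rewrite -mem_cols.
have two : exists v w, [/\ v \in s1, w \in s1 & v != w].
  have [i [j [iA jA ij _]]] := nonuniform_extremes hA.
  exists (column_size A i), (column_size A j); rewrite !map_f //; split => //.
  by rewrite neq_ltn ij.
have [s [t [s0 t0 e]]] := dirichlet_power_rational ne1 ne2 pos1 pos2 beta0 rel two.
have pow (x y : nat) : (1 < x)%N -> (1 < y)%N -> ln y%:R = beta * ln x%:R -> (x ^ s = y ^ t)%N.
  move=> x1 y1 h; apply/eqP; rewrite -(eqr_nat R) !natrX.
  have [x0 y0] : 0 < x%:R :> R /\ 0 < y%:R :> R by rewrite !ltr0n (ltnW x1) (ltnW y1).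
  apply/eqP; apply: ln_inj; rewrite ?posrE ?exprn_gt0 //.
  rewrite !lnXn // h -(mulr_natr (ln _)) -(mulr_natr (beta * _)) -e; ring.
by exists s, t; split => //; apply: pow.
Qed.

(** * Bi-Lipschitz invariants of carpets *)

Theorem corollary2p10 (R : realType)
    (m n : nat) (A : {set ('I_m * 'I_n)}) (L : set (R * R))
    (m' n' : nat) (A' : {set ('I_m' * 'I_n')}) (L' : set (R * R))
    (nu nu' : probability (R * R)%type R)
    (hL : bm_carpet A L) (hL' : bm_carpet A' L')
    (hA : nonuniform_fibres A) (hA' : nonuniform_fibres A')
    (hbl : bilipschitz_equiv L L')
    (hnu : uniform_bernoulli A nu) (hnu' : uniform_bernoulli A' nu') :
  [/\ forall alpha : R, alpha_min R A < alpha < alpha_max R A ->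
        multifractal_spectrum nu alpha = multifractal_spectrum nu' alpha,
      exists T : R -> R, is_Lq_spectrum nu T /\ is_Lq_spectrum nu' T &
      exists p q : nat,
        [/\ exists B : {set ('I_p * 'I_q)}, bm_carpet B L,
            exists B' : {set ('I_p * 'I_q)}, bm_carpet B' L' &
            forall B B' : {set ('I_p * 'I_q)},
              bm_carpet B L -> bm_carpet B' L' ->
              num_sizes B = num_sizes B' /\
              forall k : nat, (k < num_sizes B)%N ->
                (size_val B k)%:R / (size_val B' k)%:R
                  = ((size_mult B' k)%:R / (size_mult B k)%:R)
                      `^ bm_gamma R p q /\
                ((size_mult B' k)%:R / (size_mult B k)%:R)
                    `^ bm_gamma R p q
                  = ((num_columns B')%:R / (num_columns B)%:R)
                      `^ bm_gamma R p q]].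
Proof.
have [f [C [C1 fL lip]]] := hbl.
have hf : bilip_onto C f L L' by split.
have [g [hg _ _]] := bilip_inverse C1 hf.
have [a1 [a2 [a1A a2A a12]]] := nonuniform_columns hA.
have [a1' [a2' [a1A' a2A' a12']]] := nonuniform_columns hA'.
have hT q : Lq_exponent A q = Lq_exponent A' q :> R.
  apply/eqP; rewrite eq_le (Lq_exponent_le hL hnu a1A a2A a12 q hL' hnu' C1 hf).
  by rewrite (Lq_exponent_le hL' hnu' a1A' a2A' a12' q hL hnu C1 hg).
split.
- move=> alpha _; apply/eqP; rewrite eq_le.
  rewrite (multifractal_spectrum_le hL' hL hnu' hnu C1 hg).
  by rewrite (multifractal_spectrum_le hL hL' hnu hnu' C1 hf).
- exists (Lq_exponent A); split; first exact: (Lq_spectrum_exponent hL hnu a1A a2A a12).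
  rewrite (_ : Lq_exponent A = Lq_exponent A'); last exact/funext.
  exact: (Lq_spectrum_exponent hL' hnu' a1A' a2A' a12').
have hg1 := log_ratio_le hL hL' hnu hnu' C1 hf hA hA' hT.
have hg2 := log_ratio_le hL' hL hnu' hnu C1 hg hA' hA (fun q => esym (hT q)).
have hgam : ln n%:R / ln m%:R = ln n'%:R / ln m'%:R :> R by apply/eqP; rewrite eq_le hg1 hg2.
have [s [t [s0 t0 em en]]] := common_grid hL hL' hA hgam hT.
have hB := iterate_carpet hL s0 erefl erefl.
have hB' := iterate_carpet hL' t0 em en.
exists (m ^ s)%N, (n ^ s)%N; split; [by exists (iterate_set A s _ _)|by exists (iterate_set A' t
  _ _)|].
move=> B B' hBL hBL'.
have -> : B = iterate_set A s (m ^ s)%N (n ^ s)%N.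
  exact: carpet_set_unique hBL hB (interior_point hL hA).
have -> : B' = iterate_set A' t (m ^ s)%N (n ^ s)%N.
  exact: carpet_set_unique hBL' hB' (interior_point hL' hA').
have nuB := iterate_bernoulli hL erefl erefl hnu (s := s).
have nuB' := iterate_bernoulli hL' em en hnu'.
have [b1 [b2 [b1B b2B b12]]] := iterate_columns s0 erefl erefl a1A a2A a12 (s := s).
have [b1' [b2' [b1B' b2B' b12']]] := iterate_columns t0 em en a1A' a2A' a12'.
apply: (same_grid_parameters hB hB') => q; apply/eqP; rewrite eq_le.
rewrite (Lq_exponent_le hB nuB b1B b2B b12 q hB' nuB' C1 hf).
by rewrite (Lq_exponent_le hB' nuB' b1B' b2B' b12' q hB nuB C1 hg).
Qed.
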